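(* Let $d, j \in \mathbb{N}$ and let $\alpha > 0$. Let $f$ be a probability density function on $\mathbb{R}^d$. Suppose that the support of $f$ is a finite union of convex bounded sets with nonempty interior, and that $f$ is bounded away from zero and infinity on its support. Then, as $n \to \infty$, $$ n^{-1} S_{n,\alpha} \to \omega_d^{-\alpha/d} \left( \frac{\Gamma(j+\alpha/d)}{\Gamma(j)} \right) I_{1-\alpha/d}(f), $$ where the convergence holds both in $L^2$ and almost surely.
   Context: $\mathbb{N} = \{1,2,\ldots\}$. For a finite set $\mathcal{X} \subset \mathbb{R}^d$ and $x \in \mathcal{X}$, $D(x,\mathcal{X}) = D_j(x,\mathcal{X})$ denotes the Euclidean distance from $x$ to its $j$th nearest neighbor in $\mathcal{X} \setminus \{x\}$ if $\mathrm{card}(\mathcal{X}) > j$, and $D(x,\mathcal{X}) := 0$ if $\mathrm{card}(\mathcal{X}) \le j$. $(X_i)_{i \in \mathbb{N}}$ is a sequence of independent random vectors in $\mathbb{R}^d$ with common density $f$, $\mathcal{X}_n := \{X_1,\ldots,X_n\}$, and $$S_{n,\alpha} := \sum_{i=1}^n (n^{1/d} D(X_i,\mathcal{X}_n))^{\alpha}.$$ $\omega_d := \pi^{d/2}/\Gamma(1+d/2)$ is the volume of the unit ball in $\mathbb{R}^d$. The support of $f$ is $\mathrm{supp}(f) := \{x \in \mathbb{R}^d : f(x) > 0\}$. For $\rho \in \mathbb{R}$, $I_\rho(f) := \int_{\mathrm{supp}(f)} f(y)^\rho\, dy$ (for $\rho > 0$ this equals $\int_{\mathbb{R}^d} f(y)^\rho\,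 dy$). *)

(* Defs.v *)
From HB Require Import structures.
From mathcomp Require Import all_boot all_order all_algebra finmap.
From mathcomp Require Import all_classical all_reals all_analysis.

Set Implicit Arguments.
Unset Strict Implicit.
Unset Printing Implicit Defensive.

Import Order.TTheory GRing.Theory Num.Theory.
Import numFieldNormedType.Exports.
Local Open Scope classical_set_scope.
Local Open Scope ring_scope.

Definition measure_rV_display : measure_display -> measure_display.
Proof. exact. Qed.

(* Row vectors carry the product sigma-algebra generated by the coordinates;
   for T = R this is the Borel sigma-algebra of R^n. *)
Section measurable_rV.
Context {d} {T : measurableType d}.
Variable n : nat.

Let coors : 'I_n -> 'rV[T]_n -> T := fun i v => v ord0 i.

Let rV_set0 : g_sigma_preimage coors set0.
Proof. exact: sigma_algebra0. Qed.

Let rV_setC A : g_sigma_preimage coors A -> g_sigma_preimage coors (~` A).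
Proof. exact: sigma_algebraC. Qed.

Let rV_bigcup (F : _^nat) : (forall i, g_sigma_preimage coors (F i)) ->
  g_sigma_preimage coors (\bigcup_i (F i)).
Proof. exact: sigma_algebra_bigcup. Qed.

HB.instance Definition _ := @isMeasurable.Build (measure_rV_display d)
  'rV[T]_n (g_sigma_preimage coors) rV_set0 rV_setC rV_bigcup.

End measurable_rV.

Lemma measurable_rV_coord d (T : measurableType d) n (i : 'I_n) :
  measurable_fun [set: 'rV[T]_n] (fun v : 'rV[T]_n => v ord0 i).
Proof.
move=> _ Y mY; rewrite setTI; apply: sub_sigma_algebra => /=.
rewrite -bigcup_seq/=; exists i => /=; first by rewrite mem_index_enum.
by exists Y => //; rewrite setTI.
Qed.

Lemma measurable_fun_rVP d1 d2 (T1 : measurableType d1) (T2 : measurableType d2)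
    n (f : T1 -> 'rV[T2]_n) :
  measurable_fun [set: T1] f <->
  forall i, measurable_fun [set: T1] (fun x => f x ord0 i).
Proof.
split=> [mf i|mf].
  exact: (measurableT_comp (@measurable_rV_coord _ T2 n i) mf).
apply: (@iffRL _ (g_sigma_preimage
    (fun i x => f x ord0 i) `<=` measurable)).
  rewrite (g_sigma_preimage_comp (fun i (v : 'rV[T2]_n) => v ord0 i) f).
  split=> [H A [/= C preC <-]|H _ A mA]; [exact: H | by apply: H; exists A].
apply: smallest_sub; first exact: sigma_algebra_measurable.
rewrite -bigcup_seq => A [i _ [B mB <-]]; exact: mf.
Qed.

Section rV_measure.
Local Open Scope ereal_scope.
Context {R : realType}.

Definition rV_cons n (xv : R * 'rV[R]_n) : 'rV[R]_n.+1 :=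
  row_mx (const_mx xv.1 : 'rV[R]_1) xv.2.

Lemma rV_consE0 n (xv : R * 'rV[R]_n) : rV_cons xv ord0 ord0 = xv.1.
Proof. by rewrite mxE; case: splitP => // j _; rewrite mxE. Qed.

Lemma rV_consES n (xv : R * 'rV[R]_n) i :
  rV_cons xv ord0 (lift ord0 i) = xv.2 ord0 i.
Proof.
rewrite mxE; case: splitP => j /=; first by rewrite [j]ord1.
by rewrite /bump/= => -[/val_inj ->].
Qed.

Lemma measurable_rV_cons n :
  measurable_fun [set: R * 'rV[R]_n] (@rV_cons n).
Proof.
apply/measurable_fun_rVP => i; have [j ->|->] := unliftP ord0 i.
  rewrite [X in measurable_fun _ X](_ : _ =
      fun xv : R * 'rV[R]_n => xv.2 ord0 j); last first.
    by apply/funext => xv; rewrite rV_consES.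
  exact: (measurableT_comp (@measurable_rV_coord _ R n j) measurable_snd).
rewrite [X in measurable_fun _ X](_ : _ = fst); last first.
  by apply/funext => xv; rewrite rV_consE0.
exact: measurable_fst.
Qed.

Section cons_step.
Variables (n : nat) (mu : {sigma_finite_measure set 'rV[R]_n -> \bar R}).

Definition lebesgue_rV_cons : set 'rV[R]_n.+1 -> \bar R :=
  pushforward (@lebesgue_measure R \x mu) (@rV_cons n).

Let rV_cons_preimage A : measurable A -> measurable (@rV_cons n @^-1` A).
Proof.
by move=> mA; rewrite -[X in measurable X]setTI; exact: measurable_rV_cons.
Qed.

Let lebesgue_rV_cons0 : lebesgue_rV_cons set0 = 0.
Proof. by rewrite /lebesgue_rV_cons /pushforward preimage_set0 measure0. Qed.

Let lebesgue_rV_cons_ge0 A : 0 <= lebesgue_rV_cons A.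
Proof. by rewrite /lebesgue_rV_cons /pushforward measure_ge0. Qed.

Let lebesgue_rV_cons_sigma_additive : semi_sigma_additive lebesgue_rV_cons.
Proof.
move=> F mF tF mUF; rewrite /lebesgue_rV_cons /pushforward preimage_bigcup.
apply: measure_semi_sigma_additive.
- by move=> k; exact: rV_cons_preimage.
- apply/trivIsetP => /= a b _ _ ab; rewrite -preimage_setI.
  by move/trivIsetP : tF => /(_ _ _ _ _ ab) ->//; rewrite preimage_set0.
- by rewrite -preimage_bigcup; exact: rV_cons_preimage.
Qed.

HB.instance Definition _ := isMeasure.Build _ _ _ lebesgue_rV_cons
  lebesgue_rV_cons0 lebesgue_rV_cons_ge0 lebesgue_rV_cons_sigma_additive.

Definition rV_uncons (v : 'rV[R]_n.+1) : R * 'rV[R]_n :=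
  (v ord0 ord0, \row_i v ord0 (lift ord0 i)).

Lemma rV_consK : cancel (@rV_cons n) rV_uncons.
Proof.
move=> [x v]; rewrite /rV_uncons rV_consE0; congr pair.
by apply/rowP => i; rewrite mxE rV_consES.
Qed.

Lemma rV_unconsK : cancel rV_uncons (@rV_cons n).
Proof.
move=> v; apply/rowP => i; have [k ->|->] := unliftP ord0 i.
  by rewrite rV_consES mxE.
by rewrite rV_consE0.
Qed.

Lemma measurable_rV_uncons : measurable_fun [set: 'rV[R]_n.+1] rV_uncons.
Proof.
apply/measurable_fun_pairP; split; first exact: measurable_rV_coord.
apply/measurable_fun_rVP => i /=.
rewrite [X in measurable_fun _ X](_ : _ =
    fun v : 'rV[R]_n.+1 => v ord0 (lift ord0 i)).
  exact: measurable_rV_coord.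
by apply/funext => v; rewrite mxE.
Qed.

Let lebesgue_rV_cons_sigma_finite : sigma_finite setT lebesgue_rV_cons.
Proof.
have /sigma_finiteP[F [TF ndF mF]] := sigma_finiteT (@lebesgue_measure R).
have /sigma_finiteP[G [TG ndG mG]] := sigma_finiteT mu.
exists (fun k => rV_uncons @^-1` (F k `*` G k)) => [|k].
  rewrite -preimage_bigcup (_ : \bigcup_k _ = setT) ?preimage_setT//.
  rewrite -setXTT TF TG predeqE => -[x y]; split.
    by move=> [k _ []/= ? ?]; split; exists k.
  move=> [/= [a _ Fax] [b _ Gby]]; exists (maxn a b) => //; split.
  - by move: x Fax; exact/subsetPset/ndF/leq_maxl.
  - by move: y Gby; exact/subsetPset/ndG/leq_maxr.
have [mFk Fk] := mF k; have [mGk Gk] := mG k; split.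
  rewrite -[X in measurable X]setTI; apply: measurable_rV_uncons => //.
  exact: measurableX.
rewrite /lebesgue_rV_cons /pushforward -comp_preimage.
rewrite (_ : _ \o _ = id) ?preimage_id; last first.
  by apply/funext => x /=; rewrite rV_consK.
by rewrite product_measure1E// lte_mul_pinfty// ge0_fin_numE.
Qed.

HB.instance Definition _ := Measure_isSigmaFinite.Build _ _ _ lebesgue_rV_cons
  lebesgue_rV_cons_sigma_finite.

End cons_step.

(* Lebesgue measure on R^n (restricted to Borel sets), as an iterated product;
   [lebesgue_rV_box] below gives the usual characterization on boxes. *)
Fixpoint lebesgue_rV n : {sigma_finite_measure set 'rV[R]_n -> \bar R} :=
  match n with
  | 0 => \d_(0%R : 'rV[R]_0)
  | n'.+1 => lebesgue_rV_cons (lebesgue_rV n')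
  end.

Lemma lebesgue_rV_box n (A : 'I_n -> set R) :
  (forall i, measurable (A i)) ->
  lebesgue_rV n [set v | forall i, A i (v ord0 i)] =
  \prod_(i < n) lebesgue_measure (A i).
Proof.
elim: n A => [|n IH] A mA.
  by rewrite big_ord0 /= diracE mem_set// => -[].
pose B := [set v : 'rV[R]_n | forall i, A (lift ord0 i) (v ord0 i)].
have mB : measurable B.
  rewrite (_ : B = \bigcap_(i in [set: 'I_n])
      ((fun v : 'rV[R]_n => v ord0 i) @^-1` A (lift ord0 i))); last first.
    by apply/seteqP; split=> v /= Bv i; [move=> _|]; exact: Bv.
  apply: fin_bigcap_measurable => // i _.
  by rewrite -[X in measurable X]setTI; exact: measurable_rV_coord.
have AB : @rV_cons n @^-1` [set v | forall i, A i (v ord0 i)] = A ord0 `*` B.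
  apply/seteqP; split=> [[x v]/= Axv|[x v]/= [Ax Bv] i].
    split=> [|i] /=; first by move: (Axv ord0); rewrite rV_consE0.
    by move: (Axv (lift ord0 i)); rewrite rV_consES.
  by have [k ->|->] := unliftP ord0 i; rewrite (rV_consE0, rV_consES).
rewrite big_ord_recl -IH => [|//].
rewrite [LHS](_ : _ = (@lebesgue_measure R \x lebesgue_rV n) (A ord0 `*` B)).
  rewrite product_measure1E //; exact: mA.
by rewrite -AB.
Qed.

End rV_measure.

Section real_constants.
Context {R : realType}.

(* Meaningful for 0 < s, where the integral is finite. *)
Definition Gamma (s : R) : R :=
  (\int[lebesgue_measure]_(t in `]0, +oo[) (t `^ (s - 1) * expR (- t)))%R.

Definition unit_ball_volume (d : nat) : R :=
  pi `^ (d%:R / 2) / Gamma (1 + d%:R / 2).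

End real_constants.

Section nearest_neighbors.
Context {R : realType} {d : nat}.

(* Euclidean distance: the library norm on row vectors is the sup norm. *)
Definition edist (x y : 'rV[R]_d) : R :=
  Num.sqrt (\sum_(i < d) (x ord0 i - y ord0 i) ^+ 2).

(* Distances are sorted with multiplicity, so ties count as distinct
   neighbors; [nth] is 0-indexed while [j] is 1-indexed. *)
Definition nn_dist (j : nat) (x : 'rV[R]_d) (A : {fset 'rV[R]_d}) : R :=
  if (j < #|` A|)%N
  then nth 0 (sort <=%R [seq edist x y | y <- enum_fset (A `\ x)%fset]) j.-1
  else 0.

(* Samples are indexed from 0: x 0, ..., x (n - 1) are the first n points. *)
Definition sample_set (x : nat -> 'rV[R]_d) (n : nat) : {fset 'rV[R]_d} :=
  [fset x i | i in iota 0 n]%fset.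

Definition nn_sum (j : nat) (alpha : R) (x : nat -> 'rV[R]_d) (n : nat) : R :=
  \sum_(i < n)
    (n%:R `^ (d%:R^-1) * nn_dist j (x i) (sample_set x n)) `^ alpha.

End nearest_neighbors.

Section densities.
Context {R : realType} {d : nat}.
Implicit Type f : 'rV[R]_d -> R.

Definition is_pdf f :=
  [/\ measurable_fun [set: 'rV[R]_d] f, forall x, 0 <= f x &
      (\int[lebesgue_rV d]_x (f x)%:E = 1)%E].

(* No closure is taken. *)
Definition supp f : set 'rV[R]_d := [set x | 0 < f x].

Definition I_rho (rho : R) f : \bar R :=
  (\int[lebesgue_rV d]_(y in supp f) ((f y) `^ rho)%:E)%E.

(* [bounded_set] refers to the sup norm, which has the same bounded sets as the
   Euclidean norm; the sets [C i] need be neither open, closed nor disjoint. *)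
Definition convex_body_union (A : set 'rV[R]_d) :=
  exists (m : nat) (C : 'I_m -> set 'rV[R]_d),
    A = \bigcup_i C i /\
    forall i, [/\ convex_set (C i), bounded_set (C i) & (C i)° !=set0].

Definition bounded_away_on_supp f :=
  exists a b : R, 0 < a /\ forall x, supp f x -> a <= f x <= b.

End densities.

Section random_vectors.
Context {disp d' : measure_display} {Omega : measurableType disp}.
Context {T : measurableType d'} {R : realType}.
Variable P : probability Omega R.

Definition mutually_independent (X : nat -> {RV P >-> T}) :=
  forall (J : {fset nat}) (A : nat -> set T),
    (forall i, measurable (A i)) ->
    (P (\bigcap_(i in [set` J]) (X i @^-1` A i)) =
     \prod_(i <- enum_fset J) P (X i @^-1` A i))%E.

End random_vectors.

Definition has_density {disp} {Omega : measurableType disp} {R : realType}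
    {P : probability Omega R} {d : nat} (X : {RV P >-> 'rV[R]_d})
    (f : 'rV[R]_d -> R) :=
  forall A : set 'rV[R]_d, measurable A ->
    (distribution P X A = \int[lebesgue_rV d]_(x in A) (f x)%:E)%E.

(* Main.v *)
From Pilot Require Import Defs.
From HB Require Import structures.
From mathcomp Require Import all_boot all_order all_algebra finmap.
From mathcomp Require Import all_classical all_reals all_analysis.
From mathcomp Require Import measurable_realfun.
From mathcomp Require Import zify lra ring.
Set Implicit Arguments.
Unset Strict Implicit.
Unset Printing Implicit Defensive.
Import Order.TTheory GRing.Theory Num.Theory.
Import numFieldNormedType.Exports.
Local Open Scope classical_set_scope.
Local Open Scope ring_scope.
Local Notation edist := Pilot.Defs.edist.

(** Truncate the rescaled nearest neighbor distances at a level growing like a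
    small power of n.  Given X_1 = x, the number of other points in the ball
    B(x, r) is binomial with success probability F(B(x, r)).  Since translations
    are continuous in L^1, this probability is close in L^1 to omega_d r^d f(x),
    so that the rescaled distance to the power d has the limiting tail
    P(Poisson(omega_d u f(x)) < j); integrating over u and x yields the constant.
    By convexity F(B(x, r)) >= c r^d for x in the support, hence the distances
    have exponential tails, which provide the domination needed for the limit of
    the mean and show that the truncation is eventually inactive.  The truncated
    summands are local, so the Efron-Stein inequality bounds the variance of
    their mean by O(n^(-3/4)).  This yields the convergence in L^2 and, by the
    Borel-Cantelli lemma, the almost sure convergence along n = k^4; the gaps are
    filled using that nearest neighbor distances decrease with the sample size. *)

(** * Poisson and binomial tails *)

Section poisson.
Context {R : realType}.
Implicit Types (u t p : R) (j k m : nat).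

(** As [f] is only measurable, small-ball probabilities are compared with it in L^1 rather than
    pointwise. This suffices: the binomial tail with [m] trials is [m]-Lipschitz in the success
    probability, and the relevant balls have volume of order [1/m]. Truncation replaces the
    geometric fact that a point is among the [j] nearest neighbors of boundedly many others: one
    only counts the points in two balls, and second moments of binomial counts are elementary. The
    exponent of the level is chosen so that the factor lost in the variance, the square of
    level^(alpha + d), is n^(1/4). Along n = k^4 the variance is then O(k^-3), which leaves a factor
    k to spend in Chebyshev's inequality before summing. A gap between fourth powers holds O(k^3)
    points, each contributing at most n^(1/8), about k^(1/2), which is negligible against k^4. In
    L^2, the error where the truncation is active is polynomial in n, while that event has
    probability O(n^-s) for every s. The analysis is done under the law of the whole sequence, so
    that fresh copies and exchanges of points are reindexings of coordinates. *)

Definition poisson_weight j t : R := expR (- t) * t ^+ j / j`!%:R.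

(* The probability that a Poisson variable of parameter [t] is less than [j]. *)
Definition poisson_lt j t : R := \sum_(k < j) poisson_weight k t.

Lemma poisson_ltS j t : poisson_lt j.+1 t = poisson_lt j t + poisson_weight j t.
Proof. by rewrite /poisson_lt big_ord_recr. Qed.

Lemma fact_gt0R k : 0 < k`!%:R :> R.
Proof. by rewrite ltr0n fact_gt0. Qed.

Lemma poisson_weight_ge0 j t : 0 <= t -> 0 <= poisson_weight j t.
Proof.
by move=> t0; rewrite divr_ge0 ?mulr_ge0 ?expR_ge0 ?exprn_ge0 ?ler0n.
Qed.

Lemma expr_fact_le_expR j t : 0 <= t -> t ^+ j / j`!%:R <= expR t.
Proof.
move=> t0; case: j => [|j].
  by rewrite expr0 divr1 -expR0 ler_expR.
apply: le_trans (expR_ge1Dxn j t0).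
by rewrite lerDr.
Qed.

Lemma poisson_weight_le1 j t : 0 <= t -> poisson_weight j t <= 1.
Proof.
move=> t0; rewrite /poisson_weight -mulrA.
apply: (@le_trans _ _ (expR (- t) * expR t)).
  by rewrite ler_wpM2l ?expR_ge0// expr_fact_le_expR.
by rewrite -expRD addNr expR0.
Qed.

(** The next weight, [poisson_weight j.+1 t], is this one times [t / j.+1], and it is at most 1. *)
Lemma poisson_weight_le j t : 0 < t -> poisson_weight j t <= j.+1%:R / t.
Proof.
move=> t0; rewrite ler_pdivlMr//.
have := poisson_weight_le1 j.+1 (ltW t0).
rewrite /poisson_weight exprSr factS natrM => h.
have j0 : 0 < j.+1%:R :> R by [].
rewrite -(@ler_pM2r _ j.+1%:R^-1) ?divff ?gt_eqF// ?invr_gt0//.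
apply: le_trans h; rewrite le_eqVlt; apply/orP; left; apply/eqP.
by field; rewrite !gt_eqF// ?fact_gt0R.
Qed.

Lemma is_derive_poisson_weight0 t :
  is_derive t 1 (poisson_weight 0) (- poisson_weight 0 t).
Proof.
rewrite /poisson_weight (_ : (fun _ => _) = expR \o -%R); last first.
  by apply/funext => s /=; rewrite expr0 divr1 mulr1.
rewrite expr0 divr1 mulr1.
by rewrite -[- expR _]mulrN1; exact: is_derive1_comp.
Qed.

Lemma is_derive_poisson_weightS j t : is_derive t 1 (poisson_weight j.+1)
  (poisson_weight j t - poisson_weight j.+1 t).
Proof.
rewrite /poisson_weight.
have -> : (fun t : R => expR (- t) * t ^+ j.+1 / (j.+1)`!%:R) =
    (j.+1)`!%:R^-1 *: ((expR \o -%R) * (id ^+ j.+1)).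
  by apply/funext => s; rewrite /= fctE /= mulrC /GRing.scale/=; congr (_ * (_ * _)); elim: j.+1 => // k ih; rewrite exprS ih exprS.
have dE : is_derive t 1 (expR \o -%R : R -> R) (- expR (- t)).
  by rewrite -[- expR _]mulrN1; exact: is_derive1_comp.
apply: is_derive_eq.
rewrite /= !fctE /GRing.scale/= mulr1 factS natrM.
have := fact_gt0R j; move: (j`!%:R) => F F0.
by field; rewrite gt_eqF//= -natr1 gt_eqF// natr1.
Qed.

(** The derivative of each weight is the previous weight minus itself, so the sum telescopes to its
    last term. *)
Lemma is_derive_poisson_lt j t :
  is_derive t 1 (poisson_lt j.+1) (- poisson_weight j t).
Proof.
elim: j => [|j ih].
  rewrite (_ : poisson_lt 1 = poisson_weight 0); first exact: is_derive_poisson_weight0.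
  by apply/funext => s; rewrite /poisson_lt big_ord_recl big_ord0 addr0.
rewrite (_ : poisson_lt j.+2 = poisson_lt j.+1 + poisson_weight j.+1); last first.
  by apply/funext => s; rewrite poisson_ltS.
have := is_derive_poisson_weightS j t => ih2.
by apply: is_derive_eq; rewrite addrA addNr add0r.
Qed.

Lemma continuous_poisson_weight j : continuous (poisson_weight j).
Proof.
move=> t; apply: differentiable_continuous; apply/derivable1_diffP.
case: j => [|j].
  by have [] := is_derive_poisson_weight0 t.
by have [] := is_derive_poisson_weightS j t.
Qed.

Lemma continuous_poisson_lt j : continuous (poisson_lt j).
Proof.
move=> t; apply: differentiable_continuous; apply/derivable1_diffP.
case: j => [|j]; last by have [] := is_derive_poisson_lt j t.
rewrite (_ : poisson_lt 0 = cst 0); first exact: derivable_cst.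
by apply/funext => s; rewrite /poisson_lt big_ord0.
Qed.

Lemma poisson_lt_lip j u t : 0 <= u -> u <= t ->
  0 <= poisson_lt j u - poisson_lt j t <= t - u.
Proof.
case: j => [|j] u0 ut; first by rewrite /poisson_lt !big_ord0 subrr lexx subr_ge0.
have [c] := @MVT_segment _ _ _ _ _ ut (fun x _ => is_derive_poisson_lt j x)
  (continuous_subspaceT (@continuous_poisson_lt j.+1)).
rewrite in_itv/= => /andP[uc ct] h.
have c0 := le_trans u0 uc.
rewrite -opprB h mulNr opprK mulr_ge0 ?poisson_weight_ge0 ?subr_ge0//=.
by rewrite ler_piMl ?subr_ge0// poisson_weight_le1.
Qed.

Lemma poisson_lt_lip_norm j u t : 0 <= u -> 0 <= t ->
  `|poisson_lt j u - poisson_lt j t| <= `|u - t|.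
Proof.
move=> u0 t0; wlog ut : u t u0 t0 / u <= t.
  by move=> h; have [/h|/ltW/h] := leP u t; [exact|rewrite distrC (distrC t); exact].
have /andP[h1 h2] := poisson_lt_lip j u0 ut.
by rewrite ger0_norm// distrC ger0_norm// subr_ge0.
Qed.

Lemma poisson_lt_ge0 j t : 0 <= t -> 0 <= poisson_lt j t.
Proof. by move=> t0; rewrite /poisson_lt sumr_ge0// => k _; exact: poisson_weight_ge0. Qed.

Lemma poisson_lt0 j : poisson_lt j 0 = (0 < j)%N%:R.
Proof.
case: j => [|j]; first by rewrite /poisson_lt big_ord0.
rewrite /poisson_lt big_ord_recl big1 ?addr0.
  by rewrite /poisson_weight oppr0 expR0 expr0 divr1 mulr1.
by move=> i _; rewrite /poisson_weight expr0n /= mulr0 mul0r.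
Qed.

Lemma poisson_lt_le1 j t : 0 <= t -> poisson_lt j t <= 1.
Proof.
move=> t0; have /andP[] := poisson_lt_lip j (lexx 0) t0.
rewrite subr_ge0 poisson_lt0 => /le_trans + _; apply.
by case: (0 < j)%N.
Qed.

Lemma poisson_weight_cvg0 j : poisson_weight j t @[t --> +oo] --> (0 : R).
Proof.
apply: (@squeeze_cvgr _ _ _ _ (cst 0) (fun t => j.+1%:R / t)).
- near=> t.
  have t0 : 0 < t by near: t; exact: nbhs_pinfty_gt.
  by apply/andP; split; [exact/poisson_weight_ge0/ltW|exact: poisson_weight_le].
- exact: cvg_cst.
- rewrite -(mulr0 j.+1%:R); apply: cvgMr.
  apply/cvgr0Pnorm_lt => e e0; near=> t.
  have t0 : 0 < t by near: t; exact: nbhs_pinfty_gt.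
  rewrite ger0_norm ?invr_ge0 ?ltW// -[e]invrK ltf_pV2 ?posrE ?invr_gt0//.
  near: t; apply: nbhs_pinfty_gt; exact: num_real.
Unshelve. all: end_near. Qed.

Lemma poisson_lt_cvg0 j : poisson_lt j t @[t --> +oo] --> (0 : R).
Proof.
elim: j => [|j ih].
  rewrite (_ : poisson_lt 0 = cst 0); first exact: cvg_cst.
  by apply/funext => s; rewrite /poisson_lt big_ord0.
under eq_fun do rewrite poisson_ltS.
rewrite -(addr0 0); apply: cvgD => //; exact: poisson_weight_cvg0.
Qed.

(** The antiderivative [- poisson_lt j.+1] vanishes at infinity. This duality between Poisson and
    Gamma tails later turns the limiting Poisson tail into a Gamma integral. *)
Lemma integral_poisson_weight j u : 0 <= u ->
  (\int[lebesgue_measure]_(t in `[u, +oo[) (poisson_weight j t)%:E =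
   (poisson_lt j.+1 u)%:E)%E.
Proof.
move=> u0; rewrite (@ge0_continuous_FTC2y _ _ (fun t => - poisson_lt j.+1 t) _ 0).
- by rewrite EFinN oppeK add0e.
- by move=> x ux; rewrite poisson_weight_ge0// (le_trans u0).
- exact/continuous_subspaceT/continuous_poisson_weight.
- by rewrite -oppr0; apply: cvgN; exact: poisson_lt_cvg0.
- move=> x _; apply: derivableN; by have [] := is_derive_poisson_lt j x.
- by apply: cvgN; apply: cvg_at_right_filter; exact: continuous_poisson_lt.
- move=> x _; rewrite derive1E.
  have h := is_derive_poisson_lt j x.
  by rewrite deriveN ?derive_val ?opprK//; case: h.
Qed.

End poisson.

Section binomial.
Context {R : realType}.
Implicit Types (u t p : R) (j k m : nat).

(* The probability that a binomial variable with parameters [m] and [p] is less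
   than [j], by conditioning on the first trial. *)
Fixpoint binomial_lt m j p : R :=
  if m is m'.+1 then
    if j is j'.+1 then p * binomial_lt m' j' p + (1 - p) * binomial_lt m' j p else 0
  else (0 < j)%N%:R.

Lemma binomial_lt_bounds m j p : 0 <= p <= 1 -> 0 <= binomial_lt m j p <= 1.
Proof.
move=> /andP[p0 p1]; elim: m j => [|m ih] [|j] //=; rewrite ?lexx ?ler01//.
have /andP[a0 a1] := ih j; have /andP[b0 b1] := ih j.+1.
by apply/andP; split; nra.
Qed.

(* Markov's inequality for 2 ^ (- N), N binomial. *)
Lemma binomial_lt_exp m j p : 0 <= p <= 1 ->
  binomial_lt m j p <= 2 ^+ j * (1 - p / 2) ^+ m.
Proof.
move=> /andP[p0 p1]; have q0 : 0 <= 1 - p / 2 by lra.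
elim: m j => [|m ih] [|j] /=.
- by rewrite !expr0 mulr1.
- by rewrite expr0 mulr1 exprn_ege1// ler1n.
- by rewrite mulr_ge0 ?exprn_ge0.
have := ih j; have := ih j.+1; rewrite !exprS.
have e0 : 0 <= 2 ^+ j * (1 - p / 2) ^+ m by rewrite mulr_ge0 ?exprn_ge0.
move: e0; rewrite -!mulrA; set E := 2 ^+ j * _ => e0 h1 h2.
have -> : 2 * (2 ^+ j * ((1 - p / 2) * (1 - p / 2) ^+ m)) = 2 * (1 - p / 2) * E.
  by rewrite /E; ring.
by nra.
Qed.

Lemma binomial_lt_expR m j p : 0 <= p <= 1 ->
  binomial_lt m j p <= 2 ^+ j * expR (- (m%:R * (p / 2))).
Proof.
move=> p01; apply: (le_trans (binomial_lt_exp m j p01)).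
rewrite ler_wpM2l ?exprn_ge0//.
rewrite -[in leRHS]mulrN expRM_natl lerXn2r ?nnegrE ?expR_ge0//.
  by move: p01 => /andP[]; lra.
exact: expR_ge1Dx.
Qed.

Lemma binomial_lt_p1 m j : (j <= m)%N -> binomial_lt m j 1 = 0.
Proof.
elim: m j => [|m ih] [|j] //= jm.
by rewrite ih// mulr0 subrr mul0r addr0.
Qed.

(** Changing the success probability of a single trial costs at most [|p - q|], because two binomial
    tails differ by at most 1; the costs add up over the trials. *)
Lemma binomial_lt_lip m j p q : 0 <= p <= 1 -> 0 <= q <= 1 ->
  `|binomial_lt m j p - binomial_lt m j q| <= m%:R * `|p - q|.
Proof.
move=> p01 q01; elim: m j => [|m ih] [|j] /=; rewrite ?subrr ?normr0 ?mulr_ge0//.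
have -> : p * binomial_lt m j p + (1 - p) * binomial_lt m j.+1 p -
   (q * binomial_lt m j q + (1 - q) * binomial_lt m j.+1 q) =
   p * (binomial_lt m j p - binomial_lt m j q) +
   (1 - p) * (binomial_lt m j.+1 p - binomial_lt m j.+1 q) +
   (p - q) * (binomial_lt m j q - binomial_lt m j.+1 q) by ring.
apply: (le_trans (ler_normD _ _)).
apply: (@le_trans _ _ (m%:R * `|p - q| + `|p - q|)); last by rewrite -natr1 mulrDl mul1r.
apply: lerD.
  apply: (le_trans (ler_normD _ _)); rewrite !normrM.
  move: p01 => /andP[p0 p1].
  rewrite (ger0_norm p0) (@ger0_norm _ (1 - p)) ?subr_ge0//.
  by have := ih j; have := ih j.+1; nra.
rewrite normrM ler_piMr// ler_norml.
have /andP[? ?] := binomial_lt_bounds m j q01.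
by have /andP[? ?] := binomial_lt_bounds m j.+1 q01; apply/andP; split; lra.
Qed.

(** The difference of [poisson_lt j.+1] and [poisson_lt j] is [poisson_weight j], which is minus the
    derivative of [poisson_lt j.+1]. Hence one step of the binomial recursion applied to Poisson
    tails is a first-order Taylor expansion in [p], and only a quadratic remainder is left. *)
Lemma poisson_lt_step j u p : 0 <= u -> 0 <= p ->
  `|poisson_lt j.+1 (u + p) -
    (p * poisson_lt j u + (1 - p) * poisson_lt j.+1 u)| <= 2 * p ^+ 2.
Proof.
move=> u0 p0; have up : u <= u + p by rewrite lerDl.
have [c] := @MVT_segment _ _ _ _ _ up (fun x _ => is_derive_poisson_lt j x)
  (continuous_subspaceT (@continuous_poisson_lt _ j.+1)).
rewrite in_itv/= [u + p - u]addrAC subrr add0r => /andP[uc cp] h.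
have -> : poisson_lt j.+1 (u + p) - (p * poisson_lt j u + (1 - p) * poisson_lt j.+1 u)
    = (poisson_weight j u - poisson_weight j c) * p.
  have -> : poisson_lt j.+1 (u + p) = poisson_lt j.+1 u - poisson_weight j c * p.
    by move: h; rewrite mulNr => h; lra.
  by rewrite !poisson_ltS; ring.
rewrite normrM (ger0_norm p0) expr2 mulrA ler_wpM2r//.
have -> : poisson_weight j u - poisson_weight j c = (poisson_lt j.+1 u - poisson_lt j.+1 c) -
    (poisson_lt j u - poisson_lt j c) by rewrite !poisson_ltS; ring.
have /andP[? ?] := poisson_lt_lip j.+1 u0 uc.
have /andP[? ?] := poisson_lt_lip j u0 uc.
by rewrite ler_norml; apply/andP; split; lra.
Qed.

(** A form of Le Cam's inequality: the recursion averages the errors of the previous stage, so the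
    one-step errors [2 * p ^+ 2] simply add up. *)
Lemma binomial_poisson m j p : 0 <= p <= 1 ->
  `|binomial_lt m j p - poisson_lt j (m%:R * p)| <= 2 * m%:R * p ^+ 2.
Proof.
move=> /andP[p0 p1]; elim: m j => [|m ih] [|j] /=.
- by rewrite mul0r poisson_lt0 subrr normr0 mulr0 mul0r.
- by rewrite mul0r poisson_lt0 subrr normr0 mulr0 mul0r.
- by rewrite /poisson_lt big_ord0 subr0 normr0 mulr_ge0 ?mulr_ge0 ?exprn_ge0.
have mp0 : 0 <= m%:R * p by rewrite mulr_ge0.
rewrite -natr1 (mulrDl _ _ p) mul1r.
have := @poisson_lt_step j _ _ mp0 p0.
have := ih j; have := ih j.+1.
set b1 := binomial_lt m j p; set b2 := binomial_lt m j.+1 p.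
set c1 := poisson_lt j _; set c2 := poisson_lt j.+1 (m%:R * p); set c3 := poisson_lt j.+1 (_ + _).
move=> h2 h1 h3.
have -> : p * b1 + (1 - p) * b2 - c3 =
  (p * (b1 - c1) + (1 - p) * (b2 - c2)) - (c3 - (p * c1 + (1 - p) * c2)) by ring.
apply: (le_trans (ler_normB _ _)).
have -> : 2 * (m%:R + 1) * p ^+ 2 = 2 * m%:R * p ^+ 2 + 2 * p ^+ 2 by ring.
apply: lerD => //; apply: (le_trans (ler_normD _ _)); rewrite !normrM.
by rewrite (ger0_norm p0) (@ger0_norm _ (1 - p)) ?subr_ge0//; nra.
Qed.

End binomial.

(** * The Gamma function *)

Section gamma.
Context {R : realType}.
Notation mu := (@lebesgue_measure R).
Implicit Types (s t a c : R) (j k : nat).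

Lemma powR_le_1Dexpr s t k : 0 <= s -> s <= k%:R -> 0 < t -> t `^ s <= 1 + t ^+ k.
Proof.
move=> s0 sk t0; have [t1|t1] := leP t 1.
  apply: (@le_trans _ _ 1); last by rewrite lerDl exprn_ge0// ltW.
  by rewrite -(powRr0 t) ger_powR// t0 t1.
apply: (@le_trans _ _ (t ^+ k)); last by rewrite lerDr.
by rewrite -powR_mulrn ?(ltW t0)// ler_powR// ltW.
Qed.

Lemma measurable_poisson_weight j (D : set R) :
  measurable_fun D (poisson_weight j).
Proof.
apply: measurable_funTS; apply: continuous_measurable_fun.
exact: continuous_poisson_weight.
Qed.

Lemma measurable_gamma_integrand s (D : set R) :
  measurable_fun D (fun t => t `^ s * expR (- t)).
Proof.
apply: measurable_funM; first exact: measurable_funTS.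
by apply: measurable_funTS; apply: measurableT_comp.
Qed.

Lemma integral0_poisson_weight j :
  (\int[mu]_(t in `]0%R, +oo[) (poisson_weight j t)%:E = 1)%E.
Proof.
rewrite integral_itv_obnd_cbnd; last first.
  apply/measurable_EFinP; exact: measurable_poisson_weight.
by rewrite integral_poisson_weight// poisson_lt0.
Qed.

Lemma integrable_poisson_weight j :
  mu.-integrable `]0%R, +oo[ (fun t => (poisson_weight j t)%:E).
Proof.
have m : measurable_fun (`]0%R, +oo[%classic : set R) (fun t : R => (poisson_weight j t)%:E).
  apply/measurable_EFinP; exact: measurable_poisson_weight.
apply/integrableP; split => //.
rewrite [ltLHS](_ : _ = 1%E) ?ltry// -(integral0_poisson_weight j).
apply: eq_integral => t; rewrite inE/= in_itv/= andbT => t0.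
by rewrite /= ger0_norm// poisson_weight_ge0// ltW.
Qed.

(** With [1 <= s] the integrand has no singularity at 0 and is dominated by [poisson_weight 0] plus
    a multiple of [poisson_weight k] for an integer [k] above [s - 1]. *)
Lemma integrable_gamma s : 1 <= s ->
  mu.-integrable `]0%R, +oo[ (fun t => (t `^ (s - 1) * expR (- t))%:E).
Proof.
move=> s1; pose k := (Num.truncn (s - 1)).+1.
have s0 : 0 <= s - 1 by rewrite subr_ge0.
have sk : s - 1 <= k%:R by apply/ltW; have /andP[] := truncn_itv s0.
have ig : mu.-integrable `]0%R, +oo[
    (fun t => (poisson_weight 0 t)%:E + (k`!%:R)%:E * (poisson_weight k t)%:E)%E.
  apply: integrableD => //; first exact: integrable_poisson_weight.
  by apply: integrableZl => //; exact: integrable_poisson_weight.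
apply: le_integrable ig => //.
- by apply/measurable_EFinP; exact: measurable_gamma_integrand.
- move=> t /=; rewrite in_itv/= andbT => t0.
  rewrite lee_fin !ger0_norm ?addr_ge0 ?mulr_ge0 ?powR_ge0 ?expR_ge0 ?poisson_weight_ge0 ?exprn_ge0 ?(ltW t0)//.
  rewrite /poisson_weight expr0 divr1 mulr1 [k`!%:R * _]mulrC divfK; last by rewrite gt_eqF// fact_gt0R.
  rewrite mulrC -[leRHS](_ : expR (- t) * (1 + t ^+ k) = _); last by rewrite mulrDr mulr1.
  by rewrite ler_wpM2l ?expR_ge0// powR_le_1Dexpr.
Qed.

Lemma GammaE s : 1 <= s ->
  ((Gamma s)%:E = \int[mu]_(t in `]0%R, +oo[) (t `^ (s - 1) * expR (- t))%:E)%E.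
Proof.
move=> s1; rewrite /Gamma /Rintegral fineK//.
exact/integrable_fin_num/integrable_gamma.
Qed.

Lemma Gamma_nat j : Gamma j.+1%:R = j`!%:R :> R.
Proof.
apply: EFin_inj; rewrite GammaE ?ler1n//.
rewrite -[RHS]mule1 -(integral0_poisson_weight j) -ge0_integralZl//=.
- apply: eq_integral => t; rewrite inE/= in_itv/= andbT => t0.
  rewrite -EFinM /poisson_weight [j`!%:R * _]mulrC divfK; last by rewrite gt_eqF// fact_gt0R.
  by rewrite -natr1 addrK powR_mulrn 1?mulrC// ltW.
- apply/measurable_EFinP; exact: measurable_poisson_weight.
- by move=> t; rewrite in_itv/= andbT => t0; rewrite lee_fin poisson_weight_ge0// ltW.
Qed.

Lemma powR_le_iff c a y g : 0 < c -> 0 < a -> 0 <= y -> 0 <= g ->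
  (c * y `^ a^-1 <= g) = (y <= (g / c) `^ a).
Proof.
move=> c0 a0 y0 g0; rewrite mulrC -ler_pdivlMr//.
have ya : (y `^ a^-1) `^ a = y by rewrite -powRrM mulVf ?gt_eqF// powRr1.
apply/idP/idP => h.
  by rewrite -ya ge0_ler_powR ?nnegrE ?powR_ge0 ?(ltW a0)// divr_ge0// ltW.
have gc : 0 <= g / c by rewrite divr_ge0// ltW.
have -> : g / c = ((g / c) `^ a) `^ a^-1 by rewrite -powRrM divff ?gt_eqF// powRr1.
by rewrite ge0_ler_powR ?nnegrE ?powR_ge0 ?invr_ge0 ?(ltW a0).
Qed.

Lemma integral_poisson_powR c a j : 0 < c -> 0 < a ->
  (\int[mu]_(y in `[0%R, +oo[) (poisson_lt j.+1 (c * y `^ a^-1))%:E =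
   (c `^ (- a) * (Gamma (j.+1%:R + a) / Gamma j.+1%:R))%:E)%E.
Proof.
move=> c0 a0.
pose b (p : R * R) : bool := [&& 0 <= p.1, 0 <= p.2 & c * p.1 `^ a^-1 <= p.2].
pose h (p : R * R) : \bar R := (poisson_weight j p.2 * (b p)%:R)%:E.
have mb : measurable_fun setT b.
  apply: measurable_and; first exact: measurable_fun_ler.
  apply: measurable_and; first exact: measurable_fun_ler.
  apply: measurable_fun_ler => //; apply: measurable_funM => //.
  by apply: (measurableT_comp (measurable_powR _)).
have mh : measurable_fun setT h.
  apply/measurable_EFinP; apply: measurable_funM.
    apply: (measurableT_comp _ measurable_snd).
    exact: measurable_poisson_weight.
  rewrite (_ : (fun p => _) = \1_[set p | b p]); last first.
    by apply/funext => p; rewrite indicE mem_setE.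
  apply: measurable_indic.
  by rewrite -[X in measurable X]setTI; apply: mb => //; exact: (measurable_set1 true).
have h0 p : (0 <= h p)%E.
  rewrite lee_fin /b; case: and3P => [[_ p0 _]|_]; last by rewrite mulr0.
  by rewrite mulr1 poisson_weight_ge0.
transitivity (\int[mu]_y \int[mu]_g h (y, g))%E.
  rewrite integral_mkcond; apply: eq_integral => y _; rewrite patchE.
  case: ifPn => [|]; last first.
    rewrite notin_setE/= in_itv/= andbT => /negP y0.
    by rewrite integral0_eq// => g _; rewrite /h /b /= (negbTE y0) mulr0.
  rewrite inE/= in_itv/= andbT => y0.
  have cy : 0 <= c * y `^ a^-1 by rewrite mulr_ge0 ?powR_ge0// ltW.
  rewrite -integral_poisson_weight// integral_mkcond; apply: eq_integral => g _.
  rewrite patchE mem_setE in_itv/= andbT /h /b /= y0 /=.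
  case: ifPn => [gy|_]; first by rewrite (le_trans cy gy) mulr1.
  by rewrite andbF mulr0.
rewrite fubini_tonelli//.
transitivity (\int[mu]_(g in `]0%R, +oo[)
    ((c `^ (- a) / j`!%:R)%:E * (g `^ (j.+1%:R + a - 1) * expR (- g))%:E))%E.
  rewrite integral_itv_obnd_cbnd; last first.
    apply: measurable_funeM; apply/measurable_EFinP.
    exact: measurable_gamma_integrand.
  rewrite [RHS]integral_mkcond; apply: eq_integral => g _; rewrite patchE.
  rewrite mem_setE in_itv/= andbT; case: ifPn => g0; last first.
    by rewrite integral0_eq// => y _; rewrite /h /b /= (negbTE g0) andbF mulr0.
  have gca : 0 <= (g / c) `^ a by exact: powR_ge0.
  transitivity (\int[mu]_y ((poisson_weight j g)%:E * (\1_`[0%R, (g / c) `^ a] y)%:E))%E.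
    apply: eq_integral => y _; rewrite /h /b /= g0 /= EFinM; congr (_ * (_)%:E)%E.
    rewrite indicE mem_setE in_itv/=.
    by case: (boolP (0 <= y)) => //= y0; rewrite powR_le_iff.
  rewrite ge0_integralZl//=; last 2 first.
  - by apply/measurable_EFinP; exact: measurable_indic.
  - by rewrite lee_fin poisson_weight_ge0.
  rewrite integral_indic//= setIT lebesgue_measure_itv/= lte_fin.
  rewrite (_ : (if _ then _ else _) = ((g / c) `^ a)%:E); last first.
    by move: gca; rewrite le_eqVlt => /predU1P[<-|->]; rewrite ?ltxx// oppr0 adde0.
  rewrite -!EFinM; congr EFin; rewrite /poisson_weight.
  rewrite (_ : j.+1%:R + a - 1 = j%:R + a); last by rewrite -natr1; ring.
  have [->|gn0] := eqVneq g 0.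
    by rewrite mul0r !powR0 ?gt_eqF ?ltr_wpDl// mul0r !mulr0.
  rewrite powRD ?gn0 ?implybT// powR_mulrn// powRM// ?invr_ge0 ?(ltW c0)//.
  rewrite -[c^-1]powR_inv1 ?(ltW c0)// -powRrM mulN1r.
  by ring.
rewrite ge0_integralZl//=; last 3 first.
- by apply/measurable_EFinP; exact: measurable_gamma_integrand.
- by move=> g _; rewrite lee_fin mulr_ge0 ?powR_ge0 ?expR_ge0.
- by rewrite lee_fin divr_ge0 ?powR_ge0.
rewrite -GammaE; last by rewrite -natr1 addrAC lerDr addr_ge0// ltW.
by rewrite -EFinM Gamma_nat mulrAC mulrA.
Qed.

End gamma.

(** * Lebesgue measure of Euclidean balls *)

Section affine.
Context {R : realType}.

Lemma mule_cancel3 (u r s : R) (x y : \bar R) : u * (r * s) = 1 ->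
  (u%:E * ((r%:E * x) * (s%:E * y)) = x * y)%E.
Proof.
by move=> h; rewrite -!muleA (muleCA x) !muleA -!EFinM -mulrA h mul1e.
Qed.

Lemma lebesgue_measure_affine (x t : R) (A : set R) : 0 < t -> measurable A ->
  (lebesgue_measure ((fun v => (x + t * v)%R) @^-1` A) =
   (t^-1)%:E * lebesgue_measure A)%E.
Proof.
move=> t0 mA.
have mh : measurable_fun [set: measurableTypeR R]
    ((fun v => x + t * v) : _ -> measurableTypeR R).
  by apply: measurable_funD => //; exact: measurable_funM.
pose m' : {measure set (measurableTypeR R) -> \bar R} :=
  mscale (NngNum (ltW t0)) (pushforward lebesgue_measure
    ((fun v => x + t * v) : measurableTypeR R -> measurableTypeR R)).
rewrite (@lebesgue_measure_unique _ (m' mh) _ A mA).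
  by rewrite /m' /= /mscale /= /pushforward muleA -EFinM mulVf ?gt_eqF// mul1e.
move=> X [[a b] _ <-] /=; rewrite /mscale /= /pushforward.
have -> : (fun v => (x + t * v)%R) @^-1` `]a, b]%classic =
    `]((a - x) / t), ((b - x) / t)]%classic.
  apply/seteqP; split=> v /=; rewrite !in_itv/= ltr_pdivrMr// ler_pdivlMr//;
    by rewrite ltrBlDr lerBrDr (mulrC v) (addrC x).
rewrite !lebesgue_measure_itv/= !lte_fin ltr_pM2r ?invr_gt0// ltrD2r.
case: ifP => _; last by rewrite mule0.
rewrite -!EFinD -EFinM; congr EFin.
by rewrite -mulrBl opprB addrA subrK mulrC divfK// gt_eqF.
Qed.

Lemma measurable_rV_affine n (x : 'rV[R]_n) (t : R) :
  measurable_fun setT (fun v : 'rV[R]_n => x + t *: v).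
Proof.
apply/measurable_fun_rVP => i.
rewrite [X in measurable_fun _ X](_ : _ = fun v : 'rV[R]_n => x ord0 i + t * v ord0 i).
  by apply: measurable_funD => //; apply: measurable_funM => //; exact: measurable_rV_coord.
by apply/funext => v; rewrite !mxE.
Qed.

Lemma measurable_rV_preimage n (h : 'rV[R]_n -> 'rV[R]_n) (A : set 'rV[R]_n) :
  measurable_fun setT h -> measurable A -> measurable (h @^-1` A).
Proof. by move=> mh mA; rewrite -[X in measurable X]setTI; exact: mh. Qed.

(** By induction along the iterated product: in head and tail coordinates the map acts on each
    factor separately, and a measure that has the right values on rectangles is the product
    measure. *)
Lemma lebesgue_rV_affine n (x : 'rV[R]_n) (t : R) (A : set 'rV[R]_n) :
  0 < t -> measurable A ->
  (lebesgue_rV n ((fun v => (x + t *: v)%R) @^-1` A) =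
   (t^-1 ^+ n)%:E * lebesgue_rV n A)%E.
Proof.
elim: n x A => [|n IH] x A t0 mA.
  rewrite expr0 mul1e /= (_ : (fun v => (x + t *: v)%R) = id) ?preimage_id//.
  by apply/funext => v; apply/rowP => -[].
pose x0 := x ord0 ord0; pose x' : 'rV[R]_n := \row_i x ord0 (lift ord0 i).
have mh0 : measurable_fun [set: measurableTypeR R]
    ((fun v => x0 + t * v) : _ -> measurableTypeR R).
  by apply: measurable_funD => //; exact: measurable_funM.
pose h (p : measurableTypeR R * 'rV[R]_n) : measurableTypeR R * 'rV[R]_n :=
  (x0 + t * p.1, x' + t *: p.2).
have mh : measurable_fun setT h.
  apply/measurable_fun_pairP; split.
    exact: (measurableT_comp mh0 measurable_fst).
  exact: (measurableT_comp (measurable_rV_affine x' t) measurable_snd).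
have tn0 : 0 <= t ^+ n.+1 by rewrite exprn_ge0// ltW.
pose m' : {measure set (measurableTypeR R * 'rV[R]_n) -> \bar R} :=
  mscale (NngNum tn0) (pushforward (@lebesgue_measure R \x lebesgue_rV n)%E h).
have mcA : measurable (@rV_cons R n @^-1` A).
  by rewrite -[X in measurable X]setTI; exact: measurable_rV_cons.
have E : ((lebesgue_measure \x lebesgue_rV n)%E (@rV_cons R n @^-1` A) =
    m' mh (@rV_cons R n @^-1` A))%E.
  apply: product_measure_unique => // B C mB mC.
  rewrite /m' /= /mscale /= /pushforward.
  rewrite (_ : h @^-1` (B `*` C) = ((fun v => (x0 + t * v)%R) @^-1` B) `*`
    ((fun v => (x' + t *: v)%R) @^-1` C)); last first.
    by apply/seteqP; split=> -[].
  rewrite product_measure1E//; last 2 first.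
  - by rewrite -[X in measurable X]setTI; exact: mh0.
  - by apply: measurable_rV_preimage => //; exact: measurable_rV_affine.
  transitivity ((t ^+ n.+1)%:E *
      (((t^-1)%:E * lebesgue_measure B) * ((t^-1 ^+ n)%:E * lebesgue_rV n C)))%E.
    by congr (_ * (_ * _))%E; [exact: lebesgue_measure_affine | exact: IH].
  apply: mule_cancel3.
  by rewrite -exprS -exprMn divff ?gt_eqF// expr1n.
rewrite /= /lebesgue_rV_cons /pushforward E /m' /= /mscale /pushforward /=.
rewrite muleA -EFinM -exprMn mulVf ?gt_eqF// expr1n mul1e.
have hE p : x + t *: rV_cons p = rV_cons (h p).
  apply/rowP => i; have [k ->|->] := unliftP ord0 i.
    by rewrite rV_consES !mxE -[in RHS]rV_consES mxE.
  by rewrite rV_consE0 2!mxE rV_consE0.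
by congr (_ _); apply/seteqP; split=> p /=; rewrite hE.
Qed.

Lemma ge0_integral_affine n (x : 'rV[R]_n) (t : R) (h : 'rV[R]_n -> \bar R) :
  0 < t -> measurable_fun setT h -> (forall v, 0 <= h v)%E ->
  (\int[lebesgue_rV n]_v h (x + t *: v)%R =
   (t^-1 ^+ n)%:E * \int[lebesgue_rV n]_v h v)%E.
Proof.
move=> t0 mh h0.
have tn0 : 0 <= t^-1 ^+ n by rewrite exprn_ge0// invr_ge0 ltW.
have mx := @measurable_rV_affine n x t.
rewrite -(@ge0_integral_mscale _ _ _ (lebesgue_rV n) _ measurableT (NngNum tn0))//.
rewrite -[LHS](@ge0_integral_pushforward _ _ _ _ _ _ mx _ setT h)//.
by apply: eq_measure_integral => A mA _; rewrite /= /mscale /= -(lebesgue_rV_affine x).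
Qed.

End affine.

Section euclidean_ball.
Context {R : realType}.
Implicit Types n : nat.

Definition eball n (x : 'rV[R]_n) (r : R) : set 'rV[R]_n :=
  [set y | edist x y <= r].

Lemma edist_ge0 n (x y : 'rV[R]_n) : 0 <= edist x y.
Proof. exact: sqrtr_ge0. Qed.

Lemma edistC n (x y : 'rV[R]_n) : edist x y = edist y x.
Proof.
by rewrite /edist; congr Num.sqrt; apply: eq_bigr => i _; rewrite -sqrrN opprB.
Qed.

Lemma edist_affine n (x v : 'rV[R]_n) (t : R) : 0 <= t ->
  edist x (x + t *: v) = t * edist 0 v.
Proof.
move=> t0; rewrite /edist.
have -> : \sum_(i < n) (x ord0 i - (x + t *: v) ord0 i) ^+ 2 =
    t ^+ 2 * \sum_(i < n) ((0 : 'rV[R]_n) ord0 i - v ord0 i) ^+ 2.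
  by rewrite mulr_sumr; apply: eq_bigr => i _; rewrite !mxE -exprMn; congr (_ ^+ 2); ring.
by rewrite sqrtrM ?sqr_ge0// sqrtr_sqr ger0_norm.
Qed.

Lemma edist_le_coord n (x y : 'rV[R]_n) (r : R) i :
  edist x y <= r -> `|x ord0 i - y ord0 i| <= r.
Proof.
apply: le_trans; rewrite -sqrtr_sqr ler_sqrt.
  by rewrite (bigD1 i)//= lerDl sumr_ge0// => k _; exact: sqr_ge0.
by rewrite sumr_ge0// => k _; exact: sqr_ge0.
Qed.

Lemma edist_le_sup n (x y : 'rV[R]_n) (r : R) : 0 <= r ->
  (forall i, `|x ord0 i - y ord0 i| <= r) -> edist x y <= n%:R * r.
Proof.
move=> r0 h; rewrite -[leRHS]ger0_norm ?mulr_ge0// -sqrtr_sqr ler_sqrt ?sqr_ge0//.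
apply: (@le_trans _ _ (\sum_(i < n) r ^+ 2)).
  apply: ler_sum => i _; rewrite -real_normK ?num_real//.
  by rewrite lerXn2r ?nnegrE.
rewrite sumr_const card_ord exprMn -[X in X <= _]mulr_natl; apply: ler_wpM2r; rewrite ?sqr_ge0//.
by rewrite -natrX ler_nat; case: n {x y h} => // n; rewrite expnS expn1 leq_pmull.
Qed.

Lemma edistxx n (x : 'rV[R]_n) : edist x x = 0.
Proof.
by rewrite /edist big1 ?sqrtr0// => i _; rewrite subrr expr0n.
Qed.

Lemma edist0_eq n (x y : 'rV[R]_n) : edist x y <= 0 -> x = y.
Proof.
move=> h; apply/rowP => i; apply/eqP; rewrite -subr_eq0 -normr_le0.
exact: edist_le_coord.
Qed.

Lemma measurable_fun_edist d (T : measurableType d) n (g h : T -> 'rV[R]_n) :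
  measurable_fun setT g -> measurable_fun setT h ->
  measurable_fun setT (fun t => edist (g t) (h t)).
Proof.
move=> mg mh; have msq : measurable_fun setT (@Num.sqrt R).
  by apply: continuous_measurable_fun; exact: sqrt_continuous.
apply: (measurableT_comp msq).
apply: measurable_sum => i; apply: measurable_funX; apply: measurable_funB.
  exact: (measurableT_comp (@measurable_rV_coord _ R n i) mg).
exact: (measurableT_comp (@measurable_rV_coord _ R n i) mh).
Qed.

Lemma measurable_le d (T : measurableType d) (g h : T -> R) :
  measurable_fun setT g -> measurable_fun setT h ->
  measurable [set t | g t <= h t].
Proof.
move=> mg mh.
by have /(_ measurableT [set true]) := measurable_fun_ler mg mh; rewrite setTI; exact.
Qed.

Lemma measurable_eball n (x : 'rV[R]_n) (r : R) : measurable (eball x r).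
Proof.
apply: measurable_le => //; apply: measurable_fun_edist => //.
Qed.

Lemma measurable_eball_pair n (r : R) :
  measurable [set p : 'rV[R]_n * 'rV[R]_n | edist p.1 p.2 <= r].
Proof.
by apply: measurable_le => //; exact: measurable_fun_edist.
Qed.

Definition box n (M : R) : set 'rV[R]_n := [set v | forall i, `[- M, M]%classic (v ord0 i)].
Arguments box : clear implicits.

Lemma lebesgue_rV_cube n (M : R) : 0 <= M ->
  lebesgue_rV n (box n M) = ((2 * M) ^+ n)%:E.
Proof.
move=> M0; rewrite (@lebesgue_rV_box _ n (fun=> `[- M, M]%classic))//.
rewrite (eq_bigr (fun=> (2 * M)%:E)).
  by rewrite prodEFin big_const_ord iter_mulr_1.
move=> i _; rewrite lebesgue_measure_itv/= lte_fin.
case: ifPn => [_|]; first by rewrite -EFinD; congr EFin; lra.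
by rewrite -leNgt => h; congr EFin; lra.
Qed.

Lemma measurable_rV_box n (A : 'I_n -> set R) : (forall i, measurable (A i)) ->
  measurable [set v : 'rV[R]_n | forall i, A i (v ord0 i)].
Proof.
move=> mA; rewrite (_ : [set _ | _] = \bigcap_(i in [set: 'I_n])
      ((fun v : 'rV[R]_n => v ord0 i) @^-1` A i)); last first.
  by apply/seteqP; split=> v /= Bv i; [move=> _|]; exact: Bv.
apply: fin_bigcap_measurable => // i _.
by rewrite -[X in measurable X]setTI; exact: measurable_rV_coord.
Qed.

Lemma measurable_cube n M : measurable (box n M).
Proof. by apply: (@measurable_rV_box n (fun=> `[- M, M]%classic)) => i; exact: measurable_itv. Qed.

Definition ball_vol n : R := fine (lebesgue_rV n (eball 0 1)).

Lemma lebesgue_eball_lty n : (lebesgue_rV n (eball 0 1) < +oo)%E.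
Proof.
apply: (@le_lt_trans _ _ (lebesgue_rV n (box n 1))); last by rewrite lebesgue_rV_cube// ltry.
apply: le_measure; rewrite ?inE; [exact: measurable_eball|exact: measurable_cube|].
move=> v hv i /=; have := edist_le_coord i hv.
by rewrite mxE sub0r normrN ler_norml in_itv.
Qed.

Lemma lebesgue_eball n (x : 'rV[R]_n) (r : R) : 0 < r ->
  lebesgue_rV n (eball x r) = (ball_vol n * r ^+ n)%:E.
Proof.
move=> r0; have := lebesgue_rV_affine x r0 (measurable_eball x r).
have -> : (fun v => x + r *: v) @^-1` eball x r = eball 0 1.
  apply/seteqP; split=> v; rewrite /eball /= edist_affine ?(ltW r0)//.
    by rewrite ger_pMr.
  by move=> h; rewrite ger_pMr.
rewrite -[lebesgue_rV n (eball 0 1)]fineK ?ge0_fin_numE ?lebesgue_eball_lty// -/(ball_vol n).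
move=> /(congr1 (fun z => (r ^+ n)%:E * z)%E).
rewrite muleA -!EFinM -exprMn divff ?gt_eqF// expr1n mul1e => <-.
by rewrite mulrC.
Qed.

(** The measure in dimension 0 is a Dirac mass, whence [0 < n]; in positive dimension the point lies
    in balls of arbitrarily small volume. *)
Lemma lebesgue_rV_set1 n (x : 'rV[R]_n) : (0 < n)%N -> lebesgue_rV n [set x] = 0%E.
Proof.
move=> n0; have ball_vol_ge0 : 0 <= ball_vol n by rewrite /ball_vol fine_ge0.
have sub r : 0 <= r -> [set x] `<=` eball x r by move=> r0 y ->; rewrite /eball /= edistxx.
have le r : 0 < r -> (lebesgue_rV n [set x] <= (ball_vol n * r ^+ n)%:E)%E.
  move=> r0; rewrite -(lebesgue_eball x r0); apply: le_measure; rewrite ?inE.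
  - rewrite (_ : [set x] = eball x 0); first exact: measurable_eball.
    apply/seteqP; split=> y; first by move=> ->; rewrite /eball/= edistxx.
    by move=> /edist0_eq <-.
  - exact: measurable_eball.
  - by apply: sub; exact: ltW.
have fin : lebesgue_rV n [set x] \is a fin_num.
  by rewrite ge0_fin_numE// (le_lt_trans (le 1 _))// ltry.
apply/eqP; rewrite eq_le measure_ge0 andbT -(fineK fin) lee_fin.
apply/ler_addgt0Pl => e e0; rewrite addr0 -lee_fin fineK//.
(* The bound by 1 gives [r ^+ n <= r], so the ball has volume at most
   [(ball_vol n + 1) * r <= e]. *)
pose r := Num.min 1 (e / (ball_vol n + 1)).
have v1 : 0 < ball_vol n + 1 by rewrite ltr_wpDl.
have r0 : 0 < r by rewrite /r lt_min ltr01 divr_gt0.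
apply: (le_trans (le r r0)); rewrite lee_fin.
apply: (@le_trans _ _ ((ball_vol n + 1) * r)).
  apply: ler_pM => //; rewrite ?exprn_ge0 ?(ltW r0) ?lerDl//.
  by rewrite -[leRHS]expr1 ler_wiXn2l ?(ltW r0)// /r ge_min lexx.
by rewrite mulrC -ler_pdivlMr// /r ge_min lexx orbT.
Qed.

Lemma lebesgue_eball_ge0 n (x : 'rV[R]_n) (r : R) : 0 <= r ->
  lebesgue_rV n (eball x r) = (ball_vol n * r ^+ n)%:E.
Proof.
rewrite le_eqVlt => /predU1P[<-|]; last exact: lebesgue_eball.
have E : eball x 0 = [set x].
  apply/seteqP; split=> y; last by move=> ->; rewrite /eball/= edistxx.
  by move=> /edist0_eq <-.
have [n0|n0] := posnP n; last by rewrite E lebesgue_rV_set1// expr0n eqn0Ngt n0 mulr0.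
subst n; rewrite expr0 mulr1 /ball_vol fineK; last first.
  by rewrite ge0_fin_numE// lebesgue_eball_lty.
congr (_ _); apply/seteqP; split=> y _ /=.
- by rewrite /eball /= (_ : y = 0) ?edistxx//; apply/rowP => -[].
- by rewrite /eball /= (_ : y = x) ?edistxx//; apply/rowP => -[].
Qed.

Lemma ball_vol_ge0 n : 0 <= ball_vol n.
Proof. by rewrite /ball_vol fine_ge0. Qed.

End euclidean_ball.
Arguments box {R} n M.

Section ball_volume.
Context {R : realType}.
Notation mu := (@lebesgue_measure R).

Definition sqnorm n (v : 'rV[R]_n) : R := \sum_(i < n) v ord0 i ^+ 2.

Lemma sqnorm_ge0 n (v : 'rV[R]_n) : 0 <= sqnorm v.
Proof. by rewrite /sqnorm sumr_ge0// => i _; exact: sqr_ge0. Qed.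

Lemma measurable_sqnorm n : measurable_fun setT (@sqnorm n).
Proof.
apply: measurable_sum => i; apply: measurable_funX.
exact: measurable_rV_coord.
Qed.

Lemma measurable_gauss_rV n :
  measurable_fun setT (fun v : 'rV[R]_n => (expR (- sqnorm v))%:E).
Proof.
apply/measurable_EFinP; apply: (measurableT_comp (@measurable_expR R)).
apply: (measurableT_comp (@oppr_measurable R setT)).
exact: measurable_sqnorm.
Qed.

Lemma integral_gauss_rV n :
  (\int[lebesgue_rV n]_v (expR (- sqnorm v))%:E = (Num.sqrt pi ^+ n)%:E)%E.
Proof.
elim: n => [|n ih].
  rewrite /= integral_dirac//; last exact: measurable_gauss_rV.
  by rewrite diracT mul1e /sqnorm big_ord0 oppr0 expR0 expr0.
have mg := @measurable_gauss_rV n.+1.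
have mc : measurable_fun [set: measurableTypeR R * 'rV[R]_n] (@rV_cons R n).
  exact: measurable_rV_cons.
have g0 v : (0 <= (expR (- sqnorm v))%:E)%E by rewrite lee_fin expR_ge0.
transitivity (\int[(@lebesgue_measure R \x lebesgue_rV n)%E]_p (expR (- sqnorm (rV_cons p)))%:E)%E.
  by rewrite -[RHS](@ge0_integral_pushforward _ _ _ _ R _ mc
    (@lebesgue_measure R \x lebesgue_rV n)%E setT _ measurableT mg)//.
rewrite fubini_tonelli1//=; last exact: (measurableT_comp mg mc).
rewrite /fubini_F /=.
transitivity (\int[mu]_x ((Num.sqrt pi ^+ n)%:E * (gauss_fun x)%:E))%E.
  apply: eq_integral => x _; rewrite muleC -ih -ge0_integralZl//=.
  - apply: eq_integral => v _; rewrite -EFinM -expRD; congr (expR _)%:E.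
    rewrite /sqnorm big_ord_recl rV_consE0 opprD; congr (_ - _).
    by apply: eq_bigr => i _; rewrite rV_consES.
  - exact: measurable_gauss_rV.
  - by rewrite lee_fin expR_ge0.
rewrite ge0_integralZl//=.
- by rewrite integralT_gauss -EFinM -exprSr.
- by apply/measurable_EFinP; exact: measurable_gauss_fun.
- by move=> x _; rewrite lee_fin gauss_fun_ge0.
Qed.

Lemma eball0_sqnorm n (v : 'rV[R]_n) (t : R) : 0 <= t ->
  (sqnorm v <= t) = (edist 0 v <= Num.sqrt t).
Proof.
move=> t0; rewrite /edist ler_sqrt//; congr (_ <= _).
by apply: eq_bigr => i _; rewrite mxE sub0r sqrrN.
Qed.

(* Both constants are obtained from the integral of exp(-|v|^2): as a product of
   one-dimensional integrals, and by integrating over its superlevel sets, which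
   are balls. *)
Lemma unit_ball_volumeE n : unit_ball_volume n = ball_vol n :> R.
Proof.
pose b (p : 'rV[R]_n * R) : bool := (0 <= p.2) && (sqnorm p.1 <= p.2).
pose h (p : 'rV[R]_n * R) : \bar R := (poisson_weight 0 p.2 * (b p)%:R)%:E.
have mb : measurable_fun setT b.
  apply: measurable_and; first exact: measurable_fun_ler.
  apply: measurable_fun_ler => //.
  exact: (measurableT_comp (@measurable_sqnorm n)).
have mh : measurable_fun setT h.
  apply/measurable_EFinP; apply: measurable_funM.
    apply: (measurableT_comp _ measurable_snd).
    exact: measurable_poisson_weight.
  rewrite (_ : (fun p => _) = \1_[set p | b p]); last first.
    by apply/funext => p; rewrite indicE mem_setE.
  apply: measurable_indic.
  by rewrite -[X in measurable X]setTI; apply: mb => //; exact: (measurable_set1 true).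
have h0 p : (0 <= h p)%E.
  rewrite lee_fin /b; case: andP => [[p0 _]|_]; last by rewrite mulr0.
  by rewrite mulr1 poisson_weight_ge0.
have n1 : 1 <= 1 + n%:R / 2 :> R by rewrite lerDl divr_ge0.
have E1 : (\int[lebesgue_rV n]_v (expR (- sqnorm v))%:E =
    \int[lebesgue_rV n]_v \int[mu]_t h (v, t))%E.
  apply: eq_integral => v _.
  have -> : expR (- sqnorm v) = poisson_lt 1 (sqnorm v).
    by rewrite /poisson_lt big_ord_recl big_ord0 addr0 /poisson_weight expr0 divr1 mulr1.
  rewrite -integral_poisson_weight ?sqnorm_ge0// integral_mkcond; apply: eq_integral => t _.
  rewrite patchE mem_setE in_itv/= andbT /h /b /=.
  case: ifPn => [vt|_]; first by rewrite (le_trans (sqnorm_ge0 v) vt) mulr1.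
  by rewrite andbF mulr0.
have E2 : (\int[lebesgue_rV n]_v (expR (- sqnorm v))%:E =
    (ball_vol n * Gamma (1 + n%:R / 2))%:E)%E.
  rewrite E1 fubini_tonelli// EFinM GammaE//.
  rewrite -ge0_integralZl//=; last 3 first.
  - by apply/measurable_EFinP; exact: measurable_gamma_integrand.
  - by move=> t _; rewrite lee_fin mulr_ge0 ?powR_ge0 ?expR_ge0.
  - by rewrite lee_fin ball_vol_ge0.
  rewrite integral_itv_obnd_cbnd; last first.
    by apply: measurable_funeM; apply/measurable_EFinP; exact: measurable_gamma_integrand.
  rewrite [RHS]integral_mkcond; apply: eq_integral => t _; rewrite patchE.
  rewrite mem_setE in_itv/= andbT; case: ifPn => t0; last first.
    by rewrite integral0_eq// => v _; rewrite /h /b /= (negbTE t0) mulr0.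
  transitivity (\int[lebesgue_rV n]_v ((poisson_weight 0 t)%:E * (\1_(eball 0 (Num.sqrt t)) v)%:E))%E.
    apply: eq_integral => v _; rewrite /h /b /= t0/= EFinM; congr (_ * (_)%:E)%E.
    by rewrite indicE mem_setE eball0_sqnorm.
  rewrite ge0_integralZl//=; last 2 first.
  - by apply/measurable_EFinP; apply: measurable_indic; exact: measurable_eball.
  - by rewrite lee_fin poisson_weight_ge0.
  rewrite integral_indic//=; last exact: measurable_eball.
  rewrite setIT lebesgue_eball_ge0 ?sqrtr_ge0// -!EFinM; congr EFin.
  rewrite addrAC subrr add0r [n%:R / 2]mulrC powRrM powR12_sqrt// powR_mulrn ?sqrtr_ge0//.
  by rewrite /poisson_weight expr0 divr1 mulr1; ring.
have := integral_gauss_rV n; rewrite E2 => -[G].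
have pn0 : 0 < Num.sqrt pi ^+ n :> R by rewrite exprn_gt0// sqrtr_gt0 pi_gt0.
have G0 : Gamma (1 + n%:R / 2) != 0 :> R.
  by apply: contraTneq pn0 => G0; rewrite -G G0 mulr0 ltxx.
rewrite /unit_ball_volume [n%:R / 2]mulrC powRrM powR12_sqrt ?pi_ge0//.
by rewrite powR_mulrn ?sqrtr_ge0// -G [2^-1 * _]mulrC mulfK.
Qed.

Lemma ball_vol_gt0 n : 0 < ball_vol n :> R.
Proof.
rewrite lt_neqAle ball_vol_ge0 andbT; apply/negP => /eqP v0.
(* The points of the cube of half-side [s] have Euclidean norm at most [n * s <= 1], so this cube of
   positive volume fits in the unit ball. *)
pose s : R := (n%:R + 1)^-1.
have s0 : 0 < s by rewrite invr_gt0 ltr_wpDl.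
have : (lebesgue_rV n (box n s) <= lebesgue_rV n (eball 0 1))%E.
  apply: le_measure; rewrite ?inE; [exact: measurable_cube|exact: measurable_eball|].
  move=> v hv; rewrite /eball /=.
  apply: (le_trans (edist_le_sup (r := s) _ _)); first exact: ltW.
    by move=> i; rewrite mxE sub0r normrN ler_norml; have := hv i; rewrite /= in_itv.
  by rewrite /s ler_pdivrMr ?mul1r ?lerDl// ltr_wpDl.
rewrite lebesgue_rV_cube ?(ltW s0)// lebesgue_eball// -v0 mul0r lee_fin leNgt.
by rewrite exprn_gt0// mulr_gt0.
Qed.

End ball_volume.

(** * Sequences of independent points *)

Definition measure_seq_display : measure_display -> measure_display.
Proof. exact. Qed.

(* An alias of [nat -> T] carrying the product sigma-algebra. *)
Definition seqspace (T : Type) := nat -> T.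

Section measurable_seqspace.
Context {d} {T : measurableType d}.

HB.instance Definition _ := Pointed.on (seqspace T).

Definition seq_coord_sets : set (set (seqspace T)) :=
  [set B | exists k A, measurable A /\ B = [set z | A (z k)]].

Let seq_set0 : <<s seq_coord_sets >> set0.
Proof. exact: sigma_algebra0. Qed.

Let seq_setC A : <<s seq_coord_sets >> A -> <<s seq_coord_sets >> (~` A).
Proof. exact: sigma_algebraC. Qed.

Let seq_bigcup (F : _^nat) : (forall i, <<s seq_coord_sets >> (F i)) ->
  <<s seq_coord_sets >> (\bigcup_i (F i)).
Proof. exact: sigma_algebra_bigcup. Qed.

HB.instance Definition _ := @isMeasurable.Build (measure_seq_display d)
  (seqspace T) <<s seq_coord_sets >> seq_set0 seq_setC seq_bigcup.

Lemma measurable_seq_coord k :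
  measurable_fun [set: seqspace T] (fun z : seqspace T => z k).
Proof.
move=> _ A mA; rewrite setTI; apply: sub_sigma_algebra.
by exists k, A.
Qed.

Lemma measurable_fun_seqP d' (S : measurableType d') (h : S -> seqspace T) :
  (forall k, measurable_fun setT (fun s => h s k)) -> measurable_fun setT h.
Proof.
move=> mh; apply: (@measurability _ _ _ _ setT h seq_coord_sets) => //.
by move=> _ [_ [k [A [mA ->]]] <-]; exact: mh.
Qed.

Definition cyl n (A : nat -> set T) : set (seqspace T) :=
  [set z | forall k, (k < n)%N -> A k (z k)].

Lemma measurable_cyl n A : (forall k, measurable (A k)) -> measurable (cyl n A).
Proof.
move=> mA; rewrite (_ : cyl n A = \bigcap_(k in `I_n) ((fun z : seqspace T => z k) @^-1` A k)).
  apply: bigcap_measurableType => k _.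
  by rewrite -[X in measurable X]setTI; exact: measurable_seq_coord.
by apply/seteqP; split=> z /= h k; exact: h.
Qed.

Definition cyls : set (set (seqspace T)) :=
  [set B | exists n A, (forall k, measurable (A k)) /\ B = cyl n A].

Lemma cyls_setI : setI_closed cyls.
Proof.
move=> _ _ [n [A [mA ->]]] [m [B [mB ->]]].
exists (maxn n m), (fun k => (if (k < n)%N then A k else setT) `&` (if (k < m)%N then B k else setT)); split.
  by move=> k; apply: measurableI; case: ifP.
apply/seteqP; split=> z /=.
  by move=> [hA hB] k _; split; case: ifP => // ?; [exact: hA|exact: hB].
move=> h; split=> k kn.
  by have /= := h k; rewrite leq_max kn => /(_ isT) [].
by have /= := h k; rewrite leq_max kn orbT => /(_ isT) [].
Qed.

Lemma measurable_seqE : @measurable _ (seqspace T) = <<s cyls >>.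
Proof.
apply/seteqP; split.
  apply: smallest_sub; first exact: smallest_sigma_algebra.
  move=> _ [k [A [mA ->]]]; apply: sub_sigma_algebra.
  exists k.+1, (fun l => if l == k then A else setT); split.
    by move=> l; case: ifP.
  apply/seteqP; split=> z /=.
    by move=> Az l _; case: eqP => // ->.
  by move=> /(_ k); rewrite eqxx; exact.
apply: smallest_sub; first exact: sigma_algebra_measurable.
by move=> _ [n [A [mA ->]]]; exact: measurable_cyl.
Qed.

Lemma seq_measure_unique {R : realType} (m1 m2 : {measure set (seqspace T) -> \bar R}) :
  (m1 setT < +oo)%E ->
  (forall n A, (forall k, measurable (A k)) -> m1 (cyl n A) = m2 (cyl n A)) ->
  forall B, measurable B -> m1 B = m2 B.
Proof.
move=> moo h B mB; apply: (@measure_unique _ _ _ cyls (fun=> setT)) => //.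
- exact: measurable_seqE.
- exact: cyls_setI.
- move=> _; exists 0%N, (fun=> setT); split=> //.
  by apply/seteqP; split.
- by rewrite bigcup_const//; exists 0%N.
- by move=> _ [n [A [mA ->]]]; exact: h.
Qed.

Definition reindex (s : nat -> nat) (z : seqspace T) : seqspace T := fun k => z (s k).

Lemma measurable_reindex s : measurable_fun setT (reindex s).
Proof. by apply: measurable_fun_seqP => k; exact: measurable_seq_coord. Qed.

End measurable_seqspace.

Section iid.
Context {R : realType} {d} {T : measurableType d}.
Variables (F : probability T R) (mu : probability (seqspace T) R).

Definition iid_law := forall n (A : nat -> set T), (forall k, measurable (A k)) ->
  mu (cyl n A) = (\prod_(k < n) F (A k))%E.

Hypothesis mu_iid : iid_law.

(** Along an injective selection a cylinder pulls back to a cylinder: the coordinate [s k] is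
    constrained by [A k], and every coordinate that is not selected is free and contributes a factor
    1. *)
Lemma iid_cyl_reindex s n (A : nat -> set T) : injective s ->
  (forall k, measurable (A k)) ->
  mu (reindex s @^-1` cyl n A) = (\prod_(k < n) F (A k))%E.
Proof.
move=> sI mA; pose r := [seq s k | k <- iota 0 n].
have ur : uniq r by rewrite map_inj_uniq// iota_uniq.
have szr : size r = n by rewrite size_map size_iota.
pose B i := if i \in r then A (index i r) else setT.
have mB i : measurable (B i) by rewrite /B; case: ifP.
have Bs k : (k < n)%N -> B (s k) = A k.
  move=> kn; rewrite /B; have -> : s k = nth 0%N r k.
    by rewrite (nth_map 0%N) ?size_iota// nth_iota.
  by rewrite mem_nth ?szr// index_uniq ?szr.
pose N := (\max_(i <- r) i).+1.
have rN i : i \in r -> (i < N)%N by move=> ir; rewrite ltnS; have /= := @leq_bigmax_seq _ r xpredT id i ir isT.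
have -> : reindex s @^-1` cyl n A = cyl N B.
  apply/seteqP; split=> z /= h.
    move=> i iN; rewrite /B; case: ifPn => // ir.
    have {}h : forall k, (k < size r)%N -> A k (reindex s z k) by rewrite szr.
    have := h (index i r); rewrite index_mem ir => /(_ isT).
    rewrite /reindex; congr (A _ (z _)).
    have si : (index i r < n)%N by rewrite -szr index_mem.
    rewrite -[RHS](nth_index 0%N ir) (nth_map 0%N) ?size_iota//.
    by rewrite nth_iota ?add0n.
  move=> k kn; have := h (s k); rewrite Bs//; apply.
  by apply: rN; apply: map_f; rewrite mem_iota.
rewrite mu_iid//.
rewrite -(big_mkord xpredT (fun k => F (B k))) -(big_mkord xpredT (fun k => F (A k))).
rewrite /index_iota !subn0.
have : uniq (iota 0 N) by exact: iota_uniq.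
have : forall i, (i \in iota 0 N) = (i < N)%N by move=> i; rewrite mem_iota.
move: (iota 0 N) => rN' mN uN.
rewrite (bigID (fun i => i \in r))/= [X in (_ * X)%E]big1 ?mule1; last first.
  by move=> i /negbTE ir; rewrite /B ir probability_setT.
rewrite -big_filter (perm_big r); last first.
  apply: uniq_perm => //; first exact: filter_uniq.
  move=> i; rewrite mem_filter mN /=.
  by case: (boolP (i \in r)) => //= /rN ->.
rewrite /r big_map; apply: eq_big_seq => k; rewrite mem_iota add0n => /andP[_ kn].
by rewrite Bs.
Qed.

Lemma iid_reindex s (B : set (seqspace T)) : injective s -> measurable B ->
  mu (reindex s @^-1` B) = mu B.
Proof.
move=> sI mB.
pose m1 := pushforward mu (reindex s : seqspace T -> seqspace T).
have ms := @measurable_reindex _ T s.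
rewrite (_ : mu (reindex s @^-1` B) = m1 B)//.
apply: (@seq_measure_unique _ T R (pushforward mu (reindex s)) mu) => //.
- by rewrite (le_lt_trans _ (ltry 1))//; apply: probability_le1; exact: measurableT.
- by move=> n A mA; exact: (etrans (iid_cyl_reindex n sI mA) (esym (mu_iid n mA))).
Qed.

(** Both sides are finite measures in [B], so independence of a fixed event [C] needs to be checked
    on cylinders only. Applied once per block, this gives the independence of two families of
    coordinates. *)
Lemma indep_ext (C : set (seqspace T)) s : measurable C ->
  (forall n (A : nat -> set T), (forall k, measurable (A k)) ->
    (mu ((reindex s @^-1` cyl n A) `&` C) = mu (cyl n A) * mu C)%E) ->
  forall B, measurable B -> (mu ((reindex s @^-1` B) `&` C) = mu B * mu C)%E.
Proof.
move=> mC h B mB; have ms := @measurable_reindex _ T s.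
have c0 : 0 <= fine (mu C) by rewrite fine_ge0.
have cE : ((fine (mu C))%:E = mu C) by rewrite fineK// fin_num_measure.
transitivity (mscale (NngNum c0) mu B); last by rewrite /mscale /= cE muleC.
apply: (@seq_measure_unique _ T R (pushforward (mrestr mu mC) (reindex s))
  (mscale (NngNum c0) mu)) => //.
- rewrite (le_lt_trans _ (ltry 1))//; apply: probability_le1.
  by apply: measurableI => //; rewrite -[X in measurable X]setTI; exact: ms.
- move=> n A mA; apply: (etrans (h n A mA)).
  by transitivity ((fine (mu C))%:E * mu (cyl n A))%E; [by rewrite cE muleC|by []].
Qed.

Lemma iid_blocks s t (A B : set (seqspace T)) : injective s -> injective t ->
  (forall k l, s k != t l) -> measurable A -> measurable B ->
  (mu ((reindex s @^-1` A) `&` (reindex t @^-1` B)) = mu A * mu B)%E.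
Proof.
move=> sI tI st mA mB.
have mtB : measurable (reindex t @^-1` B).
  by rewrite -[X in measurable X]setTI; exact: measurable_reindex.
rewrite -[in RHS](iid_reindex tI mB); apply: indep_ext => // n {}A {}mA.
have msA : measurable (reindex s @^-1` cyl n A).
  by rewrite -[X in measurable X]setTI; apply: measurable_reindex => //; exact: measurable_cyl.
rewrite setIC muleC iid_reindex//.
have -> : mu (cyl n A) = mu (reindex s @^-1` cyl n A).
  by rewrite iid_reindex//; exact: measurable_cyl.
apply: indep_ext => // m {}B {}mB {mtB}.
(* Two cylinders over disjoint blocks form a single cylinder over the selection [u], which lists the
   first [n] indices of [s] and then those of [t]. *)
pose u k := if (k < n)%N then s k else t (k - n)%N.
have uI : injective u.
  move=> k l; rewrite /u; case: ltnP => kn; case: ltnP => ln.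
  - exact: sI.
  - by move=> /eqP; rewrite (negbTE (st _ _)).
  - by move=> /esym/eqP; rewrite (negbTE (st _ _)).
  - by move=> /tI /eqP; rewrite -(eqn_add2r n) !subnK// => /eqP.
pose C k := if (k < n)%N then A k else B (k - n)%N.
have mC k : measurable (C k) by rewrite /C; case: ifP.
rewrite (_ : _ `&` _ = reindex u @^-1` cyl (n + m) C); last first.
  apply/seteqP; split=> z /=.
    move=> [hB hA] k knm; rewrite /reindex /C /u; case: ltnP => kn; first exact: hA.
    by apply: hB; rewrite ltn_subLR.
  move=> h; split=> k kn.
    have := h (n + k)%N; rewrite ltn_add2l => /(_ kn).
    by rewrite /C /reindex /u ltnNge leq_addr /= addKn.
  have := h k; rewrite (leq_trans kn (leq_addr _ _)) => /(_ isT).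
  by rewrite /C /reindex /u kn.
rewrite iid_cyl_reindex// mu_iid// (iid_cyl_reindex _ sI mA) muleC big_split_ord/=.
congr (_ * _)%E; apply: eq_bigr => k _; rewrite /C /=.
  by rewrite ltn_ord.
by rewrite ltnNge leq_addr /= addKn.
Qed.

Definition shift (z : seqspace T) : seqspace T := reindex S z.

Lemma iid_head_tail (A : set T) (B : set (seqspace T)) : measurable A -> measurable B ->
  (mu [set z | A (z 0%N) /\ B (shift z)] = F A * mu B)%E.
Proof.
move=> mA mB; pose C : set (seqspace T) := [set z | A (z 0%N)].
have mC : measurable C.
  by rewrite -[X in measurable X]setTI; exact: measurable_seq_coord.
have muC : mu C = F A.
  rewrite (_ : C = cyl 1 (fun=> A)).
    by rewrite mu_iid// big_ord_recl big_ord0 mule1.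
  by apply/seteqP; split=> z /= h; [case=> //|exact: h].
rewrite (_ : [set _ | _] = (reindex S @^-1` B) `&` C); last first.
  by apply/seteqP; split=> z /= [].
rewrite -muC muleC; apply: indep_ext => // n {mB}B mB.
pose D k := if k is k'.+1 then B k' else A.
rewrite (_ : _ `&` _ = cyl n.+1 D); last first.
  apply/seteqP; split=> z /=.
    by move=> [hB hA] [|k] //= kn; exact: hB.
  by move=> h; split=> [k kn|]; [exact: (h k.+1)|exact: (h 0%N)].
by rewrite muC !mu_iid//= ?big_ord_recl 1?muleC//; case.
Qed.

Lemma iid_head (A : set T) k : measurable A ->
  mu [set z | A (z k)] = F A.
Proof.
move=> mA; have kI : injective (fun l => k + l)%N by move=> a b /addnI.
have := @iid_cyl_reindex _ 1 (fun=> A) kI (fun=> mA).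
rewrite big_ord_recl big_ord0 mule1 => <-; congr (mu _).
by apply/seteqP; split=> z /= h; [case=> //; rewrite /reindex addn0|have := h 0%N isT; rewrite /reindex addn0].
Qed.

Definition head_tail (z : seqspace T) : T * seqspace T := (z 0%N, shift z).

Lemma measurable_head_tail : measurable_fun setT head_tail.
Proof.
apply/measurable_fun_pairP; split; first exact: measurable_seq_coord.
exact: measurable_reindex.
Qed.

Lemma ge0_integral_head_tail (h : T * seqspace T -> \bar R) :
  measurable_fun setT h -> (forall p, 0 <= h p)%E ->
  (\int[mu]_z h (z 0%N, shift z) = \int[F]_x \int[mu]_z h (x, z))%E.
Proof.
move=> mh h0; have mht := measurable_head_tail.
rewrite -(fubini_tonelli1 h)//.
rewrite -[LHS](@ge0_integral_pushforward _ _ _ _ R _ mht mu setT _ measurableT mh)//.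
apply: eq_measure_integral => B mB _; apply/esym.
apply: (@product_measure_unique _ _ _ _ R F mu (pushforward mu head_tail)) => // A C mA mC.
by rewrite /pushforward -iid_head_tail.
Qed.

Lemma ge0_integral_blocks s t (g h : seqspace T -> \bar R) :
  injective s -> injective t -> (forall k l, s k != t l) ->
  measurable_fun setT g -> (forall z, 0 <= g z)%E ->
  measurable_fun setT h -> (forall z, 0 <= h z)%E ->
  (\int[mu]_z (g (reindex s z) * h (reindex t z)) =
   (\int[mu]_z g z) * (\int[mu]_z h z))%E.
Proof.
move=> sI tI st mg g0 mh h0.
pose st_ z := (reindex s z, reindex t z) : seqspace T * seqspace T.
have mst : measurable_fun setT st_.
  by apply/measurable_fun_pairP; split; exact: measurable_reindex.
pose k (p : seqspace T * seqspace T) := (g p.1 * h p.2)%E.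
have mk : measurable_fun setT k.
  apply: emeasurable_funM.
    exact: (measurableT_comp mg measurable_fst).
  exact: (measurableT_comp mh measurable_snd).
have k0 p : (0 <= k p)%E by rewrite mule_ge0.
transitivity (\int[(mu \x mu)%E]_p k p)%E.
  rewrite -[LHS](@ge0_integral_pushforward _ _ _ _ R _ mst mu setT _ measurableT mk)//.
  apply: eq_measure_integral => B mB _; apply/esym.
  apply: (@product_measure_unique _ _ _ _ R mu mu (pushforward mu st_)) => // A C mA mC.
  by rewrite /pushforward -(iid_blocks sI tI st).
rewrite fubini_tonelli1// /fubini_F /k /=.
transitivity (\int[mu]_x ((\int[mu]_z h z) * g x))%E.
  by apply: eq_integral => x _; rewrite ge0_integralZl// muleC.
rewrite ge0_integralZl//; first by rewrite muleC.
exact: integral_ge0.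
Qed.

End iid.

(** * The Efron-Stein inequality *)

Section bounded_expectation.
Context {R : realType} {d} {T : measurableType d}.
Variable P : probability T R.
Implicit Types g h : T -> R.

(** Boundedness keeps all expectations finite, so that [Ex] can be real-valued and linear with a
    side condition that is stable under sums, products and reindexing. *)
Definition bounded_meas g := measurable_fun setT g /\ exists M, forall t, `|g t| <= M.

Definition Ex g : R := Rintegral P setT g.

Lemma bounded_meas_integrable g : bounded_meas g -> P.-integrable setT (EFin \o g).
Proof.
move=> [mg [M gM]]; apply: measurable_bounded_integrable => //.
  by rewrite (le_lt_trans (probability_le1 _ _)) ?ltry.
exists M; split; first exact: num_real.
by move=> x Mx t _; apply: (le_trans (gM t)); exact: ltW.
Qed.

Lemma bounded_measD g h : bounded_meas g -> bounded_meas h ->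
  bounded_meas (fun t => g t + h t).
Proof.
move=> [mg [M gM]] [mh [N hN]]; split; first exact: measurable_funD.
by exists (M + N) => t; rewrite (le_trans (ler_normD _ _))// lerD.
Qed.

Lemma bounded_measM g h : bounded_meas g -> bounded_meas h ->
  bounded_meas (fun t => g t * h t).
Proof.
move=> [mg [M gM]] [mh [N hN]]; split; first exact: measurable_funM.
by exists (M * N) => t; rewrite normrM ler_pM.
Qed.

Lemma bounded_meas_cst (c : R) : bounded_meas (fun=> c).
Proof. by split; [exact: measurable_cst|exists `|c|]. Qed.

Lemma bounded_measZ (c : R) g : bounded_meas g -> bounded_meas (fun t => c * g t).
Proof. by move=> bg; apply: bounded_measM => //; exact: bounded_meas_cst. Qed.

Lemma bounded_measB g h : bounded_meas g -> bounded_meas h ->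
  bounded_meas (fun t => g t - h t).
Proof.
move=> [mg [M gM]] [mh [N hN]]; split; first exact: measurable_funB.
by exists (M + N) => t; rewrite (le_trans (ler_normB _ _))// lerD.
Qed.

Lemma bounded_measX g n : bounded_meas g -> bounded_meas (fun t => g t ^+ n).
Proof.
move=> bg; elim: n => [|n ih]; first by under eq_fun do rewrite expr0; exact: bounded_meas_cst.
by under eq_fun do rewrite exprS; exact: bounded_measM.
Qed.

Lemma bounded_meas_sum (I : Type) (r : seq I) (g : I -> T -> R) :
  (forall i, bounded_meas (g i)) -> bounded_meas (fun t => \sum_(i <- r) g i t).
Proof.
move=> bg; elim: r => [|i r ih].
  by under eq_fun do rewrite big_nil; exact: bounded_meas_cst.
by under eq_fun do rewrite big_cons; exact: bounded_measD.
Qed.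

Lemma ExD g h : bounded_meas g -> bounded_meas h -> Ex (fun t => g t + h t) = Ex g + Ex h.
Proof. by move=> bg bh; rewrite /Ex RintegralD//; exact: bounded_meas_integrable. Qed.

Lemma ExB g h : bounded_meas g -> bounded_meas h -> Ex (fun t => g t - h t) = Ex g - Ex h.
Proof. by move=> bg bh; rewrite /Ex RintegralB//; exact: bounded_meas_integrable. Qed.

Lemma ExZ (c : R) g : bounded_meas g -> Ex (fun t => c * g t) = c * Ex g.
Proof. by move=> bg; rewrite /Ex RintegralZl//; exact: bounded_meas_integrable. Qed.

Lemma Ex_cst (c : R) : Ex (fun=> c) = c.
Proof. rewrite /Ex Rintegral_cst// [X in fine X](_ : _ = 1%E) ?mulr1//; exact: probability_setT. Qed.

Lemma Ex_sum (I : Type) (r : seq I) (g : I -> T -> R) :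
  (forall i, bounded_meas (g i)) -> Ex (fun t => \sum_(i <- r) g i t) = \sum_(i <- r) Ex (g i).
Proof.
move=> bg; elim: r => [|i r ih].
  by under [X in Ex X]eq_fun do rewrite big_nil; rewrite big_nil Ex_cst.
under [X in Ex X]eq_fun do rewrite big_cons.
by rewrite big_cons ExD// ?ih//; exact: bounded_meas_sum.
Qed.

Lemma le_Ex g h : bounded_meas g -> bounded_meas h -> (forall t, g t <= h t) -> Ex g <= Ex h.
Proof. by move=> bg bh gh; apply: le_Rintegral => //; exact: bounded_meas_integrable. Qed.

Lemma Ex_ge0 g : (forall t, 0 <= g t) -> 0 <= Ex g.
Proof. by move=> g0; apply: Rintegral_ge0. Qed.

Lemma EFin_Ex g : bounded_meas g -> ((Ex g)%:E = \int[P]_t (g t)%:E)%E.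
Proof.
move=> bg; rewrite /Ex /Rintegral fineK//; apply: integrable_fin_num => //.
exact: bounded_meas_integrable.
Qed.

Lemma Ex_var g c : bounded_meas g ->
  Ex (fun t => (g t - c) ^+ 2) = (Ex (fun t => g t ^+ 2) - Ex g ^+ 2) + (Ex g - c) ^+ 2.
Proof.
move=> bg.
have -> : Ex (fun t => (g t - c) ^+ 2) = Ex (fun t => g t ^+ 2 + (- (2 * c) * g t + c ^+ 2)).
  by congr Ex; apply/funext => t; ring.
rewrite ExD; [|exact: bounded_measX|]; last first.
  by apply: bounded_measD; [exact: bounded_measZ|exact: bounded_meas_cst].
rewrite ExD; [|exact: bounded_measZ|exact: bounded_meas_cst].
by rewrite ExZ// Ex_cst; ring.
Qed.

End bounded_expectation.

Section efron_stein.
Context {R : realType} {d} {T : measurableType d}.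
Variables (F : probability T R) (mu : probability (seqspace T) R).
Hypothesis mu_iid : iid_law F mu.
Implicit Types g : seqspace T -> R.

Lemma bounded_meas_reindex s g : bounded_meas g -> bounded_meas (fun z => g (reindex s z)).
Proof.
move=> [mg [M gM]]; split; last by exists M.
by apply: (measurableT_comp mg); exact: measurable_reindex.
Qed.

Lemma Ex_reindex s g : injective s -> bounded_meas g ->
  Ex mu (fun z => g (reindex s z)) = Ex mu g.
Proof.
move=> sI bg; have ms := @measurable_reindex _ T s.
have mg : measurable_fun setT (EFin \o g) by apply/measurable_EFinP; case: bg.
have ig : mu.-integrable (reindex s @^-1` setT) ((EFin \o g) \o reindex s).
  by rewrite preimage_setT; apply: bounded_meas_integrable (bounded_meas_reindex s bg).
rewrite /Ex /Rintegral; congr fine.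
rewrite -[LHS](@integral_pushforward _ _ _ _ R _ ms mu setT _ mg ig measurableT).
by apply: eq_measure_integral => B mB _; exact: (iid_reindex mu_iid).
Qed.

Definition depends_first n g := forall z z', (forall k, (k < n)%N -> z k = z' k) -> g z = g z'.

Definition swap i j k := if k == i then j else if k == j then i else k : nat.

Lemma swap_inj i j : injective (swap i j).
Proof. by move=> k l; rewrite /swap; do !case: eqP; lia. Qed.

Let tau n i k := if (k < i)%N then (n + k)%N else if (n <= k < n + i)%N then (k - n)%N else k.

Let tau_inj n i : (i <= n)%N -> injective (tau n i).
Proof. by move=> iln k l; rewrite /tau; do !case: ifPn; lia. Qed.

(* [tau n i] replaces the first [i] points by fresh copies; with
   [e i = E (g * (g \o tau n i))], the variance of [g] telescopes into the sum of
   the [e i - e i.+1], and by exchangeability of [i] and [n + i] each of these is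
   half the expectation of a product of two increments. *)
Lemma efron_stein n g : bounded_meas g -> (forall z, 0 <= g z) -> depends_first n g ->
  Ex mu (fun z => g z ^+ 2) - (Ex mu g) ^+ 2 <=
  2^-1 * \sum_(i < n) Ex mu (fun z => (g z - g (reindex (swap i (n + i)) z)) ^+ 2).
Proof.
move=> bg g0 gn.
pose gt i z := g (reindex (tau n i) z).
have bgt i : bounded_meas (gt i) by exact: bounded_meas_reindex.
pose e i := Ex mu (fun z => g z * gt i z).
have e0 : Ex mu (fun z => g z ^+ 2) = e 0%N.
  congr Ex; apply/funext => z; rewrite expr2; congr (_ * _); apply: gn => k kn.
  by rewrite /reindex /tau ltn0 addn0; case: ifPn => //; lia.
have en : (Ex mu g) ^+ 2 = e n.
  (* Only the first [n] values matter: [s] keeps the original points and [t] selects their fresh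
     copies. Beyond them, even and odd numbers make both maps injective with disjoint ranges. *)
  pose s k := if (k < n)%N then k else k.*2.
  pose t k := if (k < n)%N then (n + k)%N else k.*2.+1.
  have sI : injective s by move=> k l; rewrite /s; do !case: ifPn; lia.
  have tI : injective t by move=> k l; rewrite /t; do !case: ifPn; lia.
  have st k l : s k != t l by rewrite /s /t; do !case: ifPn; lia.
  have mg : measurable_fun setT (EFin \o g) by apply/measurable_EFinP; case: bg.
  have g0' z : (0 <= (EFin \o g) z)%E by rewrite lee_fin.
  have := ge0_integral_blocks mu_iid sI tI st mg g0' mg g0'.
  rewrite -(EFin_Ex mu bg) -EFinM -expr2 => /(congr1 fine) /= <-.
  rewrite /e /Ex /Rintegral; congr fine; apply: eq_integral => z _.
  rewrite -EFinM; congr (_ * _)%:E; apply: gn => k kn; rewrite /reindex.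
    by rewrite /s kn.
  by rewrite /t kn /tau kn.
have ->: Ex mu (fun z => g z ^+ 2) - (Ex mu g) ^+ 2 = \sum_(i < n) (e i - e i.+1).
  rewrite e0 en -(big_mkord xpredT (fun i => e i - e i.+1)).
  rewrite (@telescope_sumr_eq _ _ _ (fun i => - e i))// ?opprK 1?addrC//.
  by move=> k _; rewrite opprK addrC.
rewrite mulr_sumr; apply: ler_sum => -[i /= iltn] _.
pose gi z := g (reindex (swap i (n + i)) z).
have bgi : bounded_meas gi by exact: bounded_meas_reindex.
have sI := @swap_inj i (n + i).
(* Swapping the coordinates [i] and [n + i] preserves the law, turns [g] into [gi], and exchanges
   [gt i] with [gt i.+1] up to coordinates that [g] ignores. *)
have ei : e i = Ex mu (fun z => gi z * gt i.+1 z).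
  rewrite /e -(Ex_reindex sI); last by apply: bounded_measM.
  congr Ex; apply/funext => z; congr (_ * _); apply: gn => k kn.
  rewrite /reindex; congr z; rewrite /swap /tau.
  by do !case: ifPn; do ?case: eqP; lia.
have eS : e i.+1 = Ex mu (fun z => gi z * gt i z).
  rewrite /e -(Ex_reindex sI); last by apply: bounded_measM.
  congr Ex; apply/funext => z; congr (_ * _); apply: gn => k kn.
  rewrite /reindex; congr z; rewrite /swap /tau.
  by do !case: ifPn; do ?case: eqP; lia.
have eq2 : 2 * (e i - e i.+1) = Ex mu (fun z => (g z - gi z) * (gt i z - gt i.+1 z)).
  have -> : (fun z => (g z - gi z) * (gt i z - gt i.+1 z)) =
     (fun z => (g z * gt i z + gi z * gt i.+1 z) - (g z * gt i.+1 z + gi z * gt i z)).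
    by apply/funext => z; ring.
  rewrite ExB ?ExD -?ei -?eS; do ?[exact: bounded_measM|by apply: bounded_measD; exact: bounded_measM].
  by rewrite -/(e i) -/(e i.+1); ring.
pose H z := (g z - gi z) ^+ 2.
have bH : bounded_meas H by apply: bounded_measX; exact: bounded_measB.
(* The second increment is the first one reindexed by [tau n i], so both have the same second
   moment; bounding the product by half the sum of the squares then loses nothing else. *)
have EH : Ex mu (fun z => (gt i z - gt i.+1 z) ^+ 2) = Ex mu H.
  rewrite -(Ex_reindex (@tau_inj n i (ltnW iltn)) bH).
  congr Ex; apply/funext => z; rewrite /H; congr ((_ - _) ^+ 2).
  apply: gn => k kn; rewrite /reindex; congr z; rewrite /swap /tau.
  by do !case: ifPn; do ?case: eqP; lia.
have : 2 * (e i - e i.+1) <= Ex mu H.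
  rewrite eq2; apply: (@le_trans _ _ (Ex mu (fun z => 2^-1 * H z + 2^-1 * (gt i z - gt i.+1 z) ^+ 2))).
    apply: le_Ex.
    - by apply: bounded_measM; exact: bounded_measB.
    - by apply: bounded_measD; apply: bounded_measZ => //; apply: bounded_measX; exact: bounded_measB.
    - by move=> z; rewrite /H; have := sqr_ge0 ((g z - gi z) - (gt i z - gt i.+1 z)); nra.
  rewrite ExD; [|exact: bounded_measZ|]; last first.
    by apply: bounded_measZ; apply: bounded_measX; exact: bounded_measB.
  rewrite !ExZ//; last by apply: bounded_measX; exact: bounded_measB.
  by rewrite EH; lra.
by rewrite -/H; lra.
Qed.

End efron_stein.

Section expectation_more.
Context {R : realType} {d} {T : measurableType d}.
Variable P : probability T R.
Implicit Types g h : T -> R.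

Lemma bounded_meas_indic (A : set T) : measurable A -> bounded_meas (\1_A : T -> R).
Proof.
move=> mA; split; first exact: measurable_indic.
by exists 1 => t; rewrite indicE; case: (_ \in _); rewrite ?normr1 ?normr0.
Qed.

Lemma Ex_indic (A : set T) : measurable A -> (Ex P (\1_A : T -> R))%:E = P A.
Proof. by move=> mA; rewrite EFin_Ex ?integral_indic ?setIT//; exact: bounded_meas_indic. Qed.

Lemma eq_Ex_on (A : set T) g h : measurable A -> P A = 1%E -> bounded_meas g -> bounded_meas h ->
  (forall t, A t -> g t = h t) -> Ex P g = Ex P h.
Proof.
move=> mA PA [mg _] [mh _] gh; congr fine; apply: ae_eq_integral => //; do ?exact/measurable_EFinP.
exists (~` A); split; first exact: measurableC.
  by transitivity (1 - P A)%E; [exact: probability_setC|rewrite PA subee].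
by move=> t /=; apply: contra_not => At _; rewrite gh.
Qed.

Lemma le_Ex_on (A : set T) g h : measurable A -> P A = 1%E -> bounded_meas g -> bounded_meas h ->
  (forall t, A t -> g t <= h t) -> Ex P g <= Ex P h.
Proof.
move=> mA PA bg bh gh; have bA := bounded_meas_indic mA.
pose k t : R := h t + (g t - h t) * \1_A t.
have bk : bounded_meas k.
  by apply: bounded_measD => //; apply: bounded_measM => //; exact: bounded_measB.
rewrite (@eq_Ex_on A g k)//.
  apply: le_Ex => // t; rewrite /k indicE.
  have [/set_mem/gh|_] := boolP (t \in A); last by rewrite mulr0 addr0.
  by rewrite mulr1; lra.
by move=> t At; rewrite /k indicE mem_set// mulr1; ring.
Qed.

Lemma bounded_Ex_section d' (S : measurableType d') (g : S * T -> R) : measurable_fun setT g ->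
  (exists M, forall p, `|g p| <= M) -> (forall p, 0 <= g p) ->
  bounded_meas (fun x => Ex P (fun w => g (x, w))).
Proof.
move=> mg [M gM] g0; split.
  apply: (measurableT_comp (@fine_measurable R _ measurableT)) => //.
  apply: (@measurable_fun_fubini_tonelli_F _ _ _ _ R P (EFin \o g)); first by apply/measurable_EFinP.
  by move=> p; rewrite lee_fin.
exists M => x; have bg : bounded_meas (fun w => g (x, w)).
  by split; [exact: (measurableT_comp mg (pair1_measurable x))|exists M].
rewrite ger0_norm ?Ex_ge0// -[leRHS](Ex_cst P); apply: le_Ex => //.
  exact: bounded_meas_cst.
by move=> w; exact: le_trans (ler_norm _) (gM _).
Qed.

Lemma measurable_gt_indic g : measurable_fun setT g ->
  measurable_fun setT (fun p : R * T => (p.1 < g p.2)%R%:R : R).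
Proof.
move=> mg; have mlt : measurable [set p : R * T | p.1 < g p.2].
  rewrite (_ : [set _ | _] = ~` [set p : R * T | g p.2 <= p.1]).
    apply: measurableC; apply: measurable_le => //.
    exact: (measurableT_comp mg measurable_snd).
  by apply/seteqP; split=> p /=; rewrite ltNge => /negP.
rewrite (_ : (fun p => _) = \1_[set p : R * T | p.1 < g p.2]); first exact: measurable_indic.
by apply/funext => p; rewrite indicE mem_setE.
Qed.

Lemma bounded_gt_indic g y : measurable_fun setT g -> bounded_meas (fun t => (y < g t)%R%:R : R).
Proof.
move=> mg; split; first exact: (measurableT_comp (measurable_gt_indic mg) (pair1_measurable y)).
by exists 1 => t; case: (y < g t); rewrite ?normr1 ?normr0.
Qed.

Lemma measurable_Ex_tail g : measurable_fun setT g ->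
  measurable_fun setT (fun y : R => Ex P (fun t => (y < g t)%R%:R)).
Proof.
move=> mg; apply: (bounded_Ex_section (measurable_gt_indic mg) _ _).1 => //.
by exists 1 => p; case: (_ < _); rewrite ?normr1 ?normr0.
Qed.

(** The layer cake formula. The interval is open at 0 because the tails are later shown to converge,
    and to be dominated, only at [0 < y]. *)
Lemma Ex_tail g : bounded_meas g -> (forall t, 0 <= g t) ->
  ((Ex P g)%:E = \int[lebesgue_measure]_(y in `]0%R, +oo[) (Ex P (fun t => (y < g t)%R%:R))%:E)%E.
Proof.
move=> bg g0; have mg := bg.1.
pose X : {RV P >-> R} := HB.pack g (isMeasurableFun.Build _ _ _ _ g mg).
have := @ge0_expectation_ccdf _ _ _ P X g0.
rewrite unlock EFin_Ex// => ->.
rewrite integral_itv_obnd_cbnd; last first.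
  by apply/measurable_EFinP; apply: measurable_funTS; exact: measurable_Ex_tail.
apply: eq_integral => y _; rewrite /ccdf.
rewrite EFin_Ex; last exact: bounded_gt_indic.
have mA : measurable (X @^-1` `]y, +oo[).
  by rewrite -[Y in measurable Y]setTI; exact: (proj1 bg).
transitivity (P ((X @^-1` `]y, +oo[) `&` setT)); first by rewrite setIT.
rewrite -integral_indic//; apply: eq_integral => t _; rewrite indicE.
congr (nat_of_bool _)%:R%:E; apply/idP/idP => [/set_mem|h].
  by rewrite /= in_itv/= andbT.
by apply/mem_set; rewrite /= in_itv/= andbT.
Qed.

End expectation_more.

(** * Continuity of translations in L^1 *)

Section translation.
Context {R : realType}.
Variable n : nat.
Notation lam := (@lebesgue_rV R n).
Implicit Types (A B : set 'rV[R]_n) (u x : 'rV[R]_n).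

Lemma measurable_translate A u : measurable A ->
  measurable ((fun x => x + u) @^-1` A).
Proof.
move=> mA; rewrite (_ : (fun x => x + u) = (fun x => u + 1 *: x)).
  by apply: measurable_rV_preimage => //; exact: measurable_rV_affine.
by apply/funext => x; rewrite scale1r addrC.
Qed.

Lemma lebesgue_translate A u : measurable A -> lam ((fun x => x + u) @^-1` A) = lam A.
Proof.
move=> mA; rewrite (_ : (fun x => x + u) = (fun x => u + 1 *: x)).
  by rewrite lebesgue_rV_affine// invr1 expr1n mul1e.
by apply/funext => x; rewrite scale1r addrC.
Qed.

Definition translate_diff A u : set 'rV[R]_n :=
  ((fun x => x + u) @^-1` A `\` A) `|` (A `\` (fun x => x + u) @^-1` A).

Lemma measurable_translate_diff A u : measurable A -> measurable (translate_diff A u).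
Proof.
by move=> mA; apply: measurableU; apply: measurableD => //; exact: measurable_translate.
Qed.

(** Continuity of translations in L^1 for the indicator of [A]. Restricting to boxes makes it
    meaningful for sets of infinite measure, hence stable under complement. *)
Definition small_translate_diff A := measurable A /\
  forall M e : R, 0 < M -> 0 < e -> exists2 del : R, 0 < del &
  forall u, (forall i, `|u ord0 i| <= del) ->
    (lam (box n M `&` translate_diff A u) <= e%:E)%E.

Lemma small_translate_diffC A : small_translate_diff A -> small_translate_diff (~` A).
Proof.
move=> [mA h]; split; first exact: measurableC.
move=> M e M0 e0; have [del d0 {}h] := h M e M0 e0; exists del => // u ud.
rewrite (_ : translate_diff _ u = translate_diff A u); first exact: h.
apply/seteqP; split=> x; rewrite /translate_diff /=; have [] := pselect (A x);
  have [] := pselect (A (x + u)); tauto.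
Qed.

Lemma small_translate_diffU A B : small_translate_diff A -> small_translate_diff B ->
  small_translate_diff (A `|` B).
Proof.
move=> [mA hA] [mB hB]; split; first exact: measurableU.
move=> M e M0 e0; have e2 : 0 < e / 2 by rewrite divr_gt0.
have [da da0 {}hA] := hA M _ M0 e2; have [db db0 {}hB] := hB M _ M0 e2.
exists (Num.min da db); first by rewrite lt_min da0.
move=> u ud.
have uA i : `|u ord0 i| <= da by have := ud i; rewrite le_min => /andP[].
have uB i : `|u ord0 i| <= db by have := ud i; rewrite le_min => /andP[].
have mbox := @measurable_cube R n M.
apply: (@le_trans _ _ (lam (box n M `&` translate_diff A u) +
    lam (box n M `&` translate_diff B u))%E); last first.
  by rewrite [e in leRHS](splitr e) EFinD leeD// ?hA// hB.
have mDA := measurable_translate_diff u mA; have mDB := measurable_translate_diff u mB.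
apply: (@le_trans _ _ (lam ((box n M `&` translate_diff A u) `|` (box n M `&` translate_diff B u)))).
  apply: le_measure; rewrite ?inE.
  - by apply: measurableI => //; apply: measurable_translate_diff; exact: measurableU.
  - by apply: measurableU; exact: measurableI.
  - by move=> x [bx]; rewrite /translate_diff /=; have [] := pselect (A x);
      have [] := pselect (A (x + u)); tauto.
by apply: measureU2; exact: measurableI.
Qed.

Lemma small_translate_diff0 : small_translate_diff set0.
Proof.
split => // M e M0 e0; exists 1 => // u _.
by rewrite /translate_diff preimage_set0 setD0 setU0 setI0 measure0 lee_fin ltW.
Qed.

(** In the box enlarged by 1, a finite subunion misses only measure [e / 3] of the union. The finite
    subunion is handled by induction; the missing part and its translate account for the other two
    thirds, and the enlargement leaves room for [x + u] when the coordinates of [u] are at most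
    1. *)
Lemma small_translate_diff_bigcup (A : nat -> set 'rV[R]_n) :
  (forall k, small_translate_diff (A k)) -> small_translate_diff (\bigcup_k A k).
Proof.
move=> sA; have mA k : measurable (A k) by have [] := sA k.
split; first exact: bigcup_measurable.
move=> M e M0 e0; have e3 : 0 < e / 3 by rewrite divr_gt0.
pose AN N := \bigcup_(k in `I_N) A k.
have sAN N : small_translate_diff (AN N).
  rewrite /AN; elim: N => [|N ih]; first by rewrite II0 bigcup_set0; exact: small_translate_diff0.
  by rewrite IIS bigcup_setU bigcup_set1; exact: small_translate_diffU.
have mAN N : measurable (AN N) by have [] := sAN N.
pose T N := box n (M + 1) `&` (\bigcup_k A k `\` AN N).
have mT N : measurable (T N).
  apply: measurableI; first exact: measurable_cube.
  by apply: measurableD; [exact: bigcup_measurable|].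
have M1 : 0 <= M + 1 by rewrite addr_ge0// ltW.
have T0 : lam (\bigcap_N T N) = 0%E.
  rewrite (_ : \bigcap_N T N = set0) ?measure0//; apply/seteqP; split => // x h.
  have [_ [[k _ Akx] _]] := h 0%N I.
  have [_ [_ []]] := h k.+1 I; by exists k => /=.
have Tlty : (lam (T 0%N) < +oo)%E.
  apply: (@le_lt_trans _ _ (lam (box n (M + 1)))); last by rewrite lebesgue_rV_cube// ltry.
  by apply: le_measure; rewrite ?inE//; [exact: measurable_cube|exact: subIsetl].
have cT : lam (T N) @[N --> \oo] --> 0%E.
  rewrite -T0; apply: nonincreasing_cvg_mu => //.
    exact: bigcapT_measurable.
  move=> a b ab; apply/subsetPset => x [bx [Ax nAx]]; split=> //; split=> // -[k /= ka Akx].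
  by apply: nAx; exists k => //=; exact: leq_trans ka ab.
have [N TN] : exists N, (lam (T N) < (e / 3)%:E)%E.
  move/fine_cvgP : cT => [fT cT]; near \oo => N; exists N.
  have fN : lam (T N) \is a fin_num by near: N.
  by rewrite -(fineK fN) lte_fin; near: N; apply: (cvgr_lt _ cT).
have [del d0 hd] := (sAN N).2 M _ M0 e3.
exists (Num.min del 1); first by rewrite lt_min d0 ltr01.
move=> u ud.
have u1 i : `|u ord0 i| <= 1 by have := ud i; rewrite le_min => /andP[].
have uD i : `|u ord0 i| <= del by have := ud i; rewrite le_min => /andP[].
have mbox := @measurable_cube R n M.
have mD := measurable_translate_diff u (mAN N).
have mtT := measurable_translate u (mT N).
have lT := lebesgue_translate u (mT N).
set tT := _ @^-1` T N in mtT lT.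
apply: (@le_trans _ _ (lam (box n M `&` translate_diff (AN N) u) +
    (lam (T N) + lam tT))%E); last first.
  rewrite lT; have -> : e = e / 3 + (e / 3 + e / 3) by lra.
  by rewrite !EFinD leeD ?hd// leeD// ltW.
apply: (@le_trans _ _ (lam ((box n M `&` translate_diff (AN N) u) `|`
    (T N `|` tT)))).
  apply: le_measure; rewrite ?inE.
  - by apply: measurableI => //; apply: measurable_translate_diff; exact: bigcup_measurable.
  - by apply: measurableU; [exact: measurableI|exact: measurableU].
  - move=> x [bx].
    have b1 : box n (M + 1) x.
      move=> i; have := bx i; rewrite /= !in_itv/= => /andP[? ?]; lra.
    have b2 : box n (M + 1) (x + u).
      move=> i; have := bx i; have := u1 i; rewrite ler_norml /= !in_itv/= mxE => /andP[? ?] /andP[? ?]; lra.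
    have AA y : AN N y -> (\bigcup_k A k) y by move=> [k _ ?]; exists k.
    have := AA x; have := AA (x + u); rewrite /translate_diff /tT /T /=.
    have [] := pselect (AN N x); have [] := pselect (AN N (x + u)); tauto.
apply: (le_trans (measureU2 _ _ _)); [exact: measurableI|exact: measurableU|].
by rewrite leeD//; exact: measureU2.
Unshelve. all: end_near. Qed.

(** Only the points whose coordinate [i] is within [del] of [c] can change sides. Inside the box
    this slab has volume at most [2 * del * C], where [C] is the product of the other side
    lengths. *)
Lemma small_translate_diff_halfspace i c :
  small_translate_diff [set x : 'rV[R]_n | c < x ord0 i].
Proof.
pose H := [set x : 'rV[R]_n | c < x ord0 i].
have mH : measurable H.
  rewrite (_ : H = (fun x => x ord0 i) @^-1` `]c, +oo[%classic).
    by rewrite -[X in measurable X]setTI; apply: measurable_rV_coord.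
  by apply/seteqP; split=> x /=; rewrite in_itv/= andbT.
split => // M e M0 e0.
pose C := \prod_(k < n | k != i) (2 * M).
have C0 : 0 <= C by rewrite prodr_ge0// => k _; rewrite mulr_ge0// ltW.
pose del := e / (2 * (C + 1)).
have d0 : 0 < del by rewrite divr_gt0// mulr_gt0// ltr_wpDl.
exists del => // u ud.
pose A k : set R := if k == i then `[c - del, c + del]%classic else `[- M, M]%classic.
have mA k : measurable (A k) by rewrite /A; case: ifP.
have muA : lam [set v | forall k, A k (v ord0 k)] = (2 * del * C)%:E.
  rewrite lebesgue_rV_box// (bigD1 i)//= /A eqxx lebesgue_measure_itv/= lte_fin.
  rewrite ifT; last by lra.
  rewrite (eq_bigr (fun=> (2 * M)%:E)); last first.
    move=> k /negbTE ->; rewrite lebesgue_measure_itv/= lte_fin ifT; last by lra.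
    by rewrite -EFinD; congr EFin; lra.
  by rewrite prodEFin -EFinD -EFinM; congr EFin; rewrite -/C; ring.
apply: (@le_trans _ _ (lam [set v | forall k, A k (v ord0 k)])); last first.
  rewrite muA lee_fin /del.
  have -> : 2 * (e / (2 * (C + 1))) * C = e * (C / (C + 1)).
    by field; rewrite gt_eqF// ltr_wpDl.
  by rewrite ler_piMr ?(ltW e0)// ler_pdivrMr ?mul1r ?lerDl// ltr_wpDl.
apply: le_measure; rewrite ?inE.
- by apply: measurableI; [exact: measurable_cube|exact: measurable_translate_diff].
- exact: measurable_rV_box.
- move=> x [bx hx] k; rewrite /A; case: eqP => [->|_]; last exact: bx.
  have := ud i; rewrite ler_norml => /andP[u1 u2].
  rewrite /= in_itv/=; move: hx; rewrite /translate_diff /H /= !mxE.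
  by move=> [[h1 /negP]|[h1 /negP]]; rewrite -leNgt => h2; apply/andP; split; lra.
Qed.

(** The sets with this property form a sigma-algebra that contains the coordinate half-spaces, and
    these generate the measurable sets. *)
Lemma small_translate_diff_measurable A : measurable A -> small_translate_diff A.
Proof.
have sa : sigma_algebra setT small_translate_diff.
  split; first exact: small_translate_diff0.
  - by move=> B sB; rewrite setTD; exact: small_translate_diffC.
  - exact: small_translate_diff_bigcup.
apply: smallest_sub => //; rewrite -bigcup_seq => _ [i _ [B mB <-]]; rewrite setTI.
pose G := [set B : set R | small_translate_diff ((fun v : 'rV[R]_n => v ord0 i) @^-1` B)].
have : measurable `<=` G.
  rewrite [X in X `<=` _](_ : _ = <<s [set A | exists x : R, A = `]x, +oo[%classic] >>); last first.
    exact: RGenOInfty.measurableE.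
  apply: smallest_sub.
    split.
    + by rewrite /G /= preimage_set0; exact: small_translate_diff0.
    + by move=> D GD; rewrite /G /= setTD preimage_setC; exact: small_translate_diffC.
    + by move=> D GD; rewrite /G /= preimage_bigcup; exact: small_translate_diff_bigcup.
  move=> _ [x ->]; rewrite /G /=.
  apply: (eq_ind _ small_translate_diff (small_translate_diff_halfspace i x)).
  by apply/seteqP; split=> v /=; rewrite in_itv/= andbT.
by apply.
Qed.

Variables (f : 'rV[R]_n -> R) (b M : R).
Hypotheses (mf : measurable_fun setT f) (f0 : forall x, 0 <= f x)
  (fb : forall x, f x <= b) (M0 : 0 < M) (fM : forall x, 0 < f x -> box n M x).

(* The values of [f] are split into the levels [k * b / N]: wherever [f]
   changes by more than [b / N], some superlevel set separates [x] and [x + u]. *)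
Lemma translation_continuous_L1 (e : R) : 0 < e -> exists2 del : R, 0 < del &
  forall u, (forall i, `|u ord0 i| <= del) ->
    (\int[lam]_x `|f (x + u)%R - f x|%:E <= e%:E)%E.
Proof.
move=> e0; have b0 : 0 <= b by exact: le_trans (f0 0) (fb 0).
pose V := (2 * (M + 1)) ^+ n.
have M1 : 0 < M + 1 by rewrite ltr_wpDr// ltW.
have V0 : 0 < V by rewrite exprn_gt0// mulr_gt0.
(* Variations of [f] below [b / N] on a box of volume [V] then cost at most [e / 2]; the other half
   of [e] is shared among the [N] superlevel sets. *)
pose N := (Num.truncn (2 * b * V / e)).+1.
have N0 : 0 < N%:R :> R by [].
have bN : b / N%:R * V <= e / 2.
  have : 2 * b * V / e < N%:R.
    have q0 : 0 <= 2 * b * V / e by rewrite divr_ge0 ?mulr_ge0// ltW.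
    by have /andP[] := truncn_itv q0.
  rewrite ltr_pdivrMr// => h; rewrite mulrAC ler_pdivrMr//; nra.
pose A k := [set x | k.+1%:R * (b / N%:R) <= f x].
have mA k : measurable (A k) by exact: measurable_le.
have [del d0 hd] : exists2 del : R, 0 < del & forall k u, (k < N)%N ->
    (forall i, `|u ord0 i| <= del) ->
    (lam (box n (M + 1) `&` translate_diff (A k) u) <= (e / (2 * N%:R * (b + 1)))%:E)%E.
  have e' : 0 < e / (2 * N%:R * (b + 1)) by rewrite divr_gt0// !mulr_gt0// ltr_wpDl.
  move: e'; set c := e / (2 * N%:R * (b + 1)) => e'.
  elim: (N) => [|m [del d0 ih]]; first by exists 1.
  have [dm dm0 hm] := (small_translate_diff_measurable (mA m)).2 _ _ M1 e'.
  exists (Num.min del dm); first by rewrite lt_min d0.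
  move=> k u; rewrite ltnS leq_eqVlt => /predU1P[->|km] ud.
    by apply: hm => i; have := ud i; rewrite le_min => /andP[].
  by apply: ih => // i; have := ud i; rewrite le_min => /andP[].
exists (Num.min del 1); first by rewrite lt_min d0 ltr01.
move=> u ud.
have u1 i : `|u ord0 i| <= 1 by have := ud i; rewrite le_min => /andP[].
have uD i : `|u ord0 i| <= del by have := ud i; rewrite le_min => /andP[].
pose B := box n (M + 1).
have mB : measurable B by exact: measurable_cube.
pose g x : \bar R := ((b / N%:R)%:E * (\1_B x)%:E +
  b%:E * \sum_(k < N) (\1_(B `&` translate_diff (A k) u) x)%:E)%E.
have mD k : measurable (B `&` translate_diff (A k) u).
  by apply: measurableI => //; exact: measurable_translate_diff.
have mfu : measurable_fun setT (fun x => f (x + u)).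
  apply: (measurableT_comp mf).
  rewrite (_ : (fun x => x + u) = (fun x => u + 1 *: x)); first exact: measurable_rV_affine.
  by apply/funext => x; rewrite scale1r addrC.
have mS : measurable_fun setT (fun x => \sum_(k < N) (\1_(B `&` translate_diff (A k) u) x)%:E : \bar R)%E.
  by apply: emeasurable_sum => k; apply/measurable_EFinP; exact: measurable_indic.
have m1 : measurable_fun setT (fun x => (\1_B x)%:E : \bar R).
  by apply/measurable_EFinP; exact: measurable_indic.
have S0 x : ((0 : \bar R) <= \sum_(k < N) (\1_(B `&` translate_diff (A k) u) x)%:E)%E.
  by apply: sume_ge0 => k _; rewrite lee_fin.
have bN0 : 0 <= b / N%:R by rewrite divr_ge0.
apply: (@le_trans _ _ (\int[lam]_x g x)%E).
  apply: ge0_le_integral => //.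
  - apply/measurable_EFinP; apply: measurableT_comp => //; exact: measurable_funB.
  - by apply: emeasurable_funD; apply: measurable_funeM.
  - move=> x _; rewrite /g sumEFin -!EFinM -EFinD lee_fin.
    have [Bx|nBx] := pselect (B x); last first.
      have z y : ~ box n M y -> f y = 0.
        move=> h; apply/eqP; rewrite eq_le f0 andbT leNgt; apply/negP => /fM; exact: h.
      rewrite !z ?subrr ?normr0 ?addr_ge0 ?mulr_ge0// ?sumr_ge0//.
      + by move=> h; apply: nBx => i; have := h i; rewrite /= !in_itv/= => /andP[? ?]; lra.
      + move=> h; apply: nBx => i; have := h i; have := u1 i; rewrite ler_norml /= !in_itv/= mxE => /andP[? ?] /andP[? ?]; lra.
    have fxb y : 0 <= f y <= b by rewrite f0 fb.
    have nb : `|f (x + u) - f x| <= b.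
      by have := fxb x; have := fxb (x + u); rewrite ler_norml => /andP[? ?] /andP[? ?]; lra.
    rewrite indicE (mem_set Bx) mulr1.
    have [le|lt] := leP `|f (x + u) - f x| (b / N%:R).
      by rewrite (le_trans le)// lerDl mulr_ge0// sumr_ge0.
    suff [k hk] : exists k : 'I_N, translate_diff (A k) u x.
      rewrite (le_trans nb)// ler_wpDl// ler_peMr// (bigD1 k)//= indicE mem_set; last by split.
      by rewrite lerDl sumr_ge0.
    (* The first multiple of [b / N] strictly above [s] exceeds it by at most [b / N], hence stays
       below [t], and its index is below [N] because [t <= b]. *)
    have sep s t : 0 <= s -> t <= b -> b / N%:R < t - s ->
        exists k : 'I_N, s < k.+1%:R * (b / N%:R) <= t.
      move=> s0 tb st.
      have bpos : 0 < b by rewrite lt_neqAle b0 andbT; apply/eqP => b00; move: st; rewrite -b00 mul0r; lra.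
      have q0 : 0 < b / N%:R by rewrite divr_gt0.
      have sq0 : 0 <= s / (b / N%:R) by rewrite divr_ge0// ltW.
      have /andP[k1 k2] := truncn_itv sq0.
      set k := Num.truncn _ in k1 k2.
      move: k1 k2; rewrite ler_pdivlMr// ltr_pdivrMr// => k1 k2.
      have kN : (k < N)%N.
        rewrite -(ltr_nat R) -(ltr_pM2r q0) (le_lt_trans k1)//.
        by rewrite mulrC divfK ?gt_eqF//; lra.
      exists (Ordinal kN) => /=; rewrite k2/= -natr1 mulrDl mul1r; lra.
    have [xu|xu] := leP (f x) (f (x + u)).
      move: lt; rewrite ger0_norm ?subr_ge0// => /sep[]// k /andP[h1 h2].
      by exists k; left; split; [exact: h2|rewrite /A /=; apply/negP; rewrite -ltNge].
    move: lt; rewrite distrC ger0_norm ?subr_ge0 ?(ltW xu)// => /sep[]// k /andP[h1 h2].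
    by exists k; right; split; [exact: h2|rewrite /A /=; apply/negP; rewrite -ltNge].
rewrite /g ge0_integralD//; last 4 first.
- by move=> x _; rewrite mule_ge0.
- exact: measurable_funeM.
- by move=> x _; rewrite mule_ge0.
- exact: measurable_funeM.
rewrite !ge0_integralZl// integral_indic//.
rewrite [X in (_ * X + _)%E](_ : _ = V%:E); last first.
  by rewrite setIT; exact: lebesgue_rV_cube (ltW M1).
rewrite -EFinM.
rewrite ge0_integral_sum//; last first.
  by move=> k; apply/measurable_EFinP; exact: measurable_indic.
rewrite [e](splitr e) EFinD leeD ?lee_fin//.
apply: (@le_trans _ _ (b%:E * \sum_(k < N) (e / (2 * N%:R * (b + 1)))%:E)%E).
  apply: lee_wpmul2l; first by rewrite lee_fin.
  by apply: lee_sum => k _; rewrite integral_indic// setIT; exact: hd.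
rewrite sumEFin -EFinM lee_fin sumr_const card_ord -[X in b * X]mulr_natl.
have -> : b * (N%:R * (e / (2 * N%:R * (b + 1)))) = e / 2 * (b / (b + 1)).
  by field; rewrite !gt_eqF// ltr_wpDl.
by rewrite ler_piMr ?divr_ge0 ?(ltW e0)// ler_pdivrMr ?mul1r ?lerDl// ltr_wpDl.
Qed.

End translation.

(** * Probabilities of small balls *)

Section density.
Context {R : realType} {n : nat}.
Notation lam := (@lebesgue_rV R n).
Variables (F : probability 'rV[R]_n R) (f : 'rV[R]_n -> R).
Hypotheses (FE : forall A, measurable A -> F A = (\int[lam]_(x in A) (f x)%:E)%E)
  (mf : measurable_fun setT f) (f0 : forall x, 0 <= f x).

Let measurable_undergraph (h : 'rV[R]_n -> R) : measurable_fun setT h ->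
  measurable_fun setT (fun p : 'rV[R]_n * R => (0 <= p.2) && (p.2 < h p.1)).
Proof.
move=> mh; apply: measurable_and; first exact: measurable_fun_ler.
apply: measurable_fun_ltr => //; exact: (measurableT_comp mh measurable_fst).
Qed.

(** Writing [h] as the integral of the indicator of its undergraph, Tonelli's theorem reduces the
    claim to the sets where [h] exceeds a level, for which it is the hypothesis [FE]. *)
Lemma ge0_integral_density (h : 'rV[R]_n -> R) : measurable_fun setT h ->
  (forall x, 0 <= h x) ->
  (\int[F]_x (h x)%:E = \int[lam]_x (h x * f x)%:E)%E.
Proof.
move=> mh h0.
pose b (p : 'rV[R]_n * R) := (0 <= p.2) && (p.2 < h p.1).
pose S : set ('rV[R]_n * R) := [set p | b p].
have mS : measurable S.
  by rewrite -[X in measurable X]setTI; apply: (measurable_undergraph mh) => //; exact: (measurable_set1 true).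
pose k (p : 'rV[R]_n * R) : \bar R := (\1_S p)%:E.
have mk : measurable_fun setT k by apply/measurable_EFinP; exact: measurable_indic.
have k0 p : (0 <= k p)%E by rewrite lee_fin.
have kx x : (\int[lebesgue_measure]_s k (x, s) = (h x)%:E)%E.
  transitivity (\int[lebesgue_measure]_s (\1_(`[0%R, h x[%classic : set R) s : R)%:E)%E.
    by apply: eq_integral => s _; rewrite /k !indicE /= !mem_setE /b /= in_itv.
  rewrite integral_indic//= setIT lebesgue_measure_itv/= lte_fin.
  by case: ifPn => [_|]; rewrite ?oppr0 ?adde0// -leNgt => hx; congr EFin; apply/eqP; rewrite eq_le h0 hx.
have mSs s : measurable [set x | b (x, s)].
  rewrite (_ : [set _ | _] = (fun x => (x, s)) @^-1` S); last by [].
  by rewrite -[X in measurable X]setTI; exact: pair2_measurable.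
have ks s : (\int[F]_x k (x, s) = \int[lam]_x (k (x, s) * (f x)%:E))%E.
  transitivity (F [set x | b (x, s)]).
    transitivity (\int[F]_x (\1_[set x | b (x, s)] x)%:E)%E; last by rewrite integral_indic// setIT.
    by apply: eq_integral => x _; rewrite /k !indicE !mem_setE.
  rewrite FE// integral_mkcond; apply: eq_integral => x _.
  rewrite patchE /k indicE /S.
  have -> : (x \in [set x | b (x, s)]) = ((x, s) \in [set p | b p]) by rewrite !mem_setE.
  by case: ifP => _; rewrite ?mul1e ?mul0e.
transitivity (\int[F]_x \int[lebesgue_measure]_s k (x, s))%E.
  by apply: eq_integral => x _; rewrite kx.
rewrite fubini_tonelli//.
have mkf : measurable_fun setT (fun p : 'rV[R]_n * R => k p * (f p.1)%:E)%E.
  apply: emeasurable_funM => //; apply/measurable_EFinP.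
  exact: (measurableT_comp mf measurable_fst).
transitivity (\int[lebesgue_measure]_s \int[lam]_x (k (x, s) * (f x)%:E))%E.
  by apply: eq_integral => s _; rewrite ks.
transitivity (\int[lam]_x \int[lebesgue_measure]_s (k (x, s) * (f x)%:E))%E.
  apply/esym; apply: (fubini_tonelli (m1 := lam) (m2 := lebesgue_measure) _ mkf).
  by move=> p; rewrite mule_ge0// lee_fin.
apply: eq_integral => x _.
under eq_integral do rewrite muleC.
rewrite ge0_integralZl//; last by rewrite lee_fin.
  by rewrite kx -EFinM mulrC.
exact: (measurableT_comp mk (pair1_measurable x)).
Qed.

Lemma density_supp : F (supp f) = 1%E.
Proof.
have ms : measurable (supp f).
  rewrite (_ : supp f = f @^-1` `]0, +oo[%classic).
    by rewrite -[X in measurable X]setTI; exact: mf.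
  by apply/seteqP; split=> x; rewrite /supp /= in_itv/= andbT.
rewrite -(probability_setT F) !FE// [LHS]integral_mkcond; apply: eq_integral => x _.
rewrite patchE; case: ifPn => //; rewrite notin_setE /supp /= => /negP.
by rewrite -leNgt => fx; congr EFin; apply/esym/eqP; rewrite eq_le f0 fx.
Qed.

Lemma measurable_supp : measurable (supp f).
Proof.
rewrite (_ : supp f = f @^-1` `]0, +oo[%classic).
  by rewrite -[X in measurable X]setTI; exact: mf.
by apply/seteqP; split=> x; rewrite /supp /= in_itv/= andbT.
Qed.

Lemma density_le (b : R) (A : set 'rV[R]_n) : measurable A -> (forall x, f x <= b) ->
  (F A <= b%:E * lam A)%E.
Proof.
move=> mA fb; rewrite FE//; apply: (@le_trans _ _ (\int[lam]_(x in A) (cst b%:E x))%E).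
  apply: ge0_le_integral => //.
  - by move=> x _; rewrite lee_fin.
  - by apply/measurable_EFinP; exact: measurable_funTS.
  - by move=> x _; rewrite lee_fin.
by rewrite integral_cst.
Qed.

Lemma density_ge (a : R) (A : set 'rV[R]_n) : measurable A -> 0 <= a ->
  (forall x, A x -> a <= f x) -> (a%:E * lam A <= F A)%E.
Proof.
move=> mA a0 fa; rewrite FE// -integral_cst//; apply: ge0_le_integral => //.
by apply/measurable_EFinP; exact: measurable_funTS.
Qed.

Definition ball_prob x r : R := fine (F (eball x r)).

Lemma ball_probE x r : (ball_prob x r)%:E = F (eball x r).
Proof. by rewrite fineK// fin_num_measure//; exact: measurable_eball. Qed.

Lemma ball_prob_01 x r : 0 <= ball_prob x r <= 1.
Proof.
rewrite -!lee_fin ball_probE measure_ge0/=; apply: probability_le1.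
exact: measurable_eball.
Qed.

Lemma ball_prob_le (b : R) x r : 0 <= r -> (forall x, f x <= b) ->
  ball_prob x r <= b * ball_vol n * r ^+ n.
Proof.
move=> r0 fb; rewrite -lee_fin ball_probE.
apply: (le_trans (density_le (measurable_eball x r) fb)).
by rewrite lebesgue_eball_ge0// -EFinM mulrA.
Qed.

Lemma measurable_ball_prob r : measurable_fun setT (fun x => ball_prob x r).
Proof.
apply: measurableT_comp => //.
pose E := [set p : 'rV[R]_n * 'rV[R]_n | edist p.1 p.2 <= r].
rewrite (_ : (fun x => F (eball x r)) = (F \o xsection E)).
  by apply: measurable_fun_xsection; exact: measurable_eball_pair.
apply/funext => x /=; congr (F _); apply/seteqP; split=> y;
  by rewrite /xsection /E /= inE.
Qed.

End density.

(** * Lower bound for the probability of balls centered in the support *)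

Section lower_bound.
Context {R : realType} {n : nat}.
Notation lam := (@lebesgue_rV R n).

Lemma coord_le_norm (x : 'rV[R]_n) i : `|x ord0 i| <= `|x|.
Proof. by rewrite [leRHS]/Num.norm /= mx_normrE; apply/bigmax_geP; right => /=; exists (ord0, i). Qed.

(** Each piece contains a cube, and convexity adds the segments from any of its points [x] to that
    cube. Since there are finitely many pieces, the sizes [M] and [e] can be chosen uniformly; only
    the center [z] depends on [x]. *)
Lemma convex_body_union_cubes (A : set 'rV[R]_n) : convex_body_union A ->
  exists M e : R, [/\ 0 < M, 0 < e, A `<=` box n M &
    forall x, A x -> exists z : 'rV[R]_n, forall v : 'rV[R]_n, (forall i, `|v ord0 i - z ord0 i| <= e) ->
      forall t : R, 0 <= t <= 1 -> A (x + t *: (v - x))].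
Proof.
move=> [m [C [-> hC]]].
have /choice[MM hM] : forall i : 'I_m, exists M : R, 0 <= M /\ C i `<=` box n M.
  move=> i; have [_ [M [_ hM]] _] := hC i.
  exists (`|M| + 1); split; first by rewrite addr_ge0.
  move=> x Cx k /=; rewrite in_itv/= -ler_norml (le_trans (coord_le_norm x k))//.
  by apply: hM => //; rewrite ltr_pwDr// ler_norm.
have /choice[ze hz] : forall i : 'I_m, exists ze : 'rV[R]_n * R, 0 < ze.2 /\
    forall v : 'rV[R]_n, (forall k, `|v ord0 k - ze.1 ord0 k| <= ze.2) -> C i v.
  move=> i; have [_ _ [z /nbhs_ballP[e /= e0 he]]] := hC i.
  exists (z, e / 2); split => /=; first by rewrite divr_gt0.
  move=> v hv; apply: he; split => // a k; rewrite ord1 /ball /= distrC (le_lt_trans (hv k))//.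
  by lra.
pose e := \big[Num.min/1]_i (ze i).2.
(* The sum dominates the bound of every piece, and the added 1 makes it positive. *)
exists (1 + \sum_i MM i), e; split.
- by rewrite ltr_wpDr// sumr_ge0// => i _; have [] := hM i.
- by apply: lt_bigmin => // i _; have [] := hz i.
- move=> x [i _ Cx] k; have [M0 /(_ _ Cx k)] := hM i.
  rewrite /= !in_itv/= -!ler_norml => /le_trans; apply.
  rewrite (bigD1 i)//= addrCA lerDl addr_ge0// sumr_ge0// => l _.
  by have [] := hM l.
- move=> x [i _ Cx]; exists (ze i).1 => v hv t t01; exists i => //.
  have Cv : C i v.
    by apply: (hz i).2 => k; rewrite (le_trans (hv k))//; exact: bigmin_le.
  have [cC _ _] := hC i.
  have t0 : 0 <= t by case/andP: t01.
  have [T hT] : exists T : {i01 R}, T%:num = t.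
    by exists (Itv01 t0 (proj2 (andP t01))).
  have := cC v x T; rewrite !inE => /(_ Cv Cx).
  move=> h; apply: (eq_ind _ (C i) h).
  transitivity (t *: v + (1 - t) *: x); first by rewrite -hT.
  by apply/rowP => k; rewrite !mxE; ring.
Qed.

Variables (F : probability 'rV[R]_n R) (f : 'rV[R]_n -> R).
Hypotheses (FE : forall A, measurable A -> F A = (\int[lam]_(x in A) (f x)%:E)%E)
  (mf : measurable_fun setT f) (f0 : forall x, 0 <= f x).

(* The homothety of center [x] and ratio proportional to [r] maps a cube
   contained in the convex piece of [x] into the ball of radius [r]. *)
Lemma ball_prob_lower (a : R) : (0 < n)%N -> convex_body_union (supp f) -> 0 < a ->
  (forall x, supp f x -> a <= f x) ->
  exists c D : R, [/\ 0 < c, 0 < D,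
    forall x y, supp f x -> supp f y -> edist x y <= D &
    forall x r, supp f x -> 0 <= r -> r <= D -> c * r ^+ n <= ball_prob F x r].
Proof.
move=> n0 /convex_body_union_cubes[M [e [M0 e0 sM hc]]] a0 fa.
pose D : R := n%:R * (2 * M).
have D0 : 0 < D by rewrite mulr_gt0 ?ltr0n// mulr_gt0.
have dD x y : supp f x -> box n M y -> edist x y <= D.
  move=> /sM sx sy; apply: edist_le_sup; first by rewrite mulr_ge0// ltW.
  move=> i; have := sx i; have := sy i; rewrite /= !in_itv/= ler_norml => /andP[? ?] /andP[? ?].
  by apply/andP; split; lra.
(* [D] bounds the diameter of the support. The homothety of ratio [r / D] turns a cube of side
   [2 * e] into one of side [2 * e * r / D], on which the density is at least [a]. *)
exists (a * (2 * e / D) ^+ n), D; split => //.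
- by rewrite mulr_gt0// exprn_gt0// divr_gt0// mulr_gt0.
- by move=> x y sx /sM; exact: dD.
move=> x r sx; rewrite le_eqVlt => /predU1P[<-|r0] rD.
  by rewrite expr0n eqn0Ngt n0 mulr0; case/andP: (ball_prob_01 F x 0).
have [z hz] := hc x sx.
pose t := r / D; have t0 : 0 < t by rewrite divr_gt0.
have t1 : t <= 1 by rewrite ler_pdivrMr// mul1r.
have ti0 : 0 < t^-1 by rewrite invr_gt0.
pose Q : set 'rV[R]_n := [set v | forall i, `[z ord0 i - e, z ord0 i + e]%classic (v ord0 i)].
have mQ : measurable Q.
  by apply: (@measurable_rV_box _ n (fun i => `[z ord0 i - e, z ord0 i + e]%classic)) => i.
have lQ : lam Q = ((2 * e) ^+ n)%:E.
  rewrite (@lebesgue_rV_box _ n (fun i => `[z ord0 i - e, z ord0 i + e]%classic))//.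
  rewrite (eq_bigr (fun=> (2 * e)%:E)).
    by rewrite prodEFin big_const_ord iter_mulr_1.
  move=> i _; rewrite lebesgue_measure_itv/= lte_fin ifT; last by lra.
  by rewrite -EFinD; congr EFin; lra.
(* The image [A] of the cube [Q] under the homothety is written as a preimage under the inverse map,
   so that the scaling formula for Lebesgue measure applies. *)
pose w := x - t^-1 *: x.
pose A := (fun y => w + t^-1 *: y) @^-1` Q.
have mA : measurable A.
  by apply: measurable_rV_preimage => //; exact: measurable_rV_affine.
have yE y : y = x + t *: ((w + t^-1 *: y) - x).
  by apply/rowP => i; rewrite /w !mxE; field; rewrite gt_eqF.
have e1 y : x + 1 *: (w + t^-1 *: y - x) = w + t^-1 *: y by rewrite scale1r addrC subrK.
have As y : A y -> supp f y.
  move=> Ay; rewrite (yE y); apply: hz; last by rewrite t1 ltW.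
  by move=> i; have := Ay i; rewrite /= in_itv/= ler_norml => /andP[? ?]; apply/andP; split; lra.
have Ar y : A y -> eball x r y.
  move=> Ay; rewrite /eball /= (yE y).
  have sv : supp f (w + t^-1 *: y).
    have := hz (w + t^-1 *: y) _ 1; rewrite e1; apply; last by rewrite ler01 lexx.
    by move=> i; have := Ay i; rewrite /= in_itv/= ler_norml => /andP[? ?]; apply/andP; split; lra.
  rewrite edist_affine ?(ltW t0)//.
  have -> : edist 0 (w + t^-1 *: y - x) = edist x (w + t^-1 *: y).
    have := edist_affine x (w + t^-1 *: y - x) ler01.
    by rewrite mul1r e1.
  have -> : r = t * D by rewrite /t divfK// gt_eqF.
  by rewrite ler_pM2l// dD//; exact: sM.
rewrite -lee_fin ball_probE; apply: (@le_trans _ _ (F A)); last first.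
  by apply: le_measure => //; rewrite inE//; exact: measurable_eball.
apply: le_trans (density_ge FE mf mA (ltW a0) _); last by move=> y /As; exact: fa.
rewrite lebesgue_rV_affine// invrK lQ -!EFinM lee_fin -mulrA -!exprMn.
rewrite le_eqVlt; apply/orP; left; apply/eqP; congr (_ * _ ^+ _).
by rewrite /t; ring.
Qed.

End lower_bound.

(** * Comparison in L^1 of ball probabilities with the density *)

Section ball_prob_L1.
Context {R : realType} {n : nat}.
Notation lam := (@lebesgue_rV R n).
Variables (F : probability 'rV[R]_n R) (f : 'rV[R]_n -> R) (b M : R).
Hypotheses (FE : forall A, measurable A -> F A = (\int[lam]_(x in A) (f x)%:E)%E)
  (mf : measurable_fun setT f) (f0 : forall x, 0 <= f x) (fb : forall x, f x <= b)
  (M0 : 0 < M) (fM : forall x, 0 < f x -> box n M x).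

(* The difference is the integral of [r ^+ n * (f (x + r *: v) - f x)] over [v] in
   the unit ball. *)
Lemma ball_prob_L1 (e : R) : 0 < e -> exists2 del : R, 0 < del &
  forall r, 0 < r <= del ->
  (\int[lam]_x `|ball_prob F x r - ball_vol n * r ^+ n * f x|%:E <= (r ^+ n * e)%:E)%E.
Proof.
move=> e0; have v0 := @ball_vol_gt0 R n.
have b0 : 0 <= b by exact: le_trans (f0 0) (fb 0).
(* The tolerance is divided by the volume of the unit ball because it is going to be integrated over
   that ball. *)
have [del d0 hd] := translation_continuous_L1 mf f0 fb M0 fM (divr_gt0 e0 v0).
exists del => // r /andP[r0 rd].
pose B1 := eball (0 : 'rV[R]_n) 1.
have mB1 : measurable B1 by exact: measurable_eball.
have mi1 : measurable_fun setT (fun v => (\1_B1 v)%:E : \bar R).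
  by apply/measurable_EFinP; exact: measurable_indic.
pose k (p : 'rV[R]_n * 'rV[R]_n) : \bar R :=
  ((\1_B1 p.2)%:E * `|f (p.1 + r *: p.2) - f p.1|%:E)%E.
have maff : measurable_fun setT (fun p : 'rV[R]_n * 'rV[R]_n => p.1 + r *: p.2).
  apply/measurable_fun_rVP => i.
  rewrite (_ : (fun _ => _) = (fun p : 'rV[R]_n * 'rV[R]_n => p.1 ord0 i + r * p.2 ord0 i)).
    apply: measurable_funD; last apply: measurable_funM => //.
      exact: (measurableT_comp (@measurable_rV_coord _ R n i) measurable_fst).
    exact: (measurableT_comp (@measurable_rV_coord _ R n i) measurable_snd).
  by apply/funext => p; rewrite !mxE.
have mk : measurable_fun setT k.
  apply: emeasurable_funM; first exact: (measurableT_comp mi1 measurable_snd).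
  apply/measurable_EFinP; apply: measurableT_comp => //; apply: measurable_funB.
    exact: (measurableT_comp mf maff).
  exact: (measurableT_comp mf measurable_fst).
have k0 p : (0 <= k p)%E by rewrite mule_ge0// lee_fin.
have mfx (x : 'rV[R]_n) : measurable_fun setT (fun v : 'rV[R]_n => f (x + r *: v)).
  exact: (measurableT_comp mf (@measurable_rV_affine R n x r)).
have mkx x : measurable_fun setT (fun v => k (x, v)) by exact: (measurableT_comp mk (pair1_measurable x)).
have vE : lam B1 = (ball_vol n)%:E by rewrite lebesgue_eball// expr1n mulr1.
have i1 (c : R) : 0 <= c -> (\int[lam]_v ((\1_B1 v)%:E * c%:E) = (ball_vol n * c)%:E)%E.
  move=> c0; under eq_integral do rewrite muleC.
  rewrite ge0_integralZl//.
  by rewrite integral_indic// setIT [X in (_ * X)%E]vE -EFinM mulrC.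
have Hle x : (\int[lam]_v k (x, v) <= (ball_vol n * b)%:E)%E.
  rewrite -i1//; apply: ge0_le_integral => //.
  - by apply: emeasurable_funM.
  - move=> v _; apply: lee_wpmul2l; first by rewrite lee_fin.
    rewrite lee_fin ler_norml /=; have := f0 x; have := fb x; have := f0 (x + r *: v); have := fb (x + r *: v).
    by move=> *; apply/andP; split; lra.
have Hfin x : (\int[lam]_v k (x, v))%E \is a fin_num.
  rewrite ge0_fin_numE ?integral_ge0//; exact: le_lt_trans (Hle x) (ltry _).
pose H x := fine (\int[lam]_v k (x, v))%E.
have G1E x : ((ball_prob F x r)%:E = (r ^+ n)%:E * \int[lam]_v ((\1_B1 v)%:E * (f (x + r *: v))%:E))%E.
  rewrite ball_probE// FE; last exact: measurable_eball.
  rewrite integral_mkcond.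
  pose g y : \bar R := ((\1_(eball x r) y)%:E * (f y)%:E)%E.
  have mg : measurable_fun setT g.
    apply: emeasurable_funM; apply/measurable_EFinP => //.
    by apply: measurable_indic; exact: measurable_eball.
  have g0 y : (0 <= g y)%E by rewrite mule_ge0// lee_fin.
  transitivity (\int[lam]_y g y)%E.
    apply: eq_integral => y _; rewrite patchE /g indicE.
    by case: ifP => _; rewrite ?mul1e ?mul0e.
  have := ge0_integral_affine x r0 mg g0.
  rewrite (_ : (fun v => g (x + r *: v)) = (fun v => (\1_B1 v)%:E * (f (x + r *: v))%:E)%E); last first.
    apply/funext => v; rewrite /g !indicE; congr ((_%:R)%:E * _)%E.
    congr nat_of_bool; apply/idP/idP; rewrite !inE /B1 /eball /= edist_affine ?(ltW r0)//.
      by rewrite ger_pMr.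
    by move=> h; rewrite ger_pMr.
  move=> ->; rewrite muleA -EFinM -exprMn divff ?gt_eqF// expr1n mul1e //.
have mG (v' : 'rV[R]_n) : measurable_fun setT (fun v : 'rV[R]_n => (\1_B1 v)%:E * (f (v' + r *: v))%:E)%E.
  by apply: emeasurable_funM => //; apply/measurable_EFinP.
have G0 (v' v : 'rV[R]_n) : (0 <= (\1_B1 v)%:E * (f (v' + r *: v))%:E :> \bar R)%E.
  by rewrite mule_ge0// lee_fin.
have rn0 : 0 <= r ^+ n by rewrite exprn_ge0// ltW.
(* The absolute value is obtained from two one-sided bounds between sums of nonnegative integrals,
   which avoids subtracting extended reals. *)
have pt x : `|ball_prob F x r - ball_vol n * r ^+ n * f x| <= r ^+ n * H x.
  have HE : (\int[lam]_v k (x, v) = (H x)%:E)%E by rewrite fineK.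
  have mc : measurable_fun setT (fun v => (\1_B1 v)%:E * (f x)%:E)%E by apply: emeasurable_funM.
  have c0 v : (0 <= (\1_B1 v)%:E * (f x)%:E :> \bar R)%E by rewrite mule_ge0// lee_fin.
  have h1 : ball_prob F x r <= r ^+ n * (ball_vol n * f x + H x).
    rewrite -lee_fin G1E EFinM lee_wpmul2l ?lee_fin// EFinD -HE -i1// -ge0_integralD//.
    apply: ge0_le_integral => //.
    - by apply: emeasurable_funD.
    - move=> v _; rewrite /k /= -EFinM -!EFinM -EFinD lee_fin -mulrDr ler_wpM2l//.
      by rewrite -lerBlDl ler_norm.
  have h2 : r ^+ n * (ball_vol n * f x) <= ball_prob F x r + r ^+ n * H x.
    rewrite -lee_fin EFinM -i1// EFinD G1E [X in (_ <= _ + X)%E]EFinM -HE -ge0_muleDr; last 2 first.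
    - exact: integral_ge0.
    - exact: integral_ge0.
    rewrite lee_wpmul2l ?lee_fin// -ge0_integralD//.
    apply: ge0_le_integral => //.
    - by apply: emeasurable_funD.
    - move=> v _; rewrite /k /= -!EFinM -EFinD lee_fin -mulrDr ler_wpM2l//.
      by rewrite -lerBlDl distrC ler_norm.
  by rewrite ler_norml; apply/andP; split; lra.
apply: (@le_trans _ _ (\int[lam]_x ((r ^+ n)%:E * \int[lam]_v k (x, v)))%E).
  apply: ge0_le_integral => //.
  - apply/measurable_EFinP; apply: measurableT_comp => //; apply: measurable_funB.
      exact: measurable_ball_prob.
    exact: measurable_funM.
  - by apply: measurable_funeM; exact: (measurable_fun_fubini_tonelli_F (m2 := lam) _ mk).
  - by move=> x _; rewrite -(fineK (Hfin x)) -EFinM lee_fin; exact: pt.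
rewrite ge0_integralZl//; last 2 first.
- exact: (measurable_fun_fubini_tonelli_F (m2 := lam) _ mk).
- by move=> x _; exact: integral_ge0.
rewrite EFinM lee_wpmul2l ?lee_fin//.
(* After the exchange, each [v] in the unit ball contributes the L^1 distance between [f] and its
   translate by [r *: v], a vector whose coordinates are at most [r <= del] in absolute value. *)
rewrite (fubini_tonelli (m1 := lam) (m2 := lam) _ mk)//.
have -> : e%:E = (\int[lam]_v ((\1_B1 v)%:E * (e / ball_vol n)%:E))%E.
  by rewrite i1 ?divr_ge0 ?ltW// mulrC divfK// gt_eqF.
apply: ge0_le_integral => //.
- by move=> v _; exact: integral_ge0.
- exact: (measurable_fun_fubini_tonelli_G (m1 := lam) _ mk).
- by apply: emeasurable_funM.
- move=> v _; rewrite /k /= ge0_integralZl//=; last first.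
    apply/measurable_EFinP; apply: measurableT_comp => //; apply: measurable_funB => //.
    exact: (measurableT_comp mf (measurableT_comp maff (pair2_measurable v))).
  rewrite indicE; case: (boolP (v \in B1)) => [|_]; last by rewrite !mul0e.
  rewrite inE => hv; rewrite !mul1e; apply: hd => i.
  rewrite mxE normrM (gtr0_norm r0) (le_trans _ rd)// ger_pMr//.
  by have := edist_le_coord i hv; rewrite mxE sub0r normrN.
Qed.

End ball_prob_L1.

(** * Limit of the binomial tail at the nearest neighbor scale *)

Section tail.
Context {R : realType} {n : nat}.
Notation lam := (@lebesgue_rV R n).

Lemma near_natS (c : R) : \forall N \near \oo, c <= N.+1%:R.
Proof.
near=> N; apply: (@le_trans _ _ N%:R); last by rewrite ler_nat.
by near: N; exact: nbhs_infty_ger.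
Unshelve. all: end_near. Qed.

Lemma measurable_binomial_lt m j : measurable_fun setT (binomial_lt m j : R -> R).
Proof.
elim: m j => [|m ih] [|j] /=; do ?exact: measurable_cst.
apply: measurable_funD; first exact: measurable_funM.
by apply: measurable_funM => //; exact: measurable_funB.
Qed.

Lemma measurable_poisson_lt j : measurable_fun setT (poisson_lt j : R -> R).
Proof. by apply: continuous_measurable_fun; exact: continuous_poisson_lt. Qed.

(* The radius of a ball of volume [ball_vol n * (u / N)]. *)
Definition knn_radius (u : R) (N : nat) : R := (u / N%:R) `^ n%:R^-1.

Lemma knn_radius_ge0 u N : 0 <= knn_radius u N.
Proof. exact: powR_ge0. Qed.

Lemma knn_radiusX u N : (0 < n)%N -> 0 <= u -> knn_radius u N ^+ n = u / N%:R.
Proof.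
move=> n0 u0; rewrite -powR_mulrn ?powR_ge0// -powRrM mulVf ?powRr1 ?divr_ge0//.
by rewrite pnatr_eq0 -lt0n.
Qed.

Lemma knn_radius_gt0 u N : 0 < u -> (0 < N)%N -> 0 < knn_radius u N.
Proof. by move=> u0 N0; rewrite powR_gt0// divr_gt0// ltr0n. Qed.

Variables (F : probability 'rV[R]_n R) (f : 'rV[R]_n -> R) (b M : R).
Hypotheses (n0 : (0 < n)%N)
  (FE : forall A, measurable A -> F A = (\int[lam]_(x in A) (f x)%:E)%E)
  (mf : measurable_fun setT f) (f0 : forall x, 0 <= f x) (fb : forall x, f x <= b)
  (M0 : 0 < M) (fM : forall x, 0 < f x -> box n M x).

Lemma bounded_binomial_ball m j r :
  bounded_meas (fun x => binomial_lt m j (ball_prob F x r)).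
Proof.
split.
  apply: (measurableT_comp (measurable_binomial_lt m j)).
  exact: measurable_ball_prob.
exists 1 => x; have := binomial_lt_bounds m j (ball_prob_01 F x r).
by move=> /andP[h1 h2]; rewrite ger0_norm.
Qed.

Lemma bounded_poisson j (c : R) : 0 <= c -> bounded_meas (fun x => poisson_lt j (c * f x)).
Proof.
move=> c0; split.
  by apply: (measurableT_comp (measurable_poisson_lt j)); exact: measurable_funM.
by exists 1 => x; rewrite ger0_norm ?poisson_lt_ge0 ?poisson_lt_le1// mulr_ge0.
Qed.

(** Three replacements are made under the expectation: the ball probability by the volume of the
    ball times the density, through the Lipschitz bound and the L^1 estimate; the binomial tail by a
    Poisson tail; and the parameter [N * q] by [N.+1 * q]. The bound [f <= b] converts the
    expectation under [F] into a Lebesgue integral. *)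
Lemma tail_cvg (u : R) j : 0 < u ->
  Ex F (fun x => binomial_lt N j (ball_prob F x (knn_radius u N.+1))) @[N --> \oo] -->
  Ex F (fun x => poisson_lt j (ball_vol n * u * f x)).
Proof.
move=> u0; have v0 := @ball_vol_gt0 R n.
have b0 : 0 <= b by exact: le_trans (f0 0) (fb 0).
apply/cvgrPdist_le => e e0.
pose c := ball_vol n * u * b.
have c0 : 0 <= c by rewrite !mulr_ge0// ltW.
(* The first replacement costs at most [b * u * e'], which is thus at most [e / 2]. *)
pose e' := e / (2 * (b * u + 1)).
have bu0 : 0 < b * u + 1 by rewrite ltr_wpDl// mulr_ge0// ltW.
have e'0 : 0 < e' by rewrite divr_gt0// mulr_gt0.
have [del d0 hd] := ball_prob_L1 FE mf f0 fb M0 fM e'0.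
near=> N.
have N1 : 0 < N.+1%:R :> R by [].
(* [h1] makes the radius at most [del], [h2] makes [q] a probability, and [h3] bounds the last two
   replacements by [e / 2]. *)
have h1 : u / del ^+ n <= N.+1%:R.
  by near: N; exact: near_natS.
have h2 : c <= N.+1%:R by near: N; exact: near_natS.
have h3 : 2 * (2 * c ^+ 2 + c) / e <= N.+1%:R by near: N; exact: near_natS.
pose r := knn_radius u N.+1.
have r0 : 0 < r by exact: knn_radius_gt0.
have rn : r ^+ n = u / N.+1%:R by apply: knn_radiusX => //; exact: ltW.
have rd : r <= del.
  rewrite -(ler_pXn2r n0) ?nnegrE ?(ltW r0) ?(ltW d0)// rn.
  by rewrite ler_pdivrMr// mulrC -ler_pdivrMr ?exprn_gt0.
pose D x : R := `|ball_prob F x r - ball_vol n * r ^+ n * f x|.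
have mD : measurable_fun setT D.
  apply: measurableT_comp => //; apply: measurable_funB; first exact: measurable_ball_prob.
  exact: measurable_funM.
have D0 x : 0 <= D x by exact: normr_ge0.
have bD : bounded_meas D.
  split => //; exists (1 + ball_vol n * r ^+ n * b) => x; rewrite normr_id.
  have /andP[p0 p1] := ball_prob_01 F x r.
  rewrite (le_trans (ler_normB _ _))// lerD ?ger0_norm//.
    by rewrite ler_wpM2l// mulr_ge0 ?exprn_ge0// ltW.
  by rewrite !mulr_ge0 ?exprn_ge0// ltW.
have ED : Ex F D <= b * (u / N.+1%:R * e').
  rewrite -lee_fin EFin_Ex// (ge0_integral_density FE)//.
  apply: (@le_trans _ _ (\int[lam]_x (b%:E * (D x)%:E))%E).
    apply: ge0_le_integral => //.
    - by move=> x _; rewrite lee_fin mulr_ge0.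
    - by apply/measurable_EFinP; exact: measurable_funM.
    - by apply: measurable_funeM; apply/measurable_EFinP.
    - by move=> x _; rewrite -EFinM lee_fin mulrC ler_wpM2r.
  rewrite ge0_integralZl//; last 2 first.
  - by apply/measurable_EFinP.
  - by move=> x _; rewrite lee_fin.
  by rewrite EFinM lee_wpmul2l ?lee_fin// -rn; apply: hd; rewrite r0.
pose K x : R := N%:R * D x + (2 * c ^+ 2 + c) / N.+1%:R.
have bK : bounded_meas K.
  by apply: bounded_measD; [exact: bounded_measZ|exact: bounded_meas_cst].
have gK x : `|binomial_lt N j (ball_prob F x r) - poisson_lt j (ball_vol n * u * f x)| <= K x.
  pose q := ball_vol n * r ^+ n * f x.
  have qE : q = ball_vol n * u * f x / N.+1%:R by rewrite /q rn; ring.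
  have cx0 : 0 <= ball_vol n * u * f x by rewrite !mulr_ge0// ltW.
  have cxc : ball_vol n * u * f x <= c by rewrite ler_wpM2l// mulr_ge0// ltW.
  have q0 : 0 <= q by rewrite qE divr_ge0.
  have q1 : q <= 1 by rewrite qE ler_pdivrMr// mul1r (le_trans cxc).
  have qc : q <= c / N.+1%:R by rewrite qE ler_wpM2r// invr_ge0.
  have Nq0 : 0 <= N%:R * q by rewrite mulr_ge0.
  have -> : binomial_lt N j (ball_prob F x r) - poisson_lt j (ball_vol n * u * f x) =
     (binomial_lt N j (ball_prob F x r) - binomial_lt N j q) +
     (binomial_lt N j q - poisson_lt j (N%:R * q)) +
     (poisson_lt j (N%:R * q) - poisson_lt j (ball_vol n * u * f x)) by ring.
  apply: (le_trans (ler_normD _ _)); 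
  have -> : K x = (N%:R * D x + 2 * c ^+ 2 / N.+1%:R) + c / N.+1%:R by rewrite /K; ring.
  apply: lerD; last first.
    apply: (le_trans (poisson_lt_lip_norm _ _ _)) => //.
    have -> : ball_vol n * u * f x = N.+1%:R * q by rewrite qE mulrCA divff ?mulr1// gt_eqF.
    have -> : N%:R * q - N.+1%:R * q = - q by rewrite -natr1; ring.
    by rewrite normrN ger0_norm.
  apply: (le_trans (ler_normD _ _)); apply: lerD.
    by apply: binomial_lt_lip; rewrite ?ball_prob_01// q0.
  have q01 : 0 <= q <= 1 by rewrite q0.
  apply: (le_trans (binomial_poisson N j q01)).
  apply: (@le_trans _ _ (2 * N.+1%:R * (c / N.+1%:R) ^+ 2)).
    have qq : q ^+ 2 <= (c / N.+1%:R) ^+ 2 by rewrite lerXn2r ?nnegrE ?divr_ge0.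
    apply: (@le_trans _ _ (2 * N%:R * (c / N.+1%:R) ^+ 2)).
      by rewrite ler_wpM2l// mulr_ge0.
    by rewrite ler_wpM2r ?sqr_ge0// ler_wpM2l// ler_nat.
  rewrite le_eqVlt; apply/orP; left; apply/eqP.
  by field; rewrite gt_eqF// -natr1.
have bg := bounded_binomial_ball N j r.
have bh : bounded_meas (fun x => poisson_lt j (ball_vol n * u * f x)).
  by apply: bounded_poisson; rewrite mulr_ge0// ltW.
have EK : Ex F K <= e.
  rewrite /K ExD; [|exact: bounded_measZ|exact: bounded_meas_cst].
  rewrite ExZ//.
  rewrite (Ex_cst F ((2 * c ^+ 2 + c) / N.+1%:R)).
  rewrite [e in leRHS](splitr e); apply: lerD.
    apply: (@le_trans _ _ (N%:R * (b * (u / N.+1%:R * e')))); first by rewrite ler_wpM2l.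
    have -> : N%:R * (b * (u / N.+1%:R * e')) = (N%:R / N.+1%:R) * (b * u * e') by ring.
    apply: (@le_trans _ _ (b * u * e')).
      have z0 : 0 <= b * u * e' by exact: mulr_ge0 (mulr_ge0 b0 (ltW u0)) (ltW e'0).
      by rewrite ler_piMl// ler_pdivrMr// mul1r ler_nat.
    have -> : b * u * e' = e / 2 * (b * u / (b * u + 1)).
      by rewrite /e'; field; rewrite gt_eqF.
    by rewrite ler_piMr ?divr_ge0 ?(ltW e0)// ler_pdivrMr// mul1r lerDl.
  move: h3; rewrite ler_pdivrMr// => h3.
  by rewrite ler_pdivrMr//; lra.
apply: le_trans EK.
have le1 : Ex F (fun x => binomial_lt N j (ball_prob F x r)) <=
    Ex F (fun x => poisson_lt j (ball_vol n * u * f x)) + Ex F K.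
  rewrite -ExD//; apply: le_Ex => //; first exact: bounded_measD.
  by move=> x; have := gK x; rewrite ler_norml => /andP[? ?]; lra.
have le2 : Ex F (fun x => poisson_lt j (ball_vol n * u * f x)) <=
    Ex F (fun x => binomial_lt N j (ball_prob F x r)) + Ex F K.
  rewrite -ExD//; apply: le_Ex => //; first exact: bounded_measD.
  by move=> x; have := gK x; rewrite ler_norml => /andP[? ?]; lra.
by rewrite ler_norml; apply/andP; split; lra.
Unshelve. all: end_near. Qed.

End tail.

(** * Nearest neighbor distances *)

Section kth.
Context {R : realType}.
Implicit Types (s : seq R) (r : R) (j : nat).

(* 1-indexed; the value is 0 when [size s < j]. *)
Definition kth j s : R := nth 0 (sort <=%R s) j.-1.

Lemma nth_sorted_le j s r : sorted <=%R s -> (j < size s)%N ->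
  (nth 0 s j <= r) = (j < count (fun x => (x <= r)%R) s)%N.
Proof.
elim: s j => [|x s ih] [|j] //= ps.
  move=> _; case: (leP x r) => xr //=.
  rewrite (_ : count _ s = 0%N)//; apply/eqP; rewrite -leqn0 leqNgt -has_count.
  apply/hasPn => y ys; rewrite -ltNge (lt_le_trans xr)//.
  by have /allP := order_path_min le_trans ps; exact.
rewrite ltnS => js; have ss : sorted <=%R s by exact: path_sorted ps.
rewrite (ih j ss js); case: (leP x r) => xr; first by rewrite add1n.
have c0 : count (fun y => (y <= r)%R) s = 0%N.
  apply/eqP; rewrite -leqn0 leqNgt -has_count.
  apply/hasPn => y ys; rewrite -ltNge (lt_le_trans xr)//.
  by have /allP := order_path_min le_trans ps; exact.
by rewrite c0.
Qed.

(** Through this equivalence, order statistics are handled by counting points in balls. *)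
Lemma kth_le j s r : (0 < j <= size s)%N ->
  (kth j s <= r) = (j <= count (fun x => (x <= r)%R) s)%N.
Proof.
move=> /andP[j0 js]; rewrite /kth nth_sorted_le; last 2 first.
- exact: (sort_sorted (@le_total _ R)).
- by rewrite size_sort; case: (j) j0 js.
have /permP -> : perm_eq (sort <=%R s) s by rewrite perm_sort.
by rewrite prednK.
Qed.

Lemma kth_perm j s1 s2 : perm_eq s1 s2 -> kth j s1 = kth j s2.
Proof.
move=> h; rewrite /kth; congr nth; apply/perm_sortP => //.
- exact: le_total.
- exact: le_trans.
- exact: le_anti.
Qed.

Lemma kth_ge0 j s : all (fun x => 0 <= x) s -> 0 <= kth j s.
Proof.
move=> h; rewrite /kth; have [js|js] := ltnP j.-1 (size s); last by rewrite nth_default// size_sort.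
by apply: (allP h); rewrite -(mem_sort <=%R) mem_nth// size_sort.
Qed.

Lemma kth_leq j s1 s2 : (0 < j <= size s1)%N -> (size s1 <= size s2)%N ->
  (forall r, (count (fun x => (x <= r)%R) s1 <= count (fun x => (x <= r)%R) s2)%N) ->
  kth j s2 <= kth j s1.
Proof.
move=> js1 ss h; have /andP[j0 j1] := js1.
have js2 : (0 < j <= size s2)%N by rewrite j0 (leq_trans j1).
by rewrite (kth_le _ js2); apply: leq_trans (h _); rewrite -(kth_le _ js1).
Qed.

(** Truncation at [rho] only sees the counts at radii below [rho]; this is what makes the truncated
    summands local. *)
Lemma kth_min_eq j s1 s2 rho : (0 < j <= size s1)%N -> (0 < j <= size s2)%N ->
  (forall r, r < rho -> count (fun x => (x <= r)%R) s1 = count (fun x => (x <= r)%R) s2) ->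
  Num.min (kth j s1) rho = Num.min (kth j s2) rho.
Proof.
move=> j1 j2 h; have [k1|k1] := ltP (kth j s1) rho; have [k2|k2] := ltP (kth j s2) rho => //.
- apply/eqP; rewrite eq_le (kth_le _ j1) (h _ k2) -(kth_le _ j2) lexx /=.
  by rewrite (kth_le _ j2) -(h _ k1) -(kth_le _ j1).
- by move: k2; rewrite leNgt (le_lt_trans _ k1)// (kth_le _ j2) -(h _ k1) -(kth_le _ j1).
- by move: k1; rewrite leNgt (le_lt_trans _ k2)// (kth_le _ j1) (h _ k2) -(kth_le _ j2).
Qed.

End kth.

Section knn.
Context {R : realType} {d : nat}.
Notation T := 'rV[R]_d.
Implicit Types (z : seqspace T) (i l n m : nat).

Definition others i n := [seq l <- iota 0 n | l != i].

(** Indexed by positions in the sequence instead of elements of a finite set: measurability and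
    exchangeability become direct, and the value agrees with [nn_dist] when the points are
    distinct. *)
Definition knn j n z i : R := kth j [seq edist (z i) (z l) | l <- others i n].

Lemma size_others i n : (i < n)%N -> size (others i n) = n.-1.
Proof.
move=> iltn; rewrite size_filter.
have := count_predC (pred1 i) (iota 0 n).
by rewrite size_iota count_uniq_mem ?iota_uniq// mem_iota add0n iltn add1n => {2}<-.
Qed.

Lemma others_uniq i n : uniq (others i n).
Proof. by rewrite filter_uniq// iota_uniq. Qed.

Lemma mem_others i n l : (l \in others i n) = (l != i) && (l < n)%N.
Proof. by rewrite mem_filter mem_iota add0n leq0n. Qed.

Lemma knn_ge0 j n z i : 0 <= knn j n z i.
Proof. by apply: kth_ge0; apply/allP => _ /mapP[l _ ->]; exact: edist_ge0. Qed.

Lemma knn_le j n z i r : (0 < j < n)%N -> (i < n)%N ->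
  (knn j n z i <= r) = (j <= count (fun l => (edist (z i) (z l) <= r)%R) (others i n))%N.
Proof.
move=> /andP[j0 jn] iltn; rewrite /knn kth_le ?count_map// size_map size_others// j0.
by case: n jn {iltn}.
Qed.

Lemma nn_distE j n z i : (0 < j < n)%N -> (i < n)%N ->
  {in iota 0 n &, injective z} ->
  nn_dist j (z i) (sample_set z n) = knn j n z i.
Proof.
move=> /andP[j0 jn] iltn zI.
have cA : #|` sample_set z n| = n.
  rewrite -[RHS](size_iota 0) -(size_map z); apply: perm_size; apply: uniq_perm.
  - exact: fset_uniq.
  - by rewrite map_inj_in_uniq ?iota_uniq.
  - move=> y; apply/imfsetP/mapP => -[l hl ->]; exists l => //; exact: hl.
rewrite /nn_dist cA jn /knn; apply: (@kth_perm _ j).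
rewrite (map_comp (edist (z i)) z); apply: perm_map; apply: uniq_perm.
- exact: fset_uniq.
- rewrite map_inj_in_uniq ?others_uniq// => a b; rewrite !mem_others => /andP[_ an] /andP[_ bn].
  by apply: zI; rewrite mem_iota.
move=> y; apply/fsetD1P/mapP => [[yi /imfsetP[l /=]]|[l]].
  rewrite mem_iota => /andP[_ ln] yl; exists l => //; rewrite mem_others ln andbT.
  by apply/eqP => li; move: yi; rewrite yl li eqxx.
rewrite mem_others => /andP[li ln] ->; split.
  by apply: contra_neq li => /zI; apply; rewrite mem_iota.
by apply/imfsetP; exists l => //=; rewrite mem_iota.
Qed.

Lemma knn_monotone j n m z i : (0 < j < n)%N -> (i < n)%N -> (n <= m)%N ->
  knn j m z i <= knn j n z i.
Proof.
move=> /andP[j0 jn] iltn nm; have im : (i < m)%N by exact: leq_trans nm.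
apply: kth_leq; rewrite ?size_map ?size_others//.
- by rewrite j0; case: n jn {iltn nm}.
- by rewrite -!subn1 leq_sub2r.
move=> r; rewrite !count_map /others -(subnKC nm) iotaD filter_cat count_cat add0n.
exact: leq_addr.
Qed.

Lemma perm_swap_others n i : (0 < n)%N -> (i < n)%N ->
  perm_eq (map (swap 0 i) (others 0 n)) (others i n).
Proof.
move=> n0 iltn; apply: uniq_perm.
- by rewrite map_inj_uniq ?others_uniq//; exact: swap_inj.
- exact: others_uniq.
move=> l; rewrite mem_others; apply/mapP/andP => [[k]|[li ln]].
  by rewrite mem_others => /andP[k0 kn] ->; rewrite /swap; split; do !case: ifPn => //; lia.
exists (swap 0 i l).
  by rewrite mem_others /swap; do !case: ifPn => //; lia.
by rewrite /swap; do !case: ifPn => //; lia.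
Qed.

(** Exchangeability in deterministic form: after exchanging the points 0 and [i], the point 0 sees
    what the point [i] saw, so that laws need only be computed for the point 0. *)
Lemma knn_swap j n z i : (0 < n)%N -> (i < n)%N ->
  knn j n (reindex (swap 0 i) z) 0 = knn j n z i.
Proof.
move=> n0 iltn; apply: kth_perm; rewrite /reindex.
rewrite (map_comp (fun l => edist (z i) (z l)) (swap 0 i)); apply: perm_map.
exact: perm_swap_others.
Qed.

Lemma others0 n : others 0 n = map S (iota 0 n.-1).
Proof.
case: n => [|n] //=; rewrite /others /=.
have -> : iota 1 n = map S (iota 0 n) by rewrite -[1%N]addn0 iotaDl.
by apply/all_filterP/allP => _ /mapP[k _ ->].
Qed.

Definition near_count m (x : T) (r : R) (w : seqspace T) : nat :=
  count (fun l => (edist x (w l) <= r)%R) (iota 0 m).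

Lemma knn0_le j n z r : (0 < j < n)%N ->
  (knn j n z 0 <= r) = (j <= near_count n.-1 (z 0%N) r (shift z))%N.
Proof.
move=> jn; rewrite knn_le//; last by case/andP: jn => _ /(leq_ltn_trans _); apply.
by rewrite others0 count_map.
Qed.

End knn.

Lemma measurable_fun_sublevel {R : realType} d (T : measurableType d) (g : T -> R) :
  (forall r, measurable [set t | g t <= r]) -> measurable_fun setT g.
Proof.
move=> h; apply: (measurability _ (RGenOInfty.measurableE R)) => // _ [_ [r ->] <-].
rewrite setTI (_ : _ @^-1` _ = ~` [set t | g t <= r]); first exact: measurableC.
by apply/seteqP; split=> t /=; rewrite in_itv/= andbT ltNge => /negP.
Qed.

(** * Law and moments of the number of sample points in a ball *)

Section counts.
Context {R : realType} {d : nat}.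
Notation T := 'rV[R]_d.
Implicit Types (x : T) (r : R) (w z : seqspace T).

Lemma near_count_recl m x r w :
  near_count m.+1 x r w = ((edist x (w 0%N) <= r)%R + near_count m x r (shift w))%N.
Proof.
rewrite /near_count /= -[1%N]addn0 iotaDl count_map; congr addn.
Qed.

Lemma near_count_recr m x r w :
  near_count m.+1 x r w = (near_count m x r w + (edist x (w m) <= r)%R)%N.
Proof. by rewrite /near_count -addn1 iotaD count_cat /= addn0. Qed.

Lemma near_count_le m x r w : (near_count m x r w <= m)%N.
Proof. by rewrite /near_count (leq_trans (count_size _ _))// size_iota. Qed.

Lemma measurable_near_count m r (phi : nat -> R) :
  measurable_fun setT (fun p : T * seqspace T => phi (near_count m p.1 r p.2)).
Proof.
elim: m phi => [|m ih] phi; first by rewrite /near_count /=; exact: measurable_cst.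
rewrite [X in measurable_fun _ X](_ : _ = fun p : T * seqspace T =>
    if edist p.1 (p.2 m) <= r then phi (near_count m p.1 r p.2).+1
    else phi (near_count m p.1 r p.2)); last first.
  by apply/funext => p; rewrite near_count_recr; case: ifP; rewrite ?addn1 ?addn0.
apply: measurable_fun_ifT; last 2 first.
- exact: (ih (fun k => phi k.+1)).
- exact: ih.
apply: (@measurable_fun_bool _ _ _ _ true); rewrite setTI.
rewrite [X in measurable X](_ : _ = [set p : T * seqspace T | edist p.1 (p.2 m) <= r]).
  apply: measurable_le => //; apply: measurable_fun_edist => //.
  exact: (measurableT_comp (measurable_seq_coord m) measurable_snd).
by apply/seteqP; split=> p.
Qed.

Lemma bounded_near_count m x r (phi : nat -> R) :
  bounded_meas (fun w => phi (near_count m x r w)).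
Proof.
split; first exact: (measurableT_comp (measurable_near_count m r phi) (pair1_measurable x)).
exists (\sum_(k < m.+1) `|phi k|) => w.
have h : (near_count m x r w < m.+1)%N by rewrite ltnS near_count_le.
by rewrite (bigD1 (Ordinal h))//= lerDl sumr_ge0.
Qed.

Variables (F : probability T R) (mu : probability (seqspace T) R).
Hypothesis mu_iid : iid_law F mu.

Lemma Ex_head_tail (h : T -> R) (g : seqspace T -> R) : bounded_meas h -> bounded_meas g ->
  (forall x, 0 <= h x) -> (forall z, 0 <= g z) ->
  Ex mu (fun z => h (z 0%N) * g (shift z)) = Ex F h * Ex mu g.
Proof.
move=> bh bg h0 g0; pose k (p : T * seqspace T) := ((h p.1)%:E * (g p.2)%:E)%E.
have mk : measurable_fun setT k.
  apply: emeasurable_funM; apply/measurable_EFinP.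
    by case: bh => mh _; exact: (measurableT_comp mh measurable_fst).
  by case: bg => mg _; exact: (measurableT_comp mg measurable_snd).
have k0 p : (0 <= k p)%E by rewrite mule_ge0// lee_fin.
have := ge0_integral_head_tail mu_iid mk k0; rewrite /k /= => e.
apply: EFin_inj; rewrite EFinM EFin_Ex; last first.
  apply: bounded_measM.
    have [mh [M hM]] := bh; split; last by exists M.
    exact: (measurableT_comp mh (measurable_seq_coord 0)).
  exact: bounded_meas_reindex.
transitivity (\int[mu]_z ((h (z 0%N))%:E * (g (shift z))%:E))%E.
  by apply: eq_integral.
rewrite e; have [mh _] := bh; have [mg _] := bg.
transitivity (\int[F]_x ((Ex mu g)%:E * (h x)%:E))%E.
  apply: eq_integral => x _; rewrite ge0_integralZl ?lee_fin//; last 2 first.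
  - by apply/measurable_EFinP.
  - by move=> w _; rewrite lee_fin.
  by rewrite EFin_Ex// muleC.
rewrite ge0_integralZl ?lee_fin ?Ex_ge0//; last 2 first.
- by apply/measurable_EFinP.
- by move=> w _; rewrite lee_fin.
by rewrite -EFin_Ex// muleC.
Qed.

Lemma Ex_eball x r : Ex F (fun y => (edist x y <= r)%R%:R) = ball_prob F x r.
Proof.
rewrite /Ex /Rintegral /ball_prob; congr fine.
transitivity (F (eball x r `&` setT)); last by rewrite setIT.
rewrite -integral_indic//; last exact: measurable_eball.
by apply: eq_integral => y _; rewrite indicE; congr (nat_of_bool _)%:R%:E; apply/idP/idP; rewrite inE.
Qed.

Lemma bounded_eball x r : bounded_meas (fun y => (edist x y <= r)%R%:R : R).
Proof.
have -> : (fun y => (edist x y <= r)%R%:R : R) = \1_(eball x r).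
  by apply/funext => y; rewrite indicE; congr (nat_of_bool _)%:R; apply/idP/idP; rewrite inE.
split; first by apply: measurable_indic; exact: measurable_eball.
by exists 1 => y; rewrite indicE; case: (_ \in _); rewrite ?normr1 ?normr0.
Qed.

(** Conditioning on the first point reproduces the recursion that defines [binomial_lt]. Choosing an
    indicator, the identity or the square for [phi] yields the law and the first two moments. *)
Lemma Ex_near_countS m x r (phi : nat -> R) : (forall k, 0 <= phi k) ->
  Ex mu (fun w => phi (near_count m.+1 x r w)) =
  ball_prob F x r * Ex mu (fun w => phi (near_count m x r w).+1) +
  (1 - ball_prob F x r) * Ex mu (fun w => phi (near_count m x r w)).
Proof.
move=> phi0; pose h y : R := (edist x y <= r)%R%:R.
have bh : bounded_meas h by exact: bounded_eball.
have bh' : bounded_meas (fun y => 1 - h y).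
  by apply: bounded_measB => //; exact: bounded_meas_cst.
have h01 y : 0 <= h y <= 1 by rewrite /h; case: (edist x y <= r); rewrite ?lexx ?ler01.
rewrite -Ex_eball -/h -[X in _ + X * _](_ : Ex F (fun y => 1 - h y) = _); last first.
  by rewrite ExB ?(Ex_cst F)//; exact: bounded_meas_cst.
have b1 := bounded_near_count m x r (fun k => phi k.+1).
have b0 := bounded_near_count m x r phi.
have h0 y : 0 <= h y by case/andP: (h01 y).
have h1 y : 0 <= 1 - h y by case/andP: (h01 y); rewrite subr_ge0.
rewrite -Ex_head_tail// -Ex_head_tail//.
have bhd g : bounded_meas g -> bounded_meas (fun z : seqspace T => g (z 0%N) : R).
  move=> [mg [M gM]]; split; last by exists M.
  exact: (measurableT_comp mg (measurable_seq_coord 0)).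
rewrite -ExD; last 2 first.
- by apply: bounded_measM; [exact: bhd|exact: (bounded_meas_reindex S b1)].
- by apply: bounded_measM; [exact: (bhd (fun y => 1 - h y))|exact: (bounded_meas_reindex S b0)].
congr Ex; apply/funext => w; rewrite near_count_recl /h.
by case: (_ <= _); rewrite ?add1n ?add0n ?mul1r ?mul0r ?subrr ?subr0 ?mul1r ?mul0r ?addr0 ?add0r.
Qed.

Lemma near_count_binomial m j x r :
  Ex mu (fun w => (near_count m x r w < j)%:R) = binomial_lt m j (ball_prob F x r).
Proof.
elim: m j => [|m ih] j.
  by rewrite (_ : (fun=> _) = cst (0 < j)%:R)// (Ex_cst mu); case: j.
rewrite (@Ex_near_countS m x r (fun k => (k < j)%:R))//.
case: j => [|j]; last by rewrite /= -!ih.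
by rewrite (_ : (fun=> _) = cst 0)// (Ex_cst mu) !mulr0 addr0.
Qed.

Lemma Ex_near_count m x r : Ex mu (fun w => (near_count m x r w)%:R) = m%:R * ball_prob F x r.
Proof.
elim: m => [|m ih]; first by rewrite mul0r (_ : (fun=> _) = cst 0)// (Ex_cst mu).
rewrite (@Ex_near_countS m x r (fun k => k%:R))// ih.
rewrite (_ : (fun w => _.+1%:R) = (fun w => (near_count m x r w)%:R + 1)); last first.
  by apply/funext => w; rewrite -natr1.
rewrite ExD; [|exact: (bounded_near_count m x r (fun k => k%:R))|exact: bounded_meas_cst].
by rewrite ih (Ex_cst mu) -natr1; ring.
Qed.

(** The binomial second moment is m p (1 - p) + (m p)^2; the weaker bound without the factor 1 - p
    is carried directly through the induction. *)
Lemma Ex_near_count_sqr m x r : Ex mu (fun w => (near_count m x r w)%:R ^+ 2) <=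
  m%:R * ball_prob F x r + (m%:R * ball_prob F x r) ^+ 2.
Proof.
set p := ball_prob F x r; have /andP[p0 p1] : 0 <= p <= 1 by exact: ball_prob_01.
elim: m => [|m ih].
  have -> : (fun w => (near_count 0 x r w)%:R ^+ 2) = (fun=> 0 : R).
    by apply/funext => w; rewrite /near_count expr0n.
  by rewrite (Ex_cst mu) mul0r add0r expr0n.
have b1 := bounded_near_count m x r (fun k => k%:R).
have b2 : bounded_meas (fun w => (near_count m x r w)%:R ^+ 2 : R) by exact: bounded_measX.
rewrite (@Ex_near_countS m x r (fun k => k%:R ^+ 2))//.
rewrite (_ : (fun w => _.+1%:R ^+ 2) =
    (fun w => (near_count m x r w)%:R ^+ 2 + (2 * (near_count m x r w)%:R + 1))); last first.
  by apply/funext => w; rewrite -natr1; ring.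
rewrite ExD//; last by apply: bounded_measD; [exact: bounded_measZ|exact: bounded_meas_cst].
rewrite ExD//; [|exact: bounded_measZ|exact: bounded_meas_cst].
rewrite ExZ// (Ex_cst mu) Ex_near_count -/p -natr1.
have m0 : 0 <= m%:R :> R by [].
have := sqr_ge0 p; nra.
Qed.

Lemma ge0_Ex_head_tail (g : T * seqspace T -> R) : measurable_fun setT g ->
  (exists M, forall p, `|g p| <= M) -> (forall p, 0 <= g p) ->
  Ex mu (fun z => g (z 0%N, shift z)) = Ex F (fun x => Ex mu (fun w => g (x, w))).
Proof.
move=> mg [M gM] g0; have := ge0_integral_head_tail mu_iid (h := EFin \o g).
rewrite /Ex /Rintegral => -> //; last by apply/measurable_EFinP.
congr fine; apply: eq_integral => x _; rewrite fineK//; apply: integrable_fin_num => //.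
apply: bounded_meas_integrable; split; last by exists M.
exact: (measurableT_comp mg (pair1_measurable x)).
Qed.

(** The distance exceeds [r] when fewer than [j] of the [n.-1] other points fall in the ball; given
    the point 0, their number is binomial. *)
Lemma knn0_tail j n r : (0 < j < n)%N ->
  Ex mu (fun z => (r < knn j n z 0)%R%:R) = Ex F (fun x => binomial_lt n.-1 j (ball_prob F x r)).
Proof.
move=> jn.
pose g (p : T * seqspace T) : R := (near_count n.-1 p.1 r p.2 < j)%:R.
transitivity (Ex mu (fun z => g (z 0%N, shift z))).
  by congr Ex; apply/funext => z; rewrite /g /= ltNge knn0_le// ltnNge.
rewrite ge0_Ex_head_tail.
- by congr Ex; apply/funext => x; rewrite -near_count_binomial.
- exact: (measurable_near_count n.-1 r (fun k => (k < j)%:R)).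
- by exists 1 => p; rewrite /g; case: (_ < _)%N; rewrite ?normr1 ?normr0.
- by move=> p; exact: ler0n.
Qed.

Lemma Ex_near0_sqr m r p : 0 <= p -> (forall x, ball_prob F x r <= p) ->
  Ex mu (fun z => (near_count m (z 0%N) r (shift z))%:R ^+ 2) <= m%:R * p + (m%:R * p) ^+ 2.
Proof.
move=> p0 hp.
pose g (q : T * seqspace T) : R := (near_count m q.1 r q.2)%:R ^+ 2.
rewrite [leLHS](_ : _ = Ex mu (fun z => g (z 0%N, shift z)))// ge0_Ex_head_tail; last 3 first.
- exact: (measurable_near_count m r (fun k => k%:R ^+ 2)).
- exists (m%:R ^+ 2) => q; rewrite ger0_norm ?sqr_ge0//.
  by rewrite lerXn2r ?nnegrE// ler_nat near_count_le.
- by move=> q; exact: sqr_ge0.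
rewrite -[leRHS](Ex_cst F); apply: le_Ex.
- apply: bounded_Ex_section.
  + exact: (measurable_near_count m r (fun k => k%:R ^+ 2)).
  + exists (m%:R ^+ 2) => q; rewrite ger0_norm ?sqr_ge0//.
    by rewrite lerXn2r ?nnegrE// ler_nat near_count_le.
  + by move=> q; exact: sqr_ge0.
- exact: bounded_meas_cst.
move=> x; apply: (le_trans (Ex_near_count_sqr m x r)).
have h : m%:R * ball_prob F x r <= m%:R * p by rewrite ler_wpM2l.
have /andP[b0 _] := ball_prob_01 F x r.
by rewrite lerD// lerXn2r ?nnegrE ?mulr_ge0.
Qed.

Lemma measurable_knn0 j n : (0 < j < n)%N -> measurable_fun setT (fun z : seqspace T => knn j n z 0).
Proof.
move=> jn; apply: measurable_fun_sublevel => r.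
pose g (p : T * seqspace T) : R := (j <= near_count n.-1 p.1 r p.2)%:R.
have mg : measurable_fun setT g.
  exact: (measurable_near_count n.-1 r (fun k => (j <= k)%:R)).
have mgz : measurable_fun setT (fun z => g (z 0%N, shift z)).
  exact: (measurableT_comp mg (@measurable_head_tail _ T)).
rewrite [X in measurable X](_ : _ = [set z | 1 <= g (z 0%N, shift z)]).
  exact: measurable_le.
by apply/seteqP; split=> z /=; rewrite knn0_le// /g; case: (_ <= _)%N; rewrite ?ler10.
Qed.

Lemma measurable_knn j n i : (0 < j < n)%N -> (i < n)%N ->
  measurable_fun setT (fun z : seqspace T => knn j n z i).
Proof.
move=> jn iltn; have n0 : (0 < n)%N by exact: leq_ltn_trans iltn.
rewrite [X in measurable_fun _ X](_ : _ = (fun z => knn j n (reindex (swap 0 i) z) 0)).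
  exact: (measurableT_comp (measurable_knn0 jn) (@measurable_reindex _ T _)).
by apply/funext => z; rewrite knn_swap.
Qed.

End counts.

(** * Truncated distances: mean *)

Lemma leq_double_pred n : (1 < n)%N -> (n <= 2 * n.-1)%N.
Proof. lia. Qed.

Section truncated.
Context {R : realType} {d : nat}.
Notation T := 'rV[R]_d.
Notation lam := (@lebesgue_rV R d).
Notation radius := (@knn_radius R d).
Variables (j : nat) (alpha : R).

(* The exponent makes [level n ^ (alpha + d)] equal to [n ^ (1/8)]. *)
Definition level n : R := n%:R `^ (8 * (alpha + d%:R))^-1.

Definition trunc_knn n (z : seqspace T) i : R :=
  Num.min (n%:R `^ d%:R^-1 * knn j n z i) (level n) `^ alpha.

Definition trunc_mean n (z : seqspace T) : R := n%:R^-1 * \sum_(i < n) trunc_knn n z i.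

Hypotheses (d0 : (0 < d)%N) (j0 : (0 < j)%N) (alpha0 : 0 < alpha).

Lemma level_ge0 n : 0 <= level n.
Proof. exact: powR_ge0. Qed.

Lemma trunc_knn_ge0 n z i : 0 <= trunc_knn n z i.
Proof. exact: powR_ge0. Qed.

Lemma trunc_min_ge0 n (z : seqspace T) i : 0 <= Num.min (n%:R `^ d%:R^-1 * knn j n z i) (level n).
Proof. by rewrite le_min level_ge0 mulr_ge0 ?powR_ge0 ?knn_ge0. Qed.

Lemma trunc_knn_le n z i : trunc_knn n z i <= level n `^ alpha.
Proof. by rewrite ge0_ler_powR ?nnegrE ?level_ge0 ?trunc_min_ge0 ?(ltW alpha0)// ge_min lexx orbT. Qed.

Lemma bounded_trunc_knn n i : (j < n)%N -> (i < n)%N -> bounded_meas (fun z => trunc_knn n z i).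
Proof.
move=> jn iltn; split.
  apply: (measurableT_comp (measurable_powR alpha)).
  apply: measurable_minr; last exact: measurable_cst.
  by apply: measurable_funM => //; apply: measurable_knn => //; rewrite j0.
exists (level n `^ alpha) => z; rewrite ger0_norm ?trunc_knn_ge0//; exact: trunc_knn_le.
Qed.

Lemma powR_lt_iff (y x s : R) : 0 <= y -> 0 <= x -> 0 < s -> (y < x `^ s) = (y `^ s^-1 < x).
Proof.
move=> y0 x0 s0; have si0 : 0 < s^-1 by rewrite invr_gt0.
have := powR_le_iff ltr01 si0 x0 y0.
by rewrite invrK mul1r divr1 => h; rewrite ltNge h -ltNge.
Qed.

Lemma knn_radius_powR y n : 0 <= y -> (0 < n)%N ->
  n%:R `^ d%:R^-1 * radius (y `^ (alpha / d%:R)^-1) n = y `^ alpha^-1.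
Proof.
move=> y0 n0; rewrite /knn_radius powRM ?powR_ge0 ?invr_ge0// -powRrM.
have dn0 : d%:R != 0 :> R by rewrite pnatr_eq0 -lt0n.
rewrite (_ : (alpha / d%:R)^-1 / d%:R = alpha^-1); last first.
  by rewrite invf_div mulrC mulrA mulVf// mul1r.
rewrite mulrCA -powRM ?invr_ge0// divff ?powR1 ?mulr1//.
by rewrite pnatr_eq0 -lt0n.
Qed.

(** Exceeding [y] means that the distance exceeds the radius with parameter u = y^(d/alpha), as long
    as [y] is below the power [alpha] of the level; beyond it the tail is cut off. *)
Lemma trunc_knn_gt n z i y : 0 <= y -> (0 < n)%N ->
  (y < trunc_knn n z i) = (y `^ alpha^-1 < level n) && (radius (y `^ (alpha / d%:R)^-1) n < knn j n z i).
Proof.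
move=> y0 n0; rewrite powR_lt_iff ?trunc_min_ge0// lt_min andbC; congr (_ && _).
by rewrite -(knn_radius_powR y0 n0) ltr_pM2l// powR_gt0// ltr0n.
Qed.

Variables (F : probability T R) (mu : probability (seqspace T) R) (f : T -> R) (b M c D : R).
Hypotheses (mu_iid : iid_law F mu)
  (FE : forall A, measurable A -> F A = (\int[lam]_(x in A) (f x)%:E)%E)
  (mf : measurable_fun setT f) (f0 : forall x, 0 <= f x) (fb : forall x, f x <= b)
  (M0 : 0 < M) (fM : forall x, 0 < f x -> box d M x) (c0 : 0 < c) (D0 : 0 < D)
  (fD : forall x y, supp f x -> supp f y -> edist x y <= D)
  (fc : forall x r, supp f x -> 0 <= r -> r <= D -> c * r ^+ d <= ball_prob F x r).

Lemma ball_prob_diam x r : supp f x -> D <= r -> ball_prob F x r = 1.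
Proof.
move=> fx Dr; apply/EFin_inj; rewrite ball_probE; apply/eqP; rewrite eq_le.
rewrite probability_le1/=; last exact: measurable_eball.
rewrite -(density_supp FE mf f0) le_measure ?inE//; [exact: measurable_supp|exact: measurable_eball|].
by move=> y fy; exact: le_trans (fD fx fy) Dr.
Qed.

(** For [r <= D] the ball has probability at least [c * r ^+ d]. For larger [r] it contains the
    support, hence all the other points, and the tail vanishes. The denominator 4 collects a factor
    2 from the binomial tail bound and another from [n <= 2 * n.-1]. *)
Lemma knn0_tail_exp n r : (j < n)%N -> 0 <= r ->
  Ex mu (fun z : seqspace T => (r < knn j n z 0)%R%:R) <= 2 ^+ j * expR (- (c / 4 * (n%:R * r ^+ d))).
Proof.
move=> jn r0; rewrite (knn0_tail mu_iid) ?j0// -[leRHS](Ex_cst F).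
apply: (le_Ex_on (measurable_supp mf) (density_supp FE mf f0)).
- exact: bounded_binomial_ball.
- exact: bounded_meas_cst.
move=> x fx; have [rD|/ltW Dr] := leP r D; last first.
  rewrite ball_prob_diam// binomial_lt_p1; first by rewrite mulr_ge0 ?exprn_ge0 ?expR_ge0.
  by rewrite -ltnS prednK// (leq_ltn_trans _ jn).
apply: (le_trans (binomial_lt_expR n.-1 j (ball_prob_01 F x r))).
rewrite ler_wpM2l ?exprn_ge0// ler_expR lerN2.
have h := fc fx r0 rD; set p := ball_prob F x r in h *.
have q0 : 0 <= c * r ^+ d by rewrite mulr_ge0 ?exprn_ge0// ltW.
have hn : n%:R <= 2 * n.-1%:R :> R.
  by rewrite -natrM ler_nat leq_double_pred// (leq_ltn_trans j0).
have : n%:R * (c * r ^+ d) <= 2 * n.-1%:R * p by apply: ler_pM.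
have -> : c / 4 * (n%:R * r ^+ d) = n%:R * (c * r ^+ d) / 4 by ring.
rewrite ler_pdivrMr// => H; apply: (le_trans H); rewrite le_eqVlt; apply/orP; left; apply/eqP.
by field.
Qed.

Let a := alpha / d%:R.
Let a0 : 0 < a. Proof. by rewrite divr_gt0// ltr0n. Qed.

Definition knn_limit_tail y := Ex F (fun x => poisson_lt j (ball_vol d * y `^ a^-1 * f x)).

Lemma level_gt y n : 0 <= y -> y `^ (8 * (alpha + d%:R)) < n%:R -> y < level n.
Proof.
move=> y0 h; rewrite /level powR_lt_iff// ?invrK// invr_gt0 mulr_gt0// addr_gt0// ltr0n//.
Qed.

(** For fixed [y] the level eventually exceeds y^(1/alpha), so the truncation does not affect the
    limit. The index [(N + j).+1] guarantees at least [j] other points. *)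
Lemma trunc_tail_cvg y : 0 < y ->
  Ex mu (fun z => (y < trunc_knn (N + j).+1 z 0)%R%:R) @[N --> \oo] --> knn_limit_tail y.
Proof.
move=> y0; have u0 : 0 < y `^ a^-1 by rewrite powR_gt0.
have := tail_cvg d0 FE mf f0 fb M0 fM u0 (j := j).
rewrite -(@cvg_shiftn j) => h; apply: cvg_trans h; apply: near_eq_cvg.
near=> N.
transitivity (Ex mu (fun z : seqspace T => (radius (y `^ a^-1) (N + j).+1 < knn j (N + j).+1 z 0)%R%:R)).
  by rewrite (knn0_tail mu_iid)// j0 ltnS leq_addl.
congr Ex; apply/funext => z; rewrite trunc_knn_gt ?(ltW y0)//.
rewrite level_gt ?powR_ge0//.
apply: (@lt_le_trans _ _ ((y `^ alpha^-1) `^ (8 * (alpha + d%:R)) + 1)); first by rewrite ltrDl.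
apply: (@le_trans _ _ N.+1%:R); last by rewrite ler_nat ltnS leq_addr.
by near: N; exact: near_natS.
Unshelve. all: end_near. Qed.

(** The exponential bound is written as [poisson_lt 1], so that the integrability of the dominating
    function is an instance of the integral computed for the limit. *)
Lemma trunc_tail_dom n y : (j < n)%N -> 0 < y ->
  Ex mu (fun z => (y < trunc_knn n z 0)%R%:R) <= 2 ^+ j * poisson_lt 1 (c / 4 * y `^ a^-1).
Proof.
move=> jn y0; have n0 : (0 < n)%N by exact: leq_ltn_trans jn.
apply: (@le_trans _ _ (Ex mu (fun z : seqspace T => (radius (y `^ a^-1) n < knn j n z 0)%R%:R))).
  apply: le_Ex.
  - by apply: bounded_gt_indic; case: (bounded_trunc_knn jn n0).
  - by apply: bounded_gt_indic; apply: measurable_knn0; rewrite j0.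
  by move=> z; rewrite trunc_knn_gt ?(ltW y0)//; case: (_ < level n); case: (_ < knn _ _ _ _).
apply: (le_trans (knn0_tail_exp jn (knn_radius_ge0 _ _))).
rewrite knn_radiusX ?powR_ge0// ler_wpM2l ?exprn_ge0//.
rewrite [n%:R * _]mulrC divfK ?pnatr_eq0 -?lt0n//.
by rewrite /poisson_lt big_ord_recl big_ord0 addr0 /poisson_weight expr0 fact0 divr1 mulr1.
Qed.

Lemma integrable_poisson_tail : (@lebesgue_measure R).-integrable `]0%R, +oo[
  (fun y => (2 ^+ j * poisson_lt 1 (c / 4 * y `^ a^-1))%:E).
Proof.
have c40 : 0 < c / 4 by rewrite divr_gt0.
have mp : measurable_fun setT (fun y : R => poisson_lt 1 (c / 4 * y `^ a^-1)).
  apply: (measurableT_comp (measurable_poisson_lt 1)); apply: measurable_funM => //.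
have p0 y : 0 <= poisson_lt 1 (c / 4 * y `^ a^-1).
  by apply: poisson_lt_ge0; rewrite mulr_ge0 ?powR_ge0 ?(ltW c40).
under [X in _.-integrable _ X]eq_fun do rewrite EFinM.
apply: integrableZl => //; apply/integrableP; split.
  by apply: measurable_funTS; apply/measurable_EFinP.
rewrite integral_itv_obnd_cbnd; last by apply: measurable_funTS; apply: measurableT_comp => //; apply/measurable_EFinP.
under eq_integral do rewrite gee0_abs ?lee_fin//.
by rewrite integral_poisson_powR// ltry.
Qed.

Lemma measurable_knn_limit_tail : measurable_fun setT knn_limit_tail.
Proof.
pose g (p : R * T) := poisson_lt j (ball_vol d * p.1 `^ a^-1 * f p.2).
have g0 (p : R * T) : 0 <= ball_vol d * p.1 `^ a^-1 * f p.2.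
  by rewrite !mulr_ge0 ?powR_ge0 ?ball_vol_ge0.
apply: (@bounded_Ex_section _ _ _ F _ _ g _ _ _).1.
- apply: (measurableT_comp (measurable_poisson_lt j)); apply: measurable_funM.
    apply: measurable_funM => //; apply: (measurableT_comp (measurable_powR _)) => //.
  exact: (measurableT_comp mf measurable_snd).
- by exists 1 => p; rewrite ger0_norm ?poisson_lt_ge0 ?poisson_lt_le1.
- by move=> p; exact: poisson_lt_ge0.
Qed.

(** Dominated convergence for the tails in the layer cake formula. The integrability of the limit
    tail is kept, as it identifies the extended-real integral with its [fine] value. *)
Lemma trunc_Ex_cvg :
  (@lebesgue_measure R).-integrable `]0%R, +oo[ (EFin \o knn_limit_tail) /\
  Ex mu (fun z => trunc_knn n z 0) @[n --> \oo] -->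
    fine (\int[lebesgue_measure]_(y in `]0%R, +oo[) (knn_limit_tail y)%:E)%E.
Proof.
have jN N : (j < (N + j).+1)%N by rewrite ltnS leq_addl.
pose h N y := (Ex mu (fun z => (y < trunc_knn (N + j).+1 z 0)%R%:R))%:E.
have bt N : bounded_meas (fun z => trunc_knn (N + j).+1 z 0) by apply: bounded_trunc_knn.
have mh N : measurable_fun (`]0%R, +oo[%classic : set R) (h N).
  apply: measurable_funTS; apply/measurable_EFinP; apply: measurable_Ex_tail; exact: (proj1 (bt N)).
have mq : measurable_fun (`]0%R, +oo[%classic : set R) (EFin \o knn_limit_tail).
  by apply: measurable_funTS; apply/measurable_EFinP; exact: measurable_knn_limit_tail.
have hq : {ae (@lebesgue_measure R), forall y, (`]0%R, +oo[%classic : set R) y ->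
    h ^~ y @ \oo --> (EFin \o knn_limit_tail) y}.
  apply: aeW => y; rewrite /= in_itv/= andbT => y0.
  apply: cvg_EFin; first by apply: nearW => N.
  exact: trunc_tail_cvg.
have hdom : {ae (@lebesgue_measure R), forall y N, (`]0%R, +oo[%classic : set R) y ->
    (`|h N y| <= (2 ^+ j * poisson_lt 1 (c / 4 * y `^ a^-1))%:E)%E}.
  apply: aeW => y N; rewrite /= in_itv/= andbT => y0.
  by rewrite lee_fin ger0_norm ?Ex_ge0//; exact: trunc_tail_dom.
have [iq _ lim] := @dominated_convergence _ (measurableTypeR R) R (@lebesgue_measure R) _
  (measurable_itv _) h (EFin \o knn_limit_tail) _ mh mq hq integrable_poisson_tail hdom.
split => //; rewrite -(@cvg_shiftn j.+1).
have : (\int[lebesgue_measure]_(y in `]0%R, +oo[) (h N y))%E @[N --> \oo] -->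
   (fine (\int[lebesgue_measure]_(y in `]0%R, +oo[) (knn_limit_tail y)%:E))%:E%E.
  by rewrite fineK//; exact: integrable_fin_num.
move/fine_cvg; apply: cvg_trans; apply: near_eq_cvg; apply: nearW => N /=.
rewrite addnS; exact: (esym (congr1 fine (Ex_tail mu (bt N) (fun z => trunc_knn_ge0 _ z 0)))).
Qed.

(** For fixed [x] the integral over [y] is the Gamma computation with c = [ball_vol d * f x], which
    is positive only on the support; hence the restriction to [S]. It leaves f^(-a), and integrating
    against [F], whose density is [f], turns this into f^(1 - a). *)
Lemma knn_limit_tail_integral :
  (\int[lebesgue_measure]_(y in `]0%R, +oo[) (knn_limit_tail y)%:E =
   (ball_vol d `^ (- a) * (Gamma (j%:R + a) / Gamma j%:R))%:E * I_rho (1 - a) f)%E.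
Proof.
have v0 := @ball_vol_gt0 R d.
pose C : R := Gamma (j%:R + a) / Gamma j%:R.
pose S : set T := supp f.
have mS : measurable S := measurable_supp mf.
have FS : F S = 1%E := density_supp FE mf f0.
pose p y x : R := poisson_lt j (ball_vol d * y `^ a^-1 * f x).
have p0 y x : 0 <= p y x by apply: poisson_lt_ge0; rewrite !mulr_ge0 ?powR_ge0 ?ball_vol_ge0.
pose k (q : T * R) : R := \1_S q.1 * (\1_`[0, +oo[ q.2 * p q.2 q.1).
have mk : measurable_fun setT k.
  apply: measurable_funM; first exact: (measurableT_comp (measurable_indic mS) measurable_fst).
  apply: measurable_funM.
    exact: (measurableT_comp (measurable_indic (measurable_itv `[0, +oo[)) measurable_snd).
  apply: (measurableT_comp (measurable_poisson_lt j)); apply: measurable_funM.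
    apply: measurable_funM => //; apply: (measurableT_comp (measurable_powR _)) => //.
  exact: (measurableT_comp mf measurable_fst).
have k0 q : 0 <= k q by rewrite !mulr_ge0.
transitivity (\int[lebesgue_measure]_y \int[F]_x (k (x, y))%:E)%E.
  rewrite integral_itv_obnd_cbnd; last first.
    by apply: measurable_funTS; apply/measurable_EFinP; exact: measurable_knn_limit_tail.
  rewrite integral_mkcond; apply: eq_integral => y _; rewrite patchE.
  have bp : bounded_meas (p y).
    by apply: bounded_poisson => //; rewrite mulr_ge0 ?powR_ge0 ?ball_vol_ge0.
  have bS : bounded_meas (\1_S : T -> R) := bounded_meas_indic mS.
  case: ifPn => hy.
    rewrite -[knn_limit_tail y]/(Ex F (p y)) (@eq_Ex_on _ _ _ F S (p y) (fun x => \1_S x * p y x))//.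
    - rewrite EFin_Ex; last exact: bounded_measM.
      by apply: eq_integral => x _; rewrite /k /= [\1_`[0, +oo[ y]indicE hy mul1r.
    - exact: bounded_measM.
    - by move=> x Sx; rewrite indicE mem_set// mul1r.
  transitivity (0 : \bar R)%E; first by [].
  by rewrite integral0_eq// => x _; rewrite /k /= [\1_`[0, +oo[ y]indicE (negbTE hy) mul0r mulr0.
have mkE : measurable_fun setT (EFin \o k) by apply/measurable_EFinP.
transitivity (\int[F]_x \int[lebesgue_measure]_y (k (x, y))%:E)%E.
  apply/esym; apply: (fubini_tonelli (m1 := F) (m2 := lebesgue_measure) _ mkE).
  by move=> q; rewrite lee_fin.
pose h x : R := \1_S x * ((ball_vol d * f x) `^ (- a) * C).
have mh : measurable_fun setT h.
  apply: measurable_funM; first exact: measurable_indic.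
  apply: measurable_funM => //; apply: (measurableT_comp (measurable_powR _)) => //.
  exact: measurable_funM.
have hk x : (\int[lebesgue_measure]_y (k (x, y))%:E = (h x)%:E)%E.
  have [Sx|nSx] := pselect (S x); last first.
    rewrite /h indicE memNset// mul0r integral0_eq// => y _.
    by rewrite /k /= indicE memNset// mul0r.
  rewrite /h indicE mem_set// mul1r.
  have vf0 : 0 < ball_vol d * f x by rewrite mulr_gt0.
  have j1 : j = j.-1.+1 by rewrite prednK.
  rewrite /C j1 -integral_poisson_powR// [RHS]integral_mkcond; apply: eq_integral => y _.
  rewrite patchE /k /= [\1_S x]indicE mem_set// mul1r indicE; case: ifPn => _; last by rewrite mul0r.
  by rewrite mul1r /p -j1 mulrAC.
have h0 x : 0 <= h x.
  by rewrite -lee_fin -hk; apply: integral_ge0 => y _; rewrite lee_fin.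
under eq_integral do rewrite hk.
rewrite (ge0_integral_density FE mf f0 mh h0) /I_rho.
have C0 : 0 <= C.
  rewrite divr_ge0//; apply: Rintegral_ge0 => t _; by rewrite mulr_ge0 ?powR_ge0 ?expR_ge0.
have vC0 : 0 <= ball_vol d `^ (- a) * C by rewrite mulr_ge0 ?powR_ge0.
rewrite -ge0_integralZl//; last 2 first.
- apply: measurable_funTS; apply/measurable_EFinP.
  exact: (measurableT_comp (measurable_powR _)).
- by move=> y _; rewrite lee_fin powR_ge0.
rewrite [RHS]integral_mkcond; apply: eq_integral => x _; rewrite patchE /h indicE.
case: ifPn => [/set_mem Sx|_]; last by rewrite !mul0r.
rewrite -EFinM mul1r powRM ?(ltW v0)//.
rewrite powRD ?powRr1//; last by rewrite (gt_eqF Sx) implybT.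
by rewrite -/C; congr EFin; ring.
Qed.

End truncated.

(** * Truncated distances: variance *)

Section neighbor_count.
Context {R : realType} {d : nat}.
Notation T := 'rV[R]_d.

Definition nbrs n (r : R) (z : seqspace T) i : nat :=
  count (fun l => (edist (z i) (z l) <= r)%R) (others i n).

Lemma nbrs_swap n r z i : (0 < n)%N -> (i < n)%N ->
  nbrs n r (reindex (swap 0 i) z) 0 = nbrs n r z i.
Proof.
move=> n0 iltn; rewrite /nbrs -(permP (perm_swap_others n0 iltn)) count_map.
by apply: eq_count => l.
Qed.

Lemma nbrs0 n r z : nbrs n r z 0 = near_count n.-1 (z 0%N) r (shift z).
Proof. by rewrite /nbrs others0 count_map. Qed.

Lemma nbrsE n r z i : ((nbrs n r z i)%:R : R) =
  \sum_(l < n) ((l != i :> nat) && (edist (z i) (z l) <= r)%R)%:R.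
Proof.
rewrite /nbrs count_filter -sum1_count natr_sum -(big_mkord xpredT (fun l => ((l != i) && (edist (z i) (z l) <= r)%R)%:R)).
rewrite /index_iota subn0 big_mkcond/=; apply: eq_bigr => l _.
by rewrite andbC; case: ifP.
Qed.

Lemma measurable_nbrs0 n r : measurable_fun setT (fun z : seqspace T => (nbrs n r z 0)%:R : R).
Proof.
rewrite [X in measurable_fun _ X](_ : _ =
  (fun z => (near_count n.-1 (head_tail z).1 r (head_tail z).2)%:R)); last first.
  by apply/funext => z; rewrite nbrs0.
exact: (measurableT_comp (measurable_near_count n.-1 r (fun k => k%:R)) (@measurable_head_tail _ T)).
Qed.

Lemma bounded_nbrs n r i : (0 < n)%N -> (i < n)%N ->
  bounded_meas (fun z : seqspace T => (nbrs n r z i)%:R : R).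
Proof.
move=> n0 iltn; rewrite (_ : (fun z => _) = (fun z => (nbrs n r (reindex (swap 0 i) z) 0)%:R)).
  apply: (bounded_meas_reindex (swap 0 i) (g := fun z => (nbrs n r z 0)%:R)).
  split; first exact: measurable_nbrs0.
  by exists n%:R => z; rewrite ger0_norm// ler_nat /nbrs (leq_trans (count_size _ _))// size_others// leq_pred.
by apply/funext => z; rewrite nbrs_swap.
Qed.

End neighbor_count.

Section variance.
Context {R : realType} {d : nat}.
Notation T := 'rV[R]_d.
Notation lam := (@lebesgue_rV R d).
Variables (j : nat) (alpha : R).
Hypotheses (d0 : (0 < d)%N) (j0 : (0 < j)%N) (alpha0 : 0 < alpha).
Notation level := (@level R d alpha).
Notation trunc_knn := (@trunc_knn R d j alpha).
Notation trunc_mean := (@trunc_mean R d j alpha).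

Definition trunc_radius n : R := level n / n%:R `^ d%:R^-1.

(** If both the old and the new position of the point [i] are farther than the truncation radius
    from the point [l], the counts around [l] agree at every smaller radius. *)
Lemma trunc_knn_local n (z z' : seqspace T) i l : (j < n)%N -> (i < n)%N -> (l < n)%N -> l != i ->
  (forall k, (k < n)%N -> k != i -> z' k = z k) ->
  trunc_radius n < edist (z i) (z l) -> trunc_radius n < edist (z' i) (z l) ->
  trunc_knn n z l = trunc_knn n z' l.
Proof.
move=> jn iltn ln li zz' h1 h2; congr (_ `^ alpha).
have n0 : (0 < n)%N by exact: leq_ltn_trans jn.
have nd0 : 0 < n%:R `^ d%:R^-1 :> R by rewrite powR_gt0// ltr0n.
have -> : level n = n%:R `^ d%:R^-1 * trunc_radius n by rewrite mulrC divfK// gt_eqF.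
rewrite -!minr_pMr ?(ltW nd0)//; congr (_ * _).
have sz (y : seqspace T) : (0 < j <= size [seq edist (y l) (y k) | k <- others l n])%N.
  by rewrite size_map size_others// j0/=; lia.
apply: kth_min_eq => // r rr; rewrite !count_map; apply: eq_in_count => k.
rewrite mem_others => /andP[kl kn] /=; rewrite (zz' l)//.
have [->|ki] := eqVneq k i; last by rewrite zz'.
by rewrite ![edist (z l) _]edistC !leNgt !(lt_trans rr).
Qed.

(* Moving the point [i] only affects the summands of the points within
   [trunc_radius n] of its old or new position. *)
Lemma trunc_mean_diff n (z z' : seqspace T) i : (j < n)%N -> (i < n)%N ->
  z' = reindex (swap i (n + i)) z ->
  `|trunc_mean n z - trunc_mean n z'| <=
  n%:R^-1 * (level n `^ alpha * (1 + (nbrs n (trunc_radius n) z i)%:R + (nbrs n (trunc_radius n) z' i)%:R)).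
Proof.
move=> jn iltn z'E; rewrite /trunc_mean -mulrBr normrM ger0_norm ?invr_ge0// ler_wpM2l ?invr_ge0//.
rewrite -sumrB (le_trans (ler_norm_sum _ _ _))//.
have zz' k : (k < n)%N -> k != i -> z' k = z k.
  by move=> kn /negbTE ki; rewrite z'E /reindex /swap ki; case: eqP => // ?; lia.
have hsum : \sum_(l < n) (l == i :> nat)%:R = 1 :> R.
  rewrite (bigD1 (Ordinal iltn))//= eqxx big1 ?addr0// => l li.
  by rewrite (_ : (l == i :> nat) = false)//; apply/negbTE; apply: contra_neq li => li; exact/val_inj.
rewrite !nbrsE -[X in _ * (X + _ + _)]hsum -!big_split /= mulr_sumr; apply: ler_sum => -[l /= ln] _.
have L0 : 0 <= level n `^ alpha by exact: powR_ge0.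
have [li|li] /= := eqVneq l i; [|case: (leP (edist (z i) (z l)) (trunc_radius n)) => h1].
- rewrite !addr0 mulr1; have := trunc_knn_ge0 j alpha n z l; have := trunc_knn_ge0 j alpha n z' l.
  have := trunc_knn_le j alpha0 n z l; have := trunc_knn_le j alpha0 n z' l.
  by rewrite ler_norml; lra.
- rewrite add0r; apply: (@le_trans _ _ (level n `^ alpha)); last first.
    by rewrite ler_peMr// lerDl.
  have := trunc_knn_ge0 j alpha n z l; have := trunc_knn_ge0 j alpha n z' l.
  have := trunc_knn_le j alpha0 n z l; have := trunc_knn_le j alpha0 n z' l.
  by rewrite ler_norml; lra.
- rewrite !add0r; case: (leP (edist (z' i) (z' l)) (trunc_radius n)) => h2 /=; last first.
    rewrite mulr0 (@trunc_knn_local n z z' i l)// ?subrr ?normr0//.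
    by rewrite -(zz' l).
  rewrite mulr1; have := trunc_knn_ge0 j alpha n z l; have := trunc_knn_ge0 j alpha n z' l.
  have := trunc_knn_le j alpha0 n z l; have := trunc_knn_le j alpha0 n z' l.
  by rewrite ler_norml; lra.
Qed.

Lemma knn_first n (z z' : seqspace T) i : (i < n)%N -> (forall k, (k < n)%N -> z k = z' k) ->
  knn j n z i = knn j n z' i.
Proof.
move=> iltn zz'; congr kth; apply/eq_in_map => l; rewrite mem_others => /andP[_ ln].
by rewrite !zz'.
Qed.

Lemma trunc_mean_first n : depends_first n (trunc_mean n).
Proof.
move=> z z' zz'; congr (_ * _); apply: eq_bigr => -[i iltn] _ /=.
by rewrite /trunc_knn (knn_first iltn zz').
Qed.

Lemma bounded_trunc_mean n : (j < n)%N -> bounded_meas (trunc_mean n).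
Proof.
by move=> jn; apply: bounded_measZ; apply: bounded_meas_sum => -[i iltn]; exact: bounded_trunc_knn.
Qed.

Lemma trunc_mean_ge0 n z : 0 <= trunc_mean n z.
Proof. by rewrite mulr_ge0 ?invr_ge0// sumr_ge0// => i _; exact: trunc_knn_ge0. Qed.

Lemma trunc_radius_ge0 n : 0 <= trunc_radius n.
Proof. by rewrite divr_ge0 ?powR_ge0. Qed.

Lemma trunc_radiusX n : n%:R * trunc_radius n ^+ d <= level n ^+ d.
Proof.
case: n => [|n]; first by rewrite mul0r exprn_ge0 ?level_ge0.
have e : (n.+1%:R `^ d%:R^-1) ^+ d = n.+1%:R :> R.
  by rewrite -powR_mulrn ?powR_ge0// -powRrM mulVf ?powRr1// pnatr_eq0 -lt0n.
by rewrite /trunc_radius expr_div_n e mulrC divfK// pnatr_eq0.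
Qed.

Lemma level_ge1 n : (0 < n)%N -> 1 <= level n.
Proof.
move=> n0; apply: (@le_trans _ _ (1 `^ (8 * (alpha + d%:R))^-1)); first by rewrite powR1.
rewrite ge0_ler_powR ?nnegrE ?ler1n//.
by rewrite invr_ge0 mulr_ge0// addr_ge0// ltW.
Qed.

Lemma level_powR n : (level n `^ alpha * level n ^+ d) ^+ 2 = n%:R `^ 4^-1.
Proof.
have p0 : 0 < alpha + d%:R by rewrite ltr_wpDr.
rewrite -[level n ^+ d]powR_mulrn ?level_ge0// -powRD; last by rewrite gt_eqF.
rewrite -powR_mulrn ?powR_ge0// /level -!powRrM; congr (_ `^ _).
by field; rewrite gt_eqF.
Qed.

Variables (F : probability T R) (mu : probability (seqspace T) R) (f : T -> R) (b : R).
Hypotheses (mu_iid : iid_law F mu)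
  (FE : forall A, measurable A -> F A = (\int[lam]_(x in A) (f x)%:E)%E)
  (mf : measurable_fun setT f) (f0 : forall x, 0 <= f x) (fb : forall x, f x <= b).

(** The mean number of neighbors within the truncation radius is at most [n * b * ball_vol d] times
    the power [d] of that radius, that is [b * ball_vol d * level n ^+ d]. *)
Lemma Ex_nbrs_sqr n i : (0 < n)%N -> (i < n)%N ->
  Ex mu (fun z => (nbrs n (trunc_radius n) z i)%:R ^+ 2) <=
  b * ball_vol d * level n ^+ d + (b * ball_vol d * level n ^+ d) ^+ 2.
Proof.
move=> n0 iltn; set B := b * _ * _; have b0 : 0 <= b by exact: le_trans (f0 0) (fb 0).
set r := trunc_radius n; have bn : bounded_meas (fun z : seqspace T => (nbrs n r z 0)%:R ^+ 2 : R).
  by apply: bounded_measX; exact: bounded_nbrs.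
have -> : Ex mu (fun z => (nbrs n r z i)%:R ^+ 2) = Ex mu (fun z => (nbrs n r z 0)%:R ^+ 2).
  rewrite -(Ex_reindex mu_iid (@swap_inj 0 i) bn); congr Ex; apply/funext => z.
  by rewrite nbrs_swap.
rewrite (_ : (fun z => _) = (fun z => (near_count n.-1 (z 0%N) r (shift z))%:R ^+ 2)); last first.
  by apply/funext => z; rewrite nbrs0.
pose p := b * ball_vol d * r ^+ d.
have r0 : 0 <= r := trunc_radius_ge0 n.
have v0 := @ball_vol_ge0 R d.
have p0 : 0 <= p by rewrite !mulr_ge0 ?exprn_ge0.
apply: (le_trans (Ex_near0_sqr mu_iid n.-1 p0 (fun x => ball_prob_le FE mf f0 x r0 fb))).
have h : n.-1%:R * p <= B.
  apply: (@le_trans _ _ (n%:R * p)); first by rewrite ler_wpM2r// ler_nat leq_pred.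
  have -> : n%:R * p = b * ball_vol d * (n%:R * r ^+ d) by rewrite /p; ring.
  by rewrite ler_wpM2l ?mulr_ge0// trunc_radiusX.
by rewrite lerD// lerXn2r ?nnegrE ?mulr_ge0 ?exprn_ge0 ?level_ge0.
Qed.

(** Each of the [n] squared increments has expectation of order n^(-2) level^(2 (alpha + d)), and
    the power of the level is n^(1/4). *)
Lemma trunc_mean_var : exists C : R, 0 <= C /\ forall n, (j < n)%N ->
  Ex mu (fun z => trunc_mean n z ^+ 2) - Ex mu (trunc_mean n) ^+ 2 <= C * n%:R `^ (- (3 / 4)).
Proof.
have b0 : 0 <= b by exact: le_trans (f0 0) (fb 0).
have v0 := @ball_vol_ge0 R d.
pose B := b * ball_vol d; have B0 : 0 <= B by rewrite mulr_ge0.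
(* The 3 comes from (1 + s + t)^2 <= 3 (1 + s^2 + t^2); the other factor bounds
   [1 + 2 * (B * X + (B * X) ^+ 2)] by a multiple of [X ^+ 2], using [1 <= X]. *)
exists (3 * (1 + 2 * B + 2 * B ^+ 2)); split; first by rewrite mulr_ge0// !addr_ge0 ?mulr_ge0 ?sqr_ge0.
move=> n jn; have n0 : (0 < n)%N by exact: leq_ltn_trans jn.
have bt := bounded_trunc_mean jn.
apply: (le_trans (efron_stein mu_iid bt (trunc_mean_ge0 n) (@trunc_mean_first n))).
set r := trunc_radius n; set A := level n `^ alpha; set X := level n ^+ d.
have X1 : 1 <= X by rewrite exprn_ege1// level_ge1.
have A0 : 0 <= A by exact: powR_ge0.
pose V := n%:R^-2 * (A ^+ 2 * (3 * (1 + 2 * (B * X + (B * X) ^+ 2)))).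
have step i : (i < n)%N ->
    Ex mu (fun z => (trunc_mean n z - trunc_mean n (reindex (swap i (n + i)) z)) ^+ 2) <= V.
  move=> iltn; pose N (z : seqspace T) : R := (nbrs n r z i)%:R.
  have bN : bounded_meas (fun z => N z ^+ 2) by apply: bounded_measX; exact: bounded_nbrs.
  pose N' (z : seqspace T) : R := N (reindex (swap i (n + i)) z).
  have bN' : bounded_meas (fun z => N' z ^+ 2).
    exact: (bounded_meas_reindex (swap i (n + i)) bN).
  have EN : Ex mu (fun z => N z ^+ 2) <= B * X + (B * X) ^+ 2 by exact: Ex_nbrs_sqr.
  have EN' : Ex mu (fun z => N' z ^+ 2) <= B * X + (B * X) ^+ 2.
    have e : Ex mu (fun z => N' z ^+ 2) = Ex mu (fun z => N z ^+ 2) :=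
      Ex_reindex mu_iid (@swap_inj i (n + i)) bN.
    by rewrite e.
  pose c := n%:R^-2 * (A ^+ 2 * 3).
  have c0 : 0 <= c by rewrite !mulr_ge0 ?invr_ge0 ?sqr_ge0.
  apply: (@le_trans _ _ (Ex mu (fun z => c * (1 + (N z ^+ 2 + N' z ^+ 2))))).
    apply: le_Ex.
    - apply: bounded_measX; apply: bounded_measB; first exact: bt.
      exact: (bounded_meas_reindex (swap i (n + i)) bt).
    - apply: bounded_measZ; apply: bounded_measD; first exact: bounded_meas_cst.
      exact: bounded_measD.
    move=> z; have h := trunc_mean_diff jn iltn (erefl (reindex (swap i (n + i)) z)).
    rewrite -real_normK ?num_real//.
    apply: (@le_trans _ _ ((n%:R^-1 * (A * (1 + N z + N' z))) ^+ 2)).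
      by rewrite lerXn2r ?nnegrE//; exact: le_trans h.
    have -> : (n%:R^-1 * (A * (1 + N z + N' z))) ^+ 2 = n%:R^-2 * (A ^+ 2 * (1 + N z + N' z) ^+ 2).
      by rewrite !exprMn exprVn.
    have -> : c * (1 + (N z ^+ 2 + N' z ^+ 2)) = n%:R^-2 * (A ^+ 2 * (3 * (1 + (N z ^+ 2 + N' z ^+ 2)))).
      by rewrite /c; ring.
    rewrite ler_wpM2l ?invr_ge0 ?exprn_ge0// ler_wpM2l ?sqr_ge0//.
    have := sqr_ge0 (1 - N z); have := sqr_ge0 (1 - N' z); have := sqr_ge0 (N z - N' z); nra.
  rewrite ExZ; last by apply: bounded_measD; [exact: bounded_meas_cst|exact: bounded_measD].
  rewrite ExD; [|exact: bounded_meas_cst|exact: bounded_measD].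
  rewrite ExD// (Ex_cst mu).
  have -> : V = c * (1 + 2 * (B * X + (B * X) ^+ 2)) by rewrite /V /c; ring.
  rewrite ler_wpM2l// lerD2l mulr_natl mulr2n; exact: lerD.
apply: (@le_trans _ _ (n%:R * V)).
  apply: (@le_trans _ _ (\sum_(i < n) V)); last by rewrite sumr_const card_ord mulr_natl.
  apply: (@le_trans _ _ (\sum_(i < n) Ex mu (fun z => (trunc_mean n z - trunc_mean n (reindex (swap i (n + i)) z)) ^+ 2))).
    rewrite ler_piMl ?invf_le1// ?sumr_ge0// ?ler1n// => i _.
    by apply: Ex_ge0 => z; exact: sqr_ge0.
  by apply: ler_sum => -[i iltn] _; exact: step.
have -> : n%:R `^ (- (3 / 4)) = n%:R^-1 * (A * X) ^+ 2.
  rewrite level_powR -[n%:R^-1]powR_inv1 ?ler0n// -powRD; last by rewrite pnatr_eq0 -lt0n n0 implybT.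
  by congr (_ `^ _); lra.
have -> : n%:R * V = n%:R^-1 * (A ^+ 2 * (3 * (1 + 2 * (B * X + (B * X) ^+ 2)))).
  by rewrite /V mulrA; congr (_ * _); field; rewrite pnatr_eq0 -lt0n.
have -> : 3 * (1 + 2 * B + 2 * B ^+ 2) * (n%:R^-1 * (A * X) ^+ 2) =
    n%:R^-1 * (A ^+ 2 * (3 * ((1 + 2 * B + 2 * B ^+ 2) * X ^+ 2))).
  by move: (n%:R^-1) => i; ring.
rewrite ler_wpM2l ?invr_ge0// ler_wpM2l ?sqr_ge0// ler_wpM2l//.
have X2 : X <= X ^+ 2 by rewrite expr2 ler_peMr// (le_trans _ X1).
have X3 : 1 <= X ^+ 2 by exact: le_trans X1 X2.
have : B * X <= B * X ^+ 2 by rewrite ler_wpM2l.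
rewrite exprMn; nra.
Qed.

End variance.

(** * Interpolation between fourth powers *)

Section interpolation.
Context {R : realType}.
Implicit Types (k m n : nat).

Lemma leq_expS k m : (0 < m)%N -> (k.+1 <= k.+1 ^ m)%N.
Proof. by move=> m0; rewrite -[leqLHS]expn1 leq_pexp2l. Qed.

Lemma fourth_root_nat n : exists k, (k ^ 4 <= n < k.+1 ^ 4)%N.
Proof.
elim: n => [|n [k /andP[h1 h2]]]; first by exists 0%N.
have [h|h] := ltnP n.+1 (k.+1 ^ 4); first by exists k; rewrite h (leq_trans h1).
by exists k.+1; rewrite h/= (leq_trans (_ : n.+2 <= (k.+1 ^ 4).+1)%N)// ltn_exp2r.
Qed.

Lemma nat_powRN_cvg0 (p : R) : 0 < p -> n%:R `^ (- p) @[n --> \oo] --> (0 : R).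
Proof.
move=> p0; apply/cvgrPdist_le => eps eps0.
suff h : \forall n \near \oo, (eps^-1) `^ p^-1 < n%:R.
  near=> n; have hn : (eps^-1) `^ p^-1 < n%:R by near: n; exact: h.
  rewrite sub0r normrN ger0_norm ?powR_ge0// powRN.
  have n0 : 0 < n%:R :> R by rewrite (le_lt_trans _ hn)// powR_ge0.
  rewrite -[eps]invrK lef_pV2 ?posrE ?invr_gt0 ?powR_gt0// ltW//.
  by rewrite powR_lt_iff// invr_ge0 ltW.
near=> n; apply: lt_le_trans (_ : (eps^-1) `^ p^-1 + 1 <= n%:R); first by rewrite ltrDl.
by near: n; exact: nbhs_infty_ger.
Unshelve. all: end_near. Qed.

Variables (Q x : nat -> R) (a L : R) (n0 : nat).
Let s n := n%:R^-1 * (n%:R `^ a * Q n).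
Hypotheses (a0 : 0 <= a) (Q0 : forall n, 0 <= Q n)
  (Qmn : forall m n, (n0 <= m)%N -> (m <= n)%N ->
    n%:R `^ a * Q n <= n%:R `^ a * Q m + (n - m)%:R * n%:R `^ 8^-1)
  (sL : s (k.+1 ^ 4)%N @[k --> \oo] --> L).

Let q k : R := (1 + harmonic k) ^+ 4.
Let e k : R := 15 * 2 * (k.+2%:R `^ (- 2^-1)).

Let qE k : q k = (k.+2 ^ 4)%:R / (k.+1 ^ 4)%:R.
Proof.
rewrite /q /harmonic /= !natrX -expr_div_n; congr (_ ^+ 4).
by rewrite -[k.+2%:R]natr1 mulrDl divff ?mul1r ?pnatr_eq0.
Qed.

Let q_ge1 k : 1 <= q k.
Proof. by rewrite exprn_ege1// lerDl harmonic_ge0. Qed.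

(** With y = [k.+1], the relative number of new points is at most 15 / y, because (y + 1)^4 - y^4 <=
    15 y^3, and 1 / y <= 2 / (y + 1). Each new point may contribute up to the square root of
    [k.+2]. *)
Let gap k : ((k.+2 ^ 4)%:R - (k.+1 ^ 4)%:R) / (k.+1 ^ 4)%:R * (k.+2 ^ 4)%:R `^ 8^-1 <= e k.
Proof.
have k1 : 1 <= k.+1%:R :> R by rewrite ler1n.
have r0 : 0 <= k.+2%:R `^ 2^-1 :> R by exact: powR_ge0.
have -> : (k.+2 ^ 4)%:R `^ 8^-1 = k.+2%:R `^ 2^-1 :> R.
  by rewrite natrX -powR_mulrn// -powRrM; congr (_ `^ _); field.
have -> : e k = 15 * (2 / k.+2%:R) * k.+2%:R `^ 2^-1.
  rewrite /e -!mulrA; congr (_ * (_ * _)).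
  rewrite -[k.+2%:R^-1]powR_inv1 ?ler0n// -powRD ?pnatr_eq0 ?implybT//; congr (_ `^ _); lra.
rewrite ler_wpM2r// !natrX -[k.+2%:R]natr1; set y := k.+1%:R in k1 *.
have y0 : 0 < y by exact: lt_le_trans k1.
rewrite ler_pdivrMr ?exprn_gt0//.
have -> : 15 * (2 / (y + 1)) * y ^+ 4 = 30 * y ^+ 4 / (y + 1) by field; lra.
rewrite ler_pdivlMr; last lra.
have h2 : y <= y ^+ 2 by rewrite expr2 ler_peMr// ltW.
have h3 : y ^+ 2 <= y ^+ 3 by rewrite (exprS y 2) ler_peMl// exprn_ge0// ltW.
have h4 : y ^+ 3 <= y ^+ 4 by rewrite (exprS y 3) ler_peMl// exprn_ge0// ltW.
have -> : ((y + 1) ^+ 4 - y ^+ 4) * (y + 1) = 4 * y ^+ 4 + 10 * y ^+ 3 + 10 * y ^+ 2 + 5 * y + 1 by ring.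
lra.
Qed.

(** An integer above [a]: factors n^a are then controlled by integer powers of [q k], whose limit
    follows from the continuity of monomials. *)
Let N := (Num.truncn a).+1.

Let aN : a <= N%:R.
Proof. by have /andP[_ /ltW] := truncn_itv a0. Qed.

Let q_cvg n : q k ^+ n @[k --> \oo] --> (1 : R).
Proof.
have h1 : 1 + harmonic k @[k --> \oo] --> (1 + 0 : R).
  by apply: cvgD; [exact: cvg_cst|exact: cvg_harmonic].
have -> : (fun k => q k ^+ n) = (fun k => (1 + harmonic k) ^+ (4 * n)).
  by apply/funext => k; rewrite /q -exprM.
rewrite -[X in _ --> X](expr1n R (4 * n)) -[X in X ^+ _]addr0.
apply: (@cvg_comp _ _ _ (fun k => 1 + harmonic k) (fun y : R => y ^+ (4 * n))); first exact: h1.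
exact: exprn_continuous.
Qed.

Let e_cvg : e k @[k --> \oo] --> (0 : R).
Proof.
rewrite -[X in _ --> X](mulr0 (15 * 2)); apply: cvgM; first exact: cvg_cst.
have := @nat_powRN_cvg0 2^-1 ltac:(by []).
by rewrite -(@cvg_shiftn 2); under [X in X @ _ --> _ -> _]eq_fun do rewrite addn2.
Qed.

Let s_upper k n : (n0 <= k.+1 ^ 4)%N -> (k.+1 ^ 4 <= n)%N -> (n <= k.+2 ^ 4)%N ->
  s n <= q k ^+ N * s (k.+1 ^ 4)%N + e k.
Proof.
set m := (k.+1 ^ 4)%N; set M := (k.+2 ^ 4)%N => hm mn nM.
have m0 : 0 < m%:R :> R by rewrite ltr0n expn_gt0.
have n_0 : 0 < n%:R :> R by rewrite (lt_le_trans m0)// ler_nat.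
have mnR : m%:R <= n%:R :> R by rewrite ler_nat.
have nMR : n%:R <= M%:R :> R by rewrite ler_nat.
apply: (@le_trans _ _ (n%:R^-1 * (n%:R `^ a * Q m + (n - m)%:R * n%:R `^ 8^-1))).
  by rewrite ler_wpM2l ?invr_ge0 ?(ltW n_0)// Qmn.
rewrite mulrDr; apply: lerD.
  have -> : n%:R `^ a * Q m = (n%:R / m%:R) `^ a * (m%:R `^ a * Q m).
    by rewrite mulrA -powRM ?divr_ge0// divfK// gt_eqF.
  rewrite /s mulrCA; apply: ler_pM; rewrite ?powR_ge0 ?mulr_ge0 ?invr_ge0 ?powR_ge0//.
    have t1 : 1 <= n%:R / m%:R :> R by rewrite ler_pdivlMr// mul1r.
    apply: (@le_trans _ _ ((n%:R / m%:R) `^ N%:R)); first by rewrite ler_powR.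
    rewrite powR_mulrn ?divr_ge0// lerXn2r ?nnegrE ?divr_ge0//; first by rewrite (le_trans ler01).
    by rewrite qE ler_wpM2r// invr_ge0.
  by rewrite ler_wpM2r ?mulr_ge0 ?powR_ge0// lef_pV2.
apply: le_trans (gap k); rewrite -/m -/M natrB// mulrA [n%:R^-1 * _]mulrC.
apply: ler_pM; rewrite ?powR_ge0 ?divr_ge0 ?subr_ge0//.
  by apply: ler_pM; rewrite ?subr_ge0 ?invr_ge0 ?lef_pV2 ?lerB.
by rewrite ge0_ler_powR ?nnegrE.
Qed.

Let s_lower k n : (n0 <= k.+1 ^ 4)%N -> (k.+1 ^ 4 <= n)%N -> (n <= k.+2 ^ 4)%N ->
  (q k ^+ N)^-1 * s (k.+2 ^ 4)%N - e k <= s n.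
Proof.
set m := (k.+1 ^ 4)%N; set M := (k.+2 ^ 4)%N => hm mn nM.
have m0 : 0 < m%:R :> R by rewrite ltr0n expn_gt0.
have M0 : 0 < M%:R :> R by rewrite ltr0n expn_gt0.
have n_0 : 0 < n%:R :> R by rewrite (lt_le_trans m0)// ler_nat.
have mnR : m%:R <= n%:R :> R by rewrite ler_nat.
have nMR : n%:R <= M%:R :> R by rewrite ler_nat.
have h := Qmn (leq_trans hm mn) nM.
have Mna : M%:R `^ a = (M%:R / n%:R) `^ a * n%:R `^ a :> R.
  by rewrite -powRM ?divr_ge0// divfK// gt_eqF.
have t1 : 1 <= M%:R / n%:R :> R by rewrite ler_pdivlMr// mul1r.
have r1 : 1 <= (M%:R / n%:R) `^ a :> R.
  by apply: (@le_trans _ _ (1 `^ a)); [rewrite powR1|rewrite ge0_ler_powR ?nnegrE ?divr_ge0].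
have r0 : 0 < (M%:R / n%:R) `^ a :> R by exact: lt_le_trans r1.
have rq : (M%:R / n%:R) `^ a <= q k ^+ N.
  apply: (@le_trans _ _ ((M%:R / n%:R) `^ N%:R)); first by rewrite ler_powR.
  rewrite powR_mulrn ?divr_ge0// lerXn2r ?nnegrE ?divr_ge0//; first by rewrite (le_trans ler01).
  by rewrite qE ler_wpM2l// lef_pV2.
have qN0 : 0 < q k ^+ N by exact: lt_le_trans rq.
have s0 : 0 <= s M by rewrite /s !mulr_ge0 ?invr_ge0 ?powR_ge0.
rewrite lerBlDr mulrC ler_pdivrMr//.
apply: (@le_trans _ _ ((s n + e k) * (M%:R / n%:R) `^ a)); last first.
  by rewrite ler_wpM2l// addr_ge0 ?mulr_ge0 ?powR_ge0.
rewrite mulrDl; apply: (@le_trans _ _ (M%:R^-1 * (M%:R `^ a * Q n + (M - n)%:R * M%:R `^ 8^-1))).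
  by rewrite ler_wpM2l ?invr_ge0 ?(ltW M0).
rewrite mulrDr; apply: lerD.
  have -> : s n * (M%:R / n%:R) `^ a = n%:R^-1 * (M%:R `^ a * Q n).
    by rewrite Mna /s; move: (n%:R^-1) (n%:R `^ a) (_ `^ a) => i y t; ring.
  by rewrite ler_wpM2r ?mulr_ge0 ?powR_ge0// lef_pV2.
apply: (@le_trans _ _ (e k)); last by rewrite ler_peMr// mulr_ge0 ?powR_ge0.
apply: le_trans (gap k); rewrite -/m -/M natrB// mulrA [M%:R^-1 * _]mulrC.
rewrite ler_wpM2r ?powR_ge0//.
by apply: ler_pM; rewrite ?subr_ge0 ?invr_ge0 ?lef_pV2 ?lerB// (le_trans mnR).
Qed.

(* [Q] almost decreases, so between two consecutive fourth powers [s] is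
   controlled by its values there up to the factor [q k ^+ N] and the error [e k]. *)
Lemma interpolation_cvg : s n @[n --> \oo] --> L.
Proof.
pose A k := (q k ^+ N)^-1 * s (k.+2 ^ 4)%N - e k.
pose B k := q k ^+ N * s (k.+1 ^ 4)%N + e k.
have AL : A k @[k --> \oo] --> L.
  rewrite -[L]subr0 -[L]mul1r; apply: cvgB; last exact: e_cvg.
  apply: cvgM; last by rewrite (@cvg_shiftS _ (fun k => s (k.+1 ^ 4)%N)).
  by rewrite -[X in _ --> X]invr1; apply: cvgV => //; exact: oner_neq0.
have BL : B k @[k --> \oo] --> L.
  by rewrite -[L]addr0 -[L]mul1r; apply: cvgD; [apply: cvgM|exact: e_cvg].
apply/cvgrPdist_le => eps eps0.
have /cvgrPdist_le/(_ _ eps0)[kA _ hA] := AL.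
have /cvgrPdist_le/(_ _ eps0)[kB _ hB] := BL.
pose k0 := maxn (maxn kA kB) n0; exists (k0.+1 ^ 4)%N => // n /= hn.
have [[|k]] := fourth_root_nat n.
  by rewrite exp1n ltnS leqn0 => /andP[_ /eqP n_0]; move: hn; rewrite n_0 leqn0 expn_eq0.
move=> /andP[h1 h2].
have : (k0.+1 ^ 4 < k.+2 ^ 4)%N by exact: leq_ltn_trans h2.
rewrite ltn_exp2r// !ltnS => kk.
have kA' : (kA <= k)%N by rewrite (leq_trans _ kk)// /k0 !leq_max leqnn.
have kB' : (kB <= k)%N by rewrite (leq_trans _ kk)// /k0 !leq_max leqnn orbT.
have n0k : (n0 <= k.+1 ^ 4)%N.
  apply: (@leq_trans k.+1); last exact: leq_expS.
  by rewrite (leq_trans _ (leqW kk))// /k0 leq_max leqnn orbT.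
have := hA _ kA'; have := hB _ kB'; rewrite !ler_norml => /andP[hB1 hB2] /andP[hA1 hA2].
have := s_upper n0k h1 (ltnW h2); have := s_lower n0k h1 (ltnW h2).
rewrite -/(A k) -/(B k) => lA lB; apply/andP; split; lra.
Qed.

End interpolation.

(** * Almost sure and quadratic convergence *)

Section borel_cantelli.
Context {R : realType} {d} {T : measurableType d}.
Variable P : probability T R.

Lemma borel_cantelli_sq (A : nat -> set T) (C : R) : (forall n, measurable (A n)) ->
  (forall n, (P (A n) <= (C / n.+1%:R ^+ 2)%:E)%E) ->
  {ae P, forall t, \forall n \near \oo, ~ A n t}.
Proof.
move=> mA PA.
have C0 : 0 <= C.
  by have := le_trans (measure_ge0 P (A 0%N)) (PA 0%N); rewrite lee_fin expr1n divr1.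
have : P (lim_sup_set A) = 0%E.
  apply: lim_sup_set_cvg0 => //; apply: (@le_lt_trans _ _ (2 * C)%:E); last exact: ltry.
  apply: lime_le; first by apply: is_cvg_nneseries => n _ _; exact: measure_ge0.
  apply: nearW => n; apply: (@le_trans _ _ (\sum_(0 <= k < n) (C / k.+1%:R ^+ 2)%:E)%E).
    by apply: lee_sum => k _; exact: PA.
  rewrite sumEFin lee_fin.
  (* Each term C / y^2 is at most 2C / y - 2C / (y + 1) for y >= 1, so the partial sums are bounded
     by a telescoping sum. *)
  suff : \sum_(0 <= k < n) (C / k.+1%:R ^+ 2) <= 2 * C - 2 * C / n.+1%:R.
    by move/le_trans; apply; rewrite gerBl divr_ge0// mulr_ge0.
  elim: n => [|n ih]; first by rewrite big_nil divr1 subrr.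
  rewrite big_nat_recr//= (le_trans (lerD ih (lexx _)))// -[n.+2%:R]natr1.
  have y1 : 1 <= n.+1%:R :> R by rewrite ler1n.
  set y := n.+1%:R in y1 *; have y0 : 0 < y by exact: lt_le_trans y1.
  suff : C / y ^+ 2 <= 2 * C / y - 2 * C / (y + 1).
    by move: (C / y ^+ 2) (2 * C / y) (2 * C / (y + 1)) => u v w; lra.
  have -> : 2 * C / y - 2 * C / (y + 1) = C / y ^+ 2 * (2 * y / (y + 1)) by field; lra.
  rewrite ler_peMr ?divr_ge0 ?exprn_ge0 ?(ltW y0)// ler_pdivlMr; lra.
move=> h; exists (lim_sup_set A); split => //.
  apply: bigcap_measurable => // n _; exact: bigcup_measurable.
move=> t /= nt n _; apply: contrapT => hn; apply: nt; exists n => // m /= nm At.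
by apply: hn; exists m.
Qed.

End borel_cantelli.

Lemma expRN_le_poly {R : realType} p (x : R) : 0 < x -> expR (- x) <= p`!%:R / x ^+ p.
Proof.
move=> x0; rewrite expRN ler_pdivlMr ?exprn_gt0// mulrC ler_pdivrMr ?expR_gt0//.
by rewrite mulrC -ler_pdivrMr ?fact_gt0R//; apply: expr_fact_le_expR; exact: ltW.
Qed.

(** * Probability that the truncation is active, and its consequences for the untruncated sum *)

Section tails.
Context {R : realType} {d : nat}.
Notation T := 'rV[R]_d.
Notation lam := (@lebesgue_rV R d).
Variables (j : nat) (alpha : R).
Hypotheses (d0 : (0 < d)%N) (j0 : (0 < j)%N) (alpha0 : 0 < alpha).
Notation level := (@level R d alpha).
Notation trunc_knn := (@trunc_knn R d j alpha).
Notation trunc_mean := (@trunc_mean R d j alpha).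
Notation trunc_radius := (@trunc_radius R d alpha).

Variables (F : probability T R) (mu : probability (seqspace T) R) (f : T -> R) (b M c D : R).
Hypotheses (mu_iid : iid_law F mu)
  (FE : forall A, measurable A -> F A = (\int[lam]_(x in A) (f x)%:E)%E)
  (mf : measurable_fun setT f) (f0 : forall x, 0 <= f x) (fb : forall x, f x <= b)
  (M0 : 0 < M) (fM : forall x, 0 < f x -> box d M x) (c0 : 0 < c) (D0 : 0 < D)
  (fD : forall x y, supp f x -> supp f y -> edist x y <= D)
  (fc : forall x r, supp f x -> 0 <= r -> r <= D -> c * r ^+ d <= ball_prob F x r).

Definition knn_exceeds n : set (seqspace T) :=
  [set z | exists2 i, (i < n)%N & trunc_radius n < knn j n z i].

Lemma measurable_knn_gt n i r : (j < n)%N -> (i < n)%N ->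
  measurable [set z : seqspace T | r < knn j n z i].
Proof.
move=> jn iltn; rewrite (_ : [set _ | _] = ~` [set z | knn j n z i <= r]).
  by apply: measurableC; apply: measurable_le => //; apply: measurable_knn; rewrite ?j0.
by apply/seteqP; split=> z /=; rewrite ltNge => /negP.
Qed.

Lemma knn_exceedsE n :
  knn_exceeds n = \bigcup_(i in `I_n) [set z | trunc_radius n < knn j n z i].
Proof. by apply/seteqP; split=> z [i iltn h]; exists i. Qed.

Lemma measurable_knn_exceeds n : (j < n)%N -> measurable (knn_exceeds n).
Proof.
by move=> jn; rewrite knn_exceedsE; apply: bigcup_measurable => i iltn; exact: measurable_knn_gt.
Qed.

Lemma knn_exceeds_le_exp n : (j < n)%N ->
  (mu (knn_exceeds n) <= (n%:R * (2 ^+ j * expR (- (c / 4 * level n ^+ d))))%:E)%E.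
Proof.
move=> jn; have n0 : (0 < n)%N by exact: leq_ltn_trans jn.
pose B i := [set z : seqspace T | trunc_radius n < knn j n z i].
have mB i : (i < n)%N -> measurable (B i) by exact: measurable_knn_gt.
have rX : n%:R * trunc_radius n ^+ d = level n ^+ d.
  have e : (n%:R `^ d%:R^-1) ^+ d = n%:R :> R.
    by rewrite -powR_mulrn ?powR_ge0// -powRrM mulVf ?powRr1// pnatr_eq0 -lt0n.
  by rewrite /trunc_radius expr_div_n e mulrC divfK// pnatr_eq0 -lt0n.
have B0 : mu (B 0%N) = (Ex mu (fun z : seqspace T => (trunc_radius n < knn j n z 0)%R%:R))%:E.
  rewrite -(Ex_indic mu (mB _ n0)); congr (Ex _ _)%:E; apply/funext => z.
  by rewrite indicE mem_setE.
have Bi i : (i < n)%N -> mu (B i) = mu (B 0%N).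
  move=> iltn; rewrite -(iid_reindex mu_iid (@swap_inj 0 i) (mB _ n0)); congr (mu _).
  by apply/seteqP; split=> z; rewrite /B /= knn_swap.
have sub : (mu (knn_exceeds n) <= \sum_(i < n) mu (B i))%E.
  have -> : knn_exceeds n = \big[setU/set0]_(i < n) B i by rewrite knn_exceedsE bigcup_mkord.
  by apply: (Boole_inequality mu) => i iltn; exact: mB.
apply: (le_trans sub); rewrite (eq_bigr (fun=> mu (B 0%N))); last by move=> -[i iltn] _; exact: Bi.
rewrite B0 sumEFin lee_fin sumr_const card_ord -[leLHS]mulr_natl ler_wpM2l// -rX.
exact: (knn0_tail_exp j0 mu_iid FE mf f0 c0 fD fc jn (trunc_radius_ge0 _ _)).
Qed.

(** The power [d] of the level is a positive power of [n], so the exponential bound beats any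
    polynomial. Order 2 serves the Borel-Cantelli lemma; a higher order compensates the crude bound
    on the sum in L^2. *)
Lemma knn_exceeds_le_poly (s : nat) : exists2 C : R, 0 <= C & forall n, (j < n)%N ->
  (mu (knn_exceeds n) <= (C / n%:R ^+ s)%:E)%E.
Proof.
pose del := d%:R / (8 * (alpha + d%:R)).
have dR : 0 < d%:R :> R by rewrite ltr0n.
have del0 : 0 < del by rewrite divr_gt0// mulr_gt0// addr_gt0.
(* The degree is such that n^(del p) >= n^(s + 1); the additional power of [n] pays for the union
   bound over the points. *)
pose p := (Num.truncn (s.+1%:R / del)).+1.
have hp : s.+1%:R <= del * p%:R.
  have q0 : 0 <= s.+1%:R / del by rewrite divr_ge0// ltW.
  by rewrite mulrC -ler_pdivrMr//; have /andP[_ /ltW] := truncn_itv q0.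
have c40 : 0 < c / 4 by rewrite divr_gt0.
exists (2 ^+ j * (p`!%:R / (c / 4) ^+ p)) => [|n jn].
  by rewrite mulr_ge0 ?exprn_ge0// divr_ge0// exprn_ge0// ltW.
have n0 : (0 < n)%N by exact: leq_ltn_trans jn.
have nR : 0 < n%:R :> R by rewrite ltr0n.
have n1 : 1 <= n%:R :> R by rewrite ler1n.
have l0 : 0 < level n by rewrite powR_gt0.
apply: (le_trans (knn_exceeds_le_exp jn)); rewrite lee_fin mulrCA -[leRHS]mulrA ler_wpM2l ?exprn_ge0//.
have x0 : 0 < c / 4 * level n ^+ d by rewrite mulr_gt0// exprn_gt0.
apply: (@le_trans _ _ (n%:R * (p`!%:R / (c / 4 * level n ^+ d) ^+ p))).
  by rewrite ler_wpM2l// expRN_le_poly.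
have lX : (level n ^+ d) ^+ p = n%:R `^ (del * p%:R).
  rewrite -exprM -powR_mulrn ?level_ge0// /level -powRrM natrM; congr (_ `^ _).
  by rewrite /del; ring.
have lp : n%:R ^+ s.+1 <= (level n ^+ d) ^+ p.
  by rewrite lX -powR_mulrn// ler_powR.
have -> : n%:R * (p`!%:R / (c / 4 * level n ^+ d) ^+ p) =
    p`!%:R / (c / 4) ^+ p * (n%:R / (level n ^+ d) ^+ p).
  by rewrite exprMn invfM; move: (_ ^- p) (_ ^- p) => u v; ring.
rewrite ler_wpM2l ?divr_ge0 ?exprn_ge0 ?(ltW c40)//.
apply: (@le_trans _ _ (n%:R / n%:R ^+ s.+1)).
  by rewrite ler_wpM2l// lef_pV2 ?posrE ?exprn_gt0.
by rewrite exprS invfM mulrA divff ?mul1r// gt_eqF.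
Qed.

Definition knn_sum n (z : seqspace T) : R := \sum_(i < n) knn j n z i `^ alpha.

Lemma knn_sum_ge0 n z : 0 <= knn_sum n z.
Proof. by apply: sumr_ge0 => i _; exact: powR_ge0. Qed.

Lemma trunc_mean_knn_sum n z : (0 < n)%N -> ~ knn_exceeds n z ->
  trunc_mean n z = n%:R^-1 * (n%:R `^ (alpha / d%:R) * knn_sum n z).
Proof.
move=> n0 nb; have nd0 : 0 < n%:R `^ d%:R^-1 :> R by rewrite powR_gt0// ltr0n.
congr (_ * _); rewrite mulr_sumr; apply: eq_bigr => -[i iltn] _ /=.
have h : knn j n z i <= trunc_radius n.
  by rewrite leNgt; apply/negP => h; apply: nb; exists i.
rewrite /trunc_knn min_l; last by rewrite mulrC -ler_pdivlMr.
by rewrite powRM ?powR_ge0 ?knn_ge0// -powRrM [_^-1 * _]mulrC.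
Qed.

(** Adding points only shrinks the distances of the first [m] points. Each of the [n - m] new points
    has distance at most the truncation radius, so its rescaled contribution is at most level^alpha
    <= n^(1/8). *)
Lemma knn_sum_step m n z : (j < m)%N -> (m <= n)%N -> ~ knn_exceeds n z ->
  n%:R `^ (alpha / d%:R) * knn_sum n z <=
  n%:R `^ (alpha / d%:R) * knn_sum m z + (n - m)%:R * n%:R `^ 8^-1.
Proof.
move=> jm mn nb; have m0 : (0 < m)%N by exact: leq_ltn_trans jm.
have n0 : (0 < n)%N by exact: leq_trans mn.
have nd0 : 0 < n%:R `^ d%:R^-1 :> R by rewrite powR_gt0// ltr0n.
have rl : n%:R `^ (alpha / d%:R) * trunc_radius n `^ alpha <= n%:R `^ 8^-1.
  have -> : n%:R `^ (alpha / d%:R) = (n%:R `^ d%:R^-1) `^ alpha :> R by rewrite -powRrM mulrC.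
  rewrite -powRM ?powR_ge0 ?trunc_radius_ge0// /trunc_radius mulrC divfK ?(gt_eqF nd0)//.
  rewrite /level -powRrM ler_powR ?ler1n// mulrC ler_pdivrMr ?mulr_gt0 ?addr_gt0 ?ltr0n//.
  by rewrite mulrA mulVf// mul1r lerDl.
rewrite -[leLHS]mulrC /knn_sum -(big_mkord xpredT (fun i => knn j n z i `^ alpha)).
rewrite (@big_cat_nat _ _ _ m)//= mulrC mulrDr; apply: lerD.
  rewrite ler_wpM2l ?powR_ge0// -(big_mkord xpredT (fun i => knn j m z i `^ alpha)).
  rewrite !big_nat; apply: ler_sum => i im.
  rewrite ge0_ler_powR ?nnegrE ?knn_ge0 ?(ltW alpha0)//.
  by apply: knn_monotone => //; rewrite j0.
apply: (@le_trans _ _ (n%:R `^ (alpha / d%:R) * ((n - m)%:R * trunc_radius n `^ alpha))); last first.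
  by rewrite mulrCA ler_wpM2l.
rewrite ler_wpM2l ?powR_ge0// mulr_natl -sumr_const_nat !big_nat; apply: ler_sum => i /andP[_ iltn].
rewrite ge0_ler_powR ?nnegrE ?knn_ge0 ?trunc_radius_ge0 ?(ltW alpha0)//.
by rewrite leNgt; apply/negP => h; apply: nb; exists i.
Qed.

End tails.

(** A selection that puts the points [i] and [k] first; the remaining values exceed both and only
    serve injectivity. *)
Definition pair_first (i k l : nat) : nat :=
  if l is l'.+1 then if l' is _.+1 then (i + k + l)%N else k else i.

Lemma pair_first_inj i k : i != k -> injective (pair_first i k).
Proof. by move=> ik [|[|u]] [|[|v]] //=; lia. Qed.

Lemma sqr_diff_le {R : realDomainType} (s t l B : R) : (s - t) ^+ 2 <= B ^+ 2 ->
  (s - l) ^+ 2 <= 2 * (t - l) ^+ 2 + 2 * B ^+ 2.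
Proof. by have := sqr_ge0 ((t - l) - (s - t)); nra. Qed.

(** * Convergence under the law of the sequence *)

Section sequence_limit.
Context {R : realType} {d : nat}.
Notation T := 'rV[R]_d.
Notation lam := (@lebesgue_rV R d).
Variables (j : nat) (alpha : R).
Hypotheses (d0 : (0 < d)%N) (j0 : (0 < j)%N) (alpha0 : 0 < alpha).
Notation trunc_knn := (@trunc_knn R d j alpha).
Notation trunc_mean := (@trunc_mean R d j alpha).
Notation knn_exceeds := (@knn_exceeds R d j alpha).
Notation knn_sum := (@knn_sum R d j alpha).

Variables (F : probability T R) (mu : probability (seqspace T) R) (f : T -> R) (b M c D : R).
Hypotheses (mu_iid : iid_law F mu)
  (FE : forall A, measurable A -> F A = (\int[lam]_(x in A) (f x)%:E)%E)
  (mf : measurable_fun setT f) (f0 : forall x, 0 <= f x) (fb : forall x, f x <= b)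
  (M0 : 0 < M) (fM : forall x, 0 < f x -> box d M x) (c0 : 0 < c) (D0 : 0 < D)
  (fD : forall x y, supp f x -> supp f y -> edist x y <= D)
  (fc : forall x r, supp f x -> 0 <= r -> r <= D -> c * r ^+ d <= ball_prob F x r).

Definition knn_limit : R := fine (\int[lebesgue_measure]_(y in `]0%R, +oo[)
  (knn_limit_tail j alpha F f y)%:E)%E.

Lemma Ex_trunc_mean n : (j < n)%N -> Ex mu (trunc_mean n) = Ex mu (fun z => trunc_knn n z 0).
Proof.
move=> jn; have n0 : (0 < n)%N by exact: leq_ltn_trans jn.
have bt i : (i < n)%N -> bounded_meas (fun z => trunc_knn n z i) by exact: bounded_trunc_knn.
rewrite ExZ; last by apply: bounded_meas_sum => -[i iltn]; exact: bt.
rewrite Ex_sum; last by move=> -[i iltn]; exact: bt.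
rewrite (eq_bigr (fun=> Ex mu (fun z => trunc_knn n z 0))).
  by rewrite sumr_const card_ord -[X in _ * X]mulr_natl mulrA mulVf ?mul1r// pnatr_eq0 -lt0n.
move=> -[i iltn] _ /=; rewrite -(Ex_reindex mu_iid (@swap_inj 0 i) (bt 0%N n0)).
by congr Ex; apply/funext => z; rewrite /(trunc_knn) knn_swap.
Qed.

Lemma trunc_mean_Ex_cvg : Ex mu (trunc_mean n) @[n --> \oo] --> knn_limit.
Proof.
have [_ h] := trunc_Ex_cvg d0 j0 alpha0 mu_iid FE mf f0 fb M0 fM c0 fD fc.
apply: cvg_trans h; apply: near_eq_cvg; near=> n; rewrite Ex_trunc_mean//.
by near: n; exists j.+1.
Unshelve. all: end_near. Qed.

(** At a sample size K^4 the variance is O(K^-3). Markov's inequality for the squared deviation with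
    threshold 1/K leaves the summable bound O(K^-2), while the threshold still tends to 0. *)
Lemma trunc_mean_ae_cvg :
  {ae mu, forall z, trunc_mean (k.+1 ^ 4)%N z @[k --> \oo] --> knn_limit}.
Proof.
have [C [C0 hC]] := @trunc_mean_var R d j alpha d0 j0 alpha0 F mu f b mu_iid FE mf f0 fb.
pose K k : nat := (k + j).+1; pose m k := (K k ^ 4)%N.
have jm k : (j < m k)%N.
  by apply: (@leq_trans (K k)); [rewrite ltnS leq_addl|exact: leq_expS].
pose e k := Ex mu (trunc_mean (m k)).
have bt k : bounded_meas (trunc_mean (m k)) by exact: bounded_trunc_mean.
pose g k z := (trunc_mean (m k) z - e k) ^+ 2.
have bg k : bounded_meas (g k).
  by apply: bounded_measX; apply: bounded_measB; [exact: bt|exact: bounded_meas_cst].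
pose A k : set (seqspace T) := [set z | (K k)%:R^-1 < g k z].
have mA k : measurable (A k).
  rewrite (_ : A k = ~` [set z | g k z <= (K k)%:R^-1]).
    by apply: measurableC; apply: measurable_le => //; exact: (proj1 (bg k)).
  by apply/seteqP; split=> z; rewrite /A /= ltNge => /negP.
have K0 k : 0 < (K k)%:R :> R by rewrite ltr0n.
have PA k : (mu (A k) <= (C / k.+1%:R ^+ 2)%:E)%E.
  rewrite -(Ex_indic mu (mA k)) lee_fin.
  apply: (@le_trans _ _ (Ex mu (fun z => (K k)%:R * g k z))).
    apply: le_Ex; [exact: bounded_meas_indic|exact: bounded_measZ|].
    move=> z; rewrite indicE; case: (boolP (z \in A k)) => [/set_mem h|_]; last first.
      by rewrite mulr_ge0 ?sqr_ge0.
    by rewrite mulrC -ler_pdivrMr// mul1r ltW.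
  rewrite ExZ// (Ex_var mu (e k) (bt k)) subrr expr0n addr0.
  apply: (@le_trans _ _ ((K k)%:R * (C * (m k)%:R `^ (- (3 / 4))))); first by rewrite ler_wpM2l// hC.
  have -> : (m k)%:R `^ (- (3 / 4)) = (K k)%:R ^- 3 :> R.
    have -> : (K k)%:R ^- 3 = (K k)%:R `^ (- 3%:R) :> R by rewrite powRN powR_mulrn.
    by rewrite /m natrX -powR_mulrn// -powRrM; congr (_ `^ _); field.
  have -> : (K k)%:R * (C * (K k)%:R ^- 3) = C * (K k)%:R ^- 2 by field; rewrite gt_eqF.
  by rewrite ler_wpM2l// lef_pV2 ?posrE ?exprn_gt0 ?lerXn2r ?nnegrE// ler_nat ltnS leq_addr.
apply: filterS (borel_cantelli_sq mA PA) => z hz.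
have ek : e k @[k --> \oo] --> knn_limit.
  apply: (@cvg_comp _ _ _ m (fun n => Ex mu (trunc_mean n)) _ \oo); last exact: trunc_mean_Ex_cvg.
  apply/cvgnyPge => n; near=> k.
  rewrite (@leq_trans (K k))//; last exact: leq_expS.
  rewrite /K ltnW// ltnS (@leq_trans k)// ?leq_addr//.
  by near: k; exists n.
have dk : trunc_mean (m k) z - e k @[k --> \oo] --> (0 : R).
  have hz' : \forall k \near \oo, g k z <= (K k)%:R^-1.
    by apply: filterS hz => k; rewrite /A /= => h; rewrite leNgt; exact/negP.
  apply/cvgrPdist_lt => eps eps0; near=> k.
  rewrite sub0r normrN.
  have h : g k z <= (K k)%:R^-1 by near: k; exact: hz'.
  have e2 : 0 < eps ^+ 2 by rewrite exprn_gt0.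
  have hk : (eps ^+ 2)^-1 + 1 <= k.+1%:R by near: k; exact: near_natS.
  have hK : (K k)%:R^-1 < eps ^+ 2.
    rewrite -[ltRHS]invrK ltf_pV2 ?posrE ?invr_gt0//.
    rewrite (@lt_le_trans _ _ k.+1%:R)//; first by rewrite (lt_le_trans _ hk)// ltrDl.
    by rewrite ler_nat ltnS leq_addr.
  rewrite -(@ltr_pXn2r _ 2) ?nnegrE ?(ltW eps0)// real_normK ?num_real//.
  exact: le_lt_trans hK.
have : trunc_mean (m k) z @[k --> \oo] --> knn_limit.
  have -> : (fun k => trunc_mean (m k) z) = (fun k => (trunc_mean (m k) z - e k) + e k).
    by apply/funext => k; rewrite subrK.
  by rewrite -[knn_limit]add0r; exact: cvgD.
by rewrite -(@cvg_shiftn j _ (fun k => trunc_mean (k.+1 ^ 4)%N z)).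
Unshelve. all: end_near. Qed.

Lemma knn_exceeds_ae : {ae mu, forall z, \forall n \near \oo, ~ knn_exceeds n z}.
Proof.
have [C C0 hC] := knn_exceeds_le_poly d0 j0 alpha0 mu_iid FE mf f0 c0 fD fc 2.
have jn n : (j < (n + j).+1)%N by rewrite ltnS leq_addl.
have mA n : measurable (knn_exceeds (n + j).+1) by exact: measurable_knn_exceeds.
have PA n : (mu (knn_exceeds (n + j).+1) <= (C / n.+1%:R ^+ 2)%:E)%E.
  apply: (le_trans (hC _ (jn n))); rewrite lee_fin ler_wpM2l//.
  by rewrite lef_pV2 ?posrE ?exprn_gt0 ?lerXn2r ?nnegrE// ler_nat ltnS leq_addr.
apply: filterS (borel_cantelli_sq mA PA) => z [N _ hN].
exists (N + j.+1)%N => // n /= hn.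
have := hN (n - j.+1)%N; rewrite /= leq_subRL; last exact: leq_trans (leq_addl _ _) hn.
rewrite addnC => /(_ hn); rewrite -addnS subnK//.
exact: leq_trans (leq_addl _ _) hn.
Qed.

Lemma knn_sum_ae_cvg : {ae mu, forall z,
  n%:R^-1 * (n%:R `^ (alpha / d%:R) * knn_sum n z) @[n --> \oo] --> knn_limit}.
Proof.
apply: filterS2 trunc_mean_ae_cvg knn_exceeds_ae => z hz [N _ hN].
apply: (@interpolation_cvg R (fun n => knn_sum n z) (alpha / d%:R) knn_limit (maxn N j.+1)).
- by rewrite divr_ge0// ltW.
- by move=> n; exact: knn_sum_ge0.
- move=> m n; rewrite geq_max => /andP[Nm jm] mn.
  by apply: knn_sum_step => //; apply: hN; exact: leq_trans mn.
apply: cvg_trans hz; apply: near_eq_cvg; near=> k.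
rewrite trunc_mean_knn_sum ?expn_gt0//; apply: hN => /=.
rewrite (@leq_trans k.+1)//; last exact: leq_expS.
by rewrite ltnW// ltnS; near: k; exists N.
Unshelve. all: end_near. Qed.

(** An almost sure event on which the first [n] points form a set of exactly [n] elements, within
    distance [D] of each other. *)
Definition general_position : set (seqspace T) :=
  [set z | (forall i, supp f (z i)) /\ forall i k, i != k -> z i <> z k].

Lemma supp_ae : {ae mu, forall z : seqspace T, forall i, supp f (z i)}.
Proof.
apply: ae_foralln => i; have mS := measurable_supp mf.
exists [set z | (~` supp f) (z i)]; split => //.
  by rewrite -[X in measurable X]setTI; apply: measurable_seq_coord => //; exact: measurableC.
transitivity (F (~` supp f)); first exact: (iid_head mu_iid i (measurableC mS)).
transitivity (1 - F (supp f))%E; first exact: probability_setC.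
by rewrite (density_supp FE mf f0) subee.
Qed.

(** If the points 0 and 1 coincide, then one other point lies in the ball of radius 0, whose
    probability vanishes as [d] is positive. Exchangeability carries this to any other pair. *)
Lemma distinct_ae : {ae mu, forall z : seqspace T, forall i k, i != k -> z i <> z k}.
Proof.
pose B : set (seqspace T) := [set z | edist (z 0%N) (z 1%N) <= 0].
have mB : measurable B.
  by apply: measurable_le => //; apply: measurable_fun_edist; exact: measurable_seq_coord.
have muB : mu B = 0%E.
  rewrite -(Ex_indic mu mB); apply/eqP; rewrite eqe eq_le Ex_ge0 ?andbT//.
  have p0 x : ball_prob F x 0 <= 0.
    by rewrite (le_trans (ball_prob_le FE mf f0 x (lexx 0) fb))// expr0n (gtn_eqF d0) mulr0.
  have := Ex_near0_sqr mu_iid 1 (lexx 0) p0; rewrite mulr0 expr0n addr0; apply: le_trans.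
  rewrite le_eqVlt; apply/orP; left; apply/eqP; congr Ex; apply/funext => z.
  have -> : \1_B z = (edist (z 0%N) (z 1%N) <= 0)%R%:R :> R.
    by rewrite indicE; congr (nat_of_bool _)%:R; apply/idP/idP => [/set_mem//|h]; exact/mem_set.
  by rewrite /near_count /= addn0 /shift /reindex; case: (_ <= _); rewrite ?expr1n ?expr0n.
apply: ae_foralln => i; apply: ae_foralln => k.
have [->|ik] := eqVneq i k; first by apply: aeW.
have sI := pair_first_inj ik.
exists (reindex (pair_first i k) @^-1` B); split.
- by rewrite -[X in measurable X]setTI; exact: measurable_reindex.
- by transitivity (mu B); [exact: (iid_reindex mu_iid sI mB)|exact: muB].
move=> z /= h; rewrite /B /reindex /=.
have -> : z i = z k by apply: contrapT => zik; apply: h.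
by rewrite edistxx.
Qed.

Lemma general_position_ae : {ae mu, forall z, general_position z}.
Proof. by apply: filterS2 supp_ae distinct_ae => z; split. Qed.

Lemma nn_sumE n z : (j < n)%N -> general_position z ->
  nn_sum j alpha z n = n%:R `^ (alpha / d%:R) * knn_sum n z.
Proof.
move=> jn [_ zI]; rewrite /nn_sum mulr_sumr; apply: eq_bigr => -[i iltn] _ /=.
rewrite nn_distE ?j0//; last first.
  by move=> u v _ _ uv; apply: contrapT => /eqP/zI; exact.
by rewrite powRM ?powR_ge0 ?knn_ge0// -powRrM [_^-1 * _]mulrC.
Qed.

Lemma knn_le_diam n z i : (j < n)%N -> (i < n)%N -> general_position z -> knn j n z i <= D.
Proof.
move=> jn iltn [zS _]; rewrite knn_le ?j0//.
rewrite (eq_count (a2 := predT)); last by move=> l; exact: fD.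
by rewrite count_predT size_others//; case: n jn {iltn}.
Qed.

(** The first term controls the truncated mean. The second takes over where the truncation is
    active: there the diameter [D] bounds every distance, so the mean is at most n^(alpha/d)
    D^alpha. *)
Definition sq_error_bound n (z : seqspace T) : R :=
  2 * (trunc_mean n z - knn_limit) ^+ 2 +
  2 * (n%:R `^ (alpha / d%:R) * D `^ alpha) ^+ 2 * \1_(knn_exceeds n) z.

Lemma sq_error_le n z : (j < n)%N -> general_position z ->
  (n%:R^-1 * nn_sum j alpha z n - knn_limit) ^+ 2 <= sq_error_bound n z.
Proof.
move=> jn gz; have n0 : (0 < n)%N by exact: leq_ltn_trans jn.
rewrite nn_sumE// /sq_error_bound indicE.
have [h|h] := pselect (knn_exceeds n z); last first.
  rewrite memNset// mulr0 addr0 trunc_mean_knn_sum//.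
  by rewrite ler_peMl ?sqr_ge0// ler1n.
rewrite mem_set// mulr1.
(* Here [0 <= t <= s <= B]: truncation only decreases the summands, and no distance exceeds [D].
   Thus replacing [s] by [t] costs at most [B]. *)
set s := n%:R^-1 * _; set t := trunc_mean n z; set B := _ `^ _ * D `^ _.
have t0 : 0 <= t by exact: trunc_mean_ge0.
have ts : t <= s.
  rewrite /t /s /(trunc_mean) ler_wpM2l ?invr_ge0// mulr_sumr; apply: ler_sum => -[i iltn] _ /=.
  have -> : n%:R `^ (alpha / d%:R) = (n%:R `^ d%:R^-1) `^ alpha :> R by rewrite -powRrM mulrC.
  rewrite -powRM ?powR_ge0 ?knn_ge0// ge0_ler_powR ?nnegrE ?(ltW alpha0) ?trunc_min_ge0//.
    by rewrite mulr_ge0 ?powR_ge0 ?knn_ge0.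
  by rewrite ge_min lexx.
have sB : s <= B.
  rewrite /s /B mulrCA ler_wpM2l ?powR_ge0// mulrC ler_pdivrMr ?ltr0n// mulr_natr.
  rewrite -[X in _ *+ X]card_ord -sumr_const; apply: ler_sum => -[i iltn] _ /=.
  rewrite ge0_ler_powR ?nnegrE ?knn_ge0 ?(ltW alpha0) ?(ltW D0)//.
  exact: knn_le_diam.
have h1 : (s - t) ^+ 2 <= B ^+ 2.
  by rewrite lerXn2r ?nnegrE ?subr_ge0 ?(le_trans t0) ?(le_trans ts)// lerBlDr (le_trans sB)// lerDl.
exact: sqr_diff_le.
Qed.

Lemma bounded_sq_error_bound n : (j < n)%N -> bounded_meas (sq_error_bound n).
Proof.
move=> jn; apply: bounded_measD; apply: bounded_measZ.
  by apply: bounded_measX; apply: bounded_measB; [exact: bounded_trunc_mean|exact: bounded_meas_cst].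
by apply: bounded_meas_indic; exact: measurable_knn_exceeds.
Qed.

Lemma sq_error_bound_cvg : Ex mu (sq_error_bound n) @[n --> \oo] --> 0.
Proof.
have a0 : 0 <= alpha / d%:R by rewrite divr_ge0// ltW.
have [C [C0 hC]] := @trunc_mean_var R d j alpha d0 j0 alpha0 F mu f b mu_iid FE mf f0 fb.
pose s := (Num.truncn (alpha / d%:R)).+1; pose B : R := D `^ alpha.
have as_ : alpha / d%:R <= s%:R by have /andP[_ /ltW] := truncn_itv a0.
(* Of the order [2 * s + 1], the part [2 * s] absorbs the squared rescaling factor n^(2 alpha/d),
   and the remaining power of [n] gives convergence to 0. *)
have [C' C'0 hC'] := knn_exceeds_le_poly d0 j0 alpha0 mu_iid FE mf f0 c0 fD fc (2 * s + 1).
pose u n : R := 2 * (C * n%:R `^ (- (3 / 4)) + (Ex mu (trunc_mean n) - knn_limit) ^+ 2) +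
  2 * B ^+ 2 * C' * n%:R `^ (- 1).
apply: (@squeeze_cvgr _ _ _ _ (fun=> 0) u).
- near=> n; have jn : (j < n)%N by near: n; exists j.+1.
  have n0 : (0 < n)%N by exact: leq_ltn_trans jn.
  have nR : 0 < n%:R :> R by rewrite ltr0n.
  rewrite Ex_ge0/=; last first.
    move=> z; apply: addr_ge0; first by apply: mulr_ge0 => //; exact: sqr_ge0.
    by apply: mulr_ge0 => //; apply: mulr_ge0 => //; exact: sqr_ge0.
  have b1 : bounded_meas (trunc_mean n) by exact: bounded_trunc_mean.
  have b2 : bounded_meas (fun z => (trunc_mean n z - knn_limit) ^+ 2).
    by apply: bounded_measX; apply: bounded_measB; [exact: b1|exact: bounded_meas_cst].
  have b3 : bounded_meas (\1_(knn_exceeds n) : seqspace T -> R).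
    by apply: bounded_meas_indic; exact: measurable_knn_exceeds.
  rewrite /sq_error_bound ExD; [|exact: bounded_measZ|exact: bounded_measZ].
  rewrite ExZ// ExZ// Ex_var// /u; apply: lerD.
    by rewrite ler_wpM2l// lerD2r; exact: hC.
  have hP : Ex mu (\1_(knn_exceeds n) : seqspace T -> R) <= C' / n%:R ^+ (2 * s + 1).
    by rewrite -lee_fin Ex_indic; [exact: hC'|exact: measurable_knn_exceeds].
  apply: (@le_trans _ _ (2 * (n%:R ^+ s * B) ^+ 2 * (C' / n%:R ^+ (2 * s + 1)))).
    have hA : (n%:R `^ (alpha / d%:R) * D `^ alpha) ^+ 2 <= (n%:R ^+ s * B) ^+ 2.
      rewrite lerXn2r ?nnegrE ?mulr_ge0 ?powR_ge0 ?exprn_ge0//.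
      by rewrite ler_wpM2r ?powR_ge0// -powR_mulrn// ler_powR// ler1n.
    apply: ler_pM; last exact: hP.
    - by apply: mulr_ge0 => //; exact: sqr_ge0.
    - by apply: Ex_ge0 => z; rewrite indicE.
    - by rewrite ler_wpM2l.
  rewrite powR_inv1// le_eqVlt; apply/orP; left; apply/eqP.
  rewrite exprD expr1 mulnC exprM; field.
  by rewrite expf_neq0 gt_eqF.
- exact: cvg_cst.
rewrite -[X in _ --> X](_ : 2 * (C * 0 + (knn_limit - knn_limit) ^+ 2) + 2 * B ^+ 2 * C' * 0 = 0); last first.
  by rewrite subrr expr0n /=; ring.
apply: cvgD; apply: cvgM; do ?exact: cvg_cst; last by apply: nat_powRN_cvg0.
apply: cvgD.
  by apply: cvgM; [exact: cvg_cst|apply: nat_powRN_cvg0].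
rewrite expr2; under eq_fun do rewrite expr2.
by apply: cvgM; apply: cvgB; do ?exact: cvg_cst; exact: trunc_mean_Ex_cvg.
Unshelve. all: end_near. Qed.

End sequence_limit.

(** * Transfer to the sample *)

(** The form suits an integrand [f] whose measurability is not established, such as the squared
    error expressed with [nn_dist]. Setting [g] to [+oo] on the null set [N] keeps its integral and
    makes the inequality hold everywhere; the integral of [f] is a supremum over simple functions
    below [f], which are then below the modified [g]. *)
Lemma le_integral_off_null d (T : measurableType d) (R : realType)
    (P : {measure set T -> \bar R}) (f g : T -> \bar R) (N : set T) :
  measurable N -> P N = 0%E -> (forall t, 0 <= f t)%E -> measurable_fun setT g ->
  (forall t, 0 <= g t)%E -> (forall t, ~ N t -> f t <= g t)%E ->
  (\int[P]_t f t <= \int[P]_t g t)%E.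
Proof.
move=> mN PN f0 mg g0 fg; pose h t : \bar R := if t \in N then +oo%E else g t.
have mh : measurable_fun setT h.
  apply: measurable_fun_ifT => //; apply: (@measurable_fun_bool _ _ _ _ true).
  rewrite setTI (_ : _ @^-1` _ = N)//.
  by apply/seteqP; split=> t /=; [move/set_mem|move/mem_set].
have -> : (\int[P]_t g t = \int[P]_t h t)%E.
  apply: ae_eq_integral => //; exists N; split => // t /=.
  by apply: contra_notP => Nt _; rewrite /h memNset.
have h0 t : (0 <= h t)%E by rewrite /h; case: ifP.
rewrite !ge0_integralTE//; apply: ereal_sup_le => _ [k hk <-]; exists k => // t.
apply: (le_trans (hk t)); rewrite /h; case: ifPn => [_|/negP nN]; first exact: leey.
by apply: fg => Nt; apply: nN; exact/mem_set.
Qed.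

Section sample_path.
Context {R : realType} {dO dT} {Omega : measurableType dO} {T : measurableType dT}.
Variables (P : probability Omega R) (X : nat -> {RV P >-> T}).

Definition sample_path (w : Omega) : seqspace T := fun k => X k w.

Lemma measurable_sample_path : measurable_fun setT sample_path.
Proof. by apply: measurable_fun_seqP => k; exact: measurable_funPT. Qed.

HB.instance Definition _ := isMeasurableFun.Build _ _ _ _ sample_path measurable_sample_path.

Lemma sample_path_iid (F : probability T R) : mutually_independent X ->
  (forall k A, measurable A -> distribution P (X k) A = F A) ->
  iid_law F (distribution P (sample_path : {RV P >-> seqspace T})).
Proof.
move=> Xind XF n A mA; change (P (sample_path @^-1` cyl n A) = (\prod_(k < n) F (A k))%E).
pose J := [fset k | k in iota 0 n]%fset.
have JE k : (k \in J) = (k < n)%N.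
  by apply/imfsetP/idP => [[l /= + ->]|kn]; [rewrite mem_iota|exists k => //=; rewrite mem_iota].
rewrite (_ : _ @^-1` _ = \bigcap_(i in [set` J]) (X i @^-1` A i)); last first.
  apply/seteqP; split=> w /= h k; first by rewrite /= JE; exact: h.
  by rewrite -JE; exact: h.
rewrite Xind// (perm_big (iota 0 n)); last first.
  apply: uniq_perm; [exact: fset_uniq|exact: iota_uniq|].
  by move=> k; rewrite -[LHS]/(k \in J) JE mem_iota.
rewrite -(big_mkord xpredT (fun k => F (A k))) /index_iota subn0.
by apply: eq_bigr => k _; exact: XF.
Qed.

Lemma ae_sample_path (Q : seqspace T -> Prop) :
  {ae distribution P (sample_path : {RV P >-> seqspace T}), forall z, Q z} ->
  {ae P, forall w, Q (sample_path w)}.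
Proof.
move=> [N [mN N0 sub]]; exists (sample_path @^-1` N); split => //.
  by rewrite -[X in measurable X]setTI; exact: measurable_sample_path.
by move=> w /= h; apply: sub.
Qed.

End sample_path.

Theorem theorem1 (R : realType) (disp : measure_display)
  (Omega : measurableType disp) (P : probability Omega R)
  (d j : nat) (d_gt0 : (0 < d)%N) (j_gt0 : (0 < j)%N)
  (alpha : R) (alpha_gt0 : 0 < alpha)
  (f : 'rV[R]_d -> R) (f_pdf : is_pdf f)
  (f_supp : convex_body_union (supp f))
  (f_bounds : bounded_away_on_supp f)
  (X : nat -> {RV P >-> 'rV[R]_d})
  (X_indep : mutually_independent X)
  (X_density : forall i, has_density (X i) f) :
  let S (n : nat) (w : Omega) : R :=
    nn_sum j alpha (fun i => X i w) n in
  let L : \bar R :=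
    ((unit_ball_volume d `^ (- (alpha / d%:R))
      * (Gamma (j%:R + alpha / d%:R) / Gamma j%:R))%:E
     * I_rho (1 - alpha / d%:R) f)%E in
  (Lnorm P 2%:E (fun w => (n%:R^-1 * S n w)%:E - L)%E @[n --> \oo] --> 0%E) /\
  {ae P, forall w, (n%:R^-1 * S n w)%:E @[n --> \oo] --> L}.
Proof.
move=> S L; have [mf f0 _] := f_pdf; have [a [b' [a0 fab]]] := f_bounds.
(* The given upper bound holds on the support only; outside it [f] is at most 0. *)
pose b := Num.max b' 0; have fb x : f x <= b.
  have [fx|fx] := ltP 0 (f x); last by rewrite le_max fx orbT.
  by rewrite le_max; have /andP[_ ->] := fab x fx.
have fa x : supp f x -> a <= f x by move=> /fab/andP[].
have [M [_ [M0 _ fM _]]] := convex_body_union_cubes f_supp.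
pose F : probability 'rV[R]_d R := distribution P (X 0%N).
have FE A : measurable A -> F A = (\int[@lebesgue_rV R d]_(x in A) (f x)%:E)%E by exact: X_density.
have [c [D [c0 D0 fD fc]]] := ball_prob_lower FE mf d_gt0 f_supp a0 fa.
pose mu : probability (seqspace 'rV[R]_d) R := distribution P (sample_path X : {RV P >-> seqspace 'rV[R]_d}).
have mu_iid : iid_law F mu.
  apply: sample_path_iid => // k A mA; rewrite FE//; exact: X_density.
pose l := knn_limit j alpha F f.
(* The integrability of the limit tail shows that the extended real [L] is finite, so that both
   convergences reduce to real ones. *)
have LE : L = l%:E.
  have [iq _] := trunc_Ex_cvg d_gt0 j_gt0 alpha_gt0 mu_iid FE mf f0 fb M0 fM c0 fD fc.
  rewrite /l /knn_limit fineK; last exact: integrable_fin_num.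
  rewrite (knn_limit_tail_integral d_gt0 j_gt0 alpha_gt0 FE mf f0).
  by rewrite -unit_ball_volumeE.
have gp := general_position_ae d_gt0 mu_iid FE mf f0 fb.
rewrite LE; split; last first.
  apply: (ae_sample_path (Q := fun z => (n%:R^-1 * nn_sum j alpha z n)%:E @[n --> \oo] --> l%:E)).
  have kc := knn_sum_ae_cvg d_gt0 j_gt0 alpha_gt0 mu_iid FE mf f0 fb M0 fM c0 fD fc.
  apply: filterS (filterI gp kc) => z [gz hz].
  apply: cvg_EFin; first by apply: nearW.
  apply: cvg_trans hz; apply: near_eq_cvg; near=> n; rewrite /= (nn_sumE alpha j_gt0 _ gz)//.
  by near: n; exists j.+1.
(* Off the null set [N] the squared error is at most [H n] evaluated at the sample path; its
   integral is then computed under the law [mu]. *)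
have [N [mN N0 sub]] := ae_sample_path gp.
pose H n := sq_error_bound j alpha F f D n.
have Hcvg : Ex mu (H n) @[n --> \oo] --> 0.
  exact: (sq_error_bound_cvg d_gt0 j_gt0 alpha_gt0 mu_iid FE mf f0 fb M0 fM c0 fD fc).
apply: (@squeeze_cvge _ _ _ _ (cst 0%E) _ (fun n => (Num.sqrt (Ex mu (H n)))%:E)).
- near=> n; have jn : (j < n)%N by near: n; exists j.+1.
  have bH : bounded_meas (H n) by exact: bounded_sq_error_bound.
  have H0 z : 0 <= H n z.
    apply: addr_ge0; first by apply: mulr_ge0 => //; exact: sqr_ge0.
    by apply: mulr_ge0 => //; apply: mulr_ge0 => //; exact: sqr_ge0.
  rewrite Lnorm_ge0/= unlock.
  have -> : (Num.sqrt (Ex mu (H n)))%:E = ((Ex mu (H n))%:E `^ 2^-1)%E.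
    by rewrite poweR_EFin powR12_sqrt// Ex_ge0.
  apply: gt0_ler_poweR; rewrite ?in_itv/= ?leey ?andbT ?invr_ge0//.
  + by apply: integral_ge0 => w _; rewrite lee_fin powR_ge0.
  + by rewrite lee_fin Ex_ge0.
  have mHE : measurable_fun setT (EFin \o H n) by apply/measurable_EFinP; case: bH.
  apply: (@le_trans _ _ (\int[P]_w (H n (sample_path X w))%:E)%E).
    apply: (le_integral_off_null mN N0) => [w||w|w Nw].
    * by rewrite lee_fin powR_ge0.
    * exact: (measurableT_comp mHE (measurable_sample_path X)).
    * by rewrite lee_fin.
    have gw : general_position f (sample_path X w) by apply: contrapT => h; apply: Nw; exact: sub.
    rewrite lee_fin powR_mulrn// real_normK ?num_real//.

    exact: (sq_error_le j_gt0 alpha_gt0 F D0 fD jn gw).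
  rewrite EFin_Ex//.
  rewrite le_eqVlt; apply/orP; left; apply/eqP/esym.
  apply: (ge0_integral_distribution (sample_path X : {RV P >-> seqspace 'rV[R]_d}) mHE) => z.
  by rewrite lee_fin.
- exact: cvg_cst.
apply: cvg_EFin; first by apply: nearW.
rewrite -[X in _ --> X](@sqrtr0 R).
apply: (@cvg_comp _ _ _ (fun n => Ex mu (H n)) Num.sqrt _ (nbhs (0 : R))); first exact: Hcvg.
exact: sqrt_continuous.
Unshelve. all: end_near. Qed.
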